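(* Let $K$ be a number field, and let $A$ be an abelian variety defined over $K$ satisfying $A(K)=0$. Let $\mathfrak{p}$ be a finite prime of $\mathcal{O}_K$ of good reduction for $A$. Let $L/K$ be an extension of degree $m$. Suppose that (i) $\mathfrak{p}$ is totally ramified in $L$; (ii) $\gcd(\# A(\mathbb{F}_{\mathfrak{p}}),m)=1$. Then $A(L) \subseteq A^1(L_{\mathfrak{P}})$, where $\mathfrak{P}$ is the unique prime of $\mathcal{O}_L$ above $\mathfrak{p}$. In particular, $(A\setminus 0)(\mathcal{O}_{L,S})=\emptyset$ for any set of places $S$ of $L$ not containing $\mathfrak{P}$.
   Context: For a number field $L$, $\mathcal{O}_L$ is its ring of integers; for a set $S$ of places of $L$, $\mathcal{O}_{L,S}$ is the ring of $S$-integers of $L$ (elements integral at all finite primes not in $S$). For a finite prime $\mathfrak{P}$ of $\mathcal{O}_L$, $\mathbb{F}_{\mathfrak{P}}=\mathcal{O}_L/\mathfrak{P}$ is the residue field and $L_{\mathfrak{P}}$ is the completion of $L$ at $\mathfrak{P}$ (similarly for $K$, $\mathfrak{p}$). If $A$ has good reduction at $\mathfrak{P}$, $A^1(L_{\mathfrak{P}})$ denotes the kernel of the reduction map $A(L_{\mathfrak{P}})\to A(\mathbb{F}_{\mathfrak{P}})$. Here $A(\mathbb{F}_{\mathfrak{p}})$ is the group of $\mathbb{F}_{\mathfrak{p}}$-points of the reduction of $A$ at $\mathfrak{p}$. $0\in A$ is the origin. $(A\setminus 0)(\mathcal{O}_{L,S})$ denotes the set of $S$-integral points of $A$ punctured at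 $0$: the set of $Q\in A(L)$ with $Q\neq 0$ such that for every finite prime $\mathfrak{Q}\notin S$ of $\mathcal{O}_L$, the reduction of $Q$ at $\mathfrak{Q}$ (in the special fibre of the Néron model of $A$ over $\mathcal{O}_L$) is not equal to the reduction of $0$; at primes of good reduction this says $Q\notin A^1(L_{\mathfrak{Q}})$. *)

(* Defs.v *)
From HB Require Import structures.
From mathcomp Require Import all_boot all_order all_algebra all_field.
From mathcomp Require Import boolp classical_sets functions cardinality.

Set Implicit Arguments.
Unset Strict Implicit.
Unset Printing Implicit Defensive.

Import Order.TTheory GRing.Theory Num.Theory.
Local Open Scope ring_scope.

(* Schemes are treated through their functors of points, as in Demazure and
   Gabriel: a scheme over a commutative ring k is a Zariski sheaf on the
   category of commutative k-algebras (the zero algebra included) which is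
   covered by affine open subfunctors.  A field-valued point stands for a point
   of the underlying space: two such points define the same one when they agree
   over a common field extension. *)

(** * Ideals *)

Definition span (R : comPzRingType) (S : set R) : set R := fun x =>
  exists n (a b : 'I_n -> R), (forall i, S (b i)) /\ x = \sum_i a i * b i.

Record ideal (R : comPzRingType) (I : set R) : Prop := Ideal {
  ideal0 : I 0;
  idealD : forall x y, I x -> I y -> I (x + y);
  idealM : forall a x, I x -> I (a * x) }.

Record prime_ideal (R : comPzRingType) (I : set R) : Prop := PrimeIdeal {
  prime_is_ideal : ideal I;
  prime_proper : ~ I 1;
  prime_mul : forall x y, I (x * y) -> I x \/ I y }.

Fixpoint ideal_pow (R : comPzRingType) (I : set R) (n : nat) : set R :=
  if n is n'.+1 then
    span (fun x => exists a b, [/\ I a, ideal_pow I n' b & x = a * b])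
  else setT.

Definition is_residue_field (R : comPzRingType) (I : set R) (F : fieldType)
    (r : {rmorphism R -> F}) : Prop :=
  (forall y, exists x, r x = y) /\ (forall x, r x = 0 <-> I x).

(** * Algebras over a commutative ring *)

Record kalg (k : comPzRingType) := KAlg {
  carrier :> comPzRingType;
  str : {rmorphism k -> carrier} }.

Record hom (k : comPzRingType) (A B : kalg k) := Hom {
  hom_fun :> {rmorphism A -> B};
  hom_str : forall c, hom_fun (str A c) = str B c }.

Definition self (k : comPzRingType) : kalg k := KAlg idfun.

Definition str_hom (k : comPzRingType) (B : kalg k) : hom (self k) B :=
  @Hom k (self k) B (str B) (fun=> erefl).

Definition restr (k k' : comPzRingType) (phi : {rmorphism k -> k'})
  (B : kalg k') : kalg k := KAlg (str B \o phi).

Definition restr_hom (k k' : comPzRingType) (phi : {rmorphism k -> k'})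
    (A B : kalg k') (f : hom A B) : hom (restr phi A) (restr phi B) :=
  @Hom k (restr phi A) (restr phi B) f (fun c => hom_str f (phi c)).

(** * Functors of points *)

(* The two laws say as well that [fmap f] depends only on the values of [f]. *)
Record functor (k : comPzRingType) := Functor {
  obj :> kalg k -> Type;
  fmap : forall A B, hom A B -> obj A -> obj B;
  fmap_id : forall A (f : hom A A) x, f =1 id -> fmap f x = x;
  fmap_comp : forall A B C (f : hom A B) (g : hom B C) (h : hom A C) x,
    h =1 g \o f -> fmap h x = fmap g (fmap f x) }.

Definition base_change (k k' : comPzRingType) (phi : {rmorphism k -> k'})
    (X : functor k) : functor k' :=
  @Functor k' (fun B => X (restr phi B))
    (fun A B f => fmap (restr_hom phi f))
    (fun A f x fE => @fmap_id k X _ (restr_hom phi f) x fE)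
    (fun A B C f g h x hE => @fmap_comp k X _ _ _
       (restr_hom phi f) (restr_hom phi g) (restr_hom phi h) x hE).

Record morphism (k : comPzRingType) (X Y : functor k) := Morphism {
  mor :> forall B, X B -> Y B;
  mor_nat : forall A B (f : hom A B) x, mor (fmap f x) = fmap f (mor x) }.

Definition isomorphism (k : comPzRingType) (X Y : functor k)
  (u : morphism X Y) : Prop := forall B, bijective (@mor k X Y u B).

Section Geometry.
Variable k : comPzRingType.
Implicit Type X : functor k.

Definition subfunctor X := forall B, set (X B).

(* U is open when, for every x : Spec A -> X, the preimage of U is the
   complement of V(I) for some subset I of A. *)
Definition is_open X (U : subfunctor X) : Prop :=
  forall A (x : X A), exists I : set A,
  forall B (f : hom A B), U B (fmap f x) <-> span (f @` I)%classic 1.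

(* B represents U, with universal point u *)
Definition represents X (U : subfunctor X) (B : kalg k) (u : X B) : Prop :=
  U B u /\ forall C (x : X C), U C x ->
    exists f : hom B C, fmap f u = x /\ forall g, fmap g u = x -> g =1 f.

Definition is_affine X (U : subfunctor X) (P : kalg k -> Prop) : Prop :=
  exists B (u : X B), represents U u /\ P B.

Definition is_localization (A B : kalg k) (f : A) (phi : hom A B) : Prop :=
  [/\ exists u, u * phi f = 1,
      forall b, exists n a, b * phi f ^+ n = phi a &
      forall a, phi a = 0 -> exists n, f ^+ n * a = 0].

Definition zariski_sheaf X : Prop :=
  forall (A : kalg k) n (f : 'I_n -> A), span (range f) 1 ->
  forall (B : 'I_n -> kalg k) (phi : forall i, hom A (B i)),
    (forall i, is_localization (f i) (phi i)) ->
  forall x : forall i, X (B i),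
    (forall i j C (g : hom (B i) C) (h : hom (B j) C),
       g \o phi i =1 h \o phi j -> fmap g (x i) = fmap h (x j)) ->
  exists! y : X A, forall i, fmap (phi i) y = x i.

Definition covered_by_affines X (P : kalg k -> Prop) : Prop :=
  forall (E : fieldType) (e : {rmorphism k -> E}) (x : X (KAlg e)),
  exists U : subfunctor X, [/\ is_open U, is_affine U P & U (KAlg e) x].

Definition is_scheme X : Prop :=
  zariski_sheaf X /\ covered_by_affines X (fun=> True).

(** * Finiteness conditions *)

(* polynomials over k in n variables, as formal expressions *)
Inductive pexpr (n : nat) : Type :=
  | Const of k
  | Var of 'I_n
  | Add of pexpr n & pexpr n
  | Mul of pexpr n & pexpr n.

Fixpoint peval n (B : kalg k) (b : 'I_n -> B) (e : pexpr n) : B :=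
  match e with
  | Const c => str B c
  | Var i => b i
  | Add e1 e2 => peval b e1 + peval b e2
  | Mul e1 e2 => peval b e1 * peval b e2
  end.

Definition finitely_generated (B : kalg k) : Prop :=
  exists n (b : 'I_n -> B), forall y, exists e, peval b e = y.

(* B = k[X_1, .., X_n] / (f_1, .., f_m), by the universal property *)
Definition finitely_presented (B : kalg k) : Prop :=
  exists n m (f : 'I_m -> pexpr n) (b : 'I_n -> B),
    (forall j, peval b (f j) = 0) /\
    forall (C : kalg k) (c : 'I_n -> C), (forall j, peval c (f j) = 0) ->
      exists g : hom B C, (forall i, g (b i) = c i) /\
        forall h : hom B C, (forall i, h (b i) = c i) -> h =1 g.

Definition finite_type X : Prop :=
  exists n (U : 'I_n -> subfunctor X),
    (forall i, is_open (U i) /\ is_affine (U i) finitely_generated) /\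
    forall (E : fieldType) (e : {rmorphism k -> E}) (x : X (KAlg e)),
      exists i, U i (KAlg e) x.

(** * Smooth, separated and proper morphisms to Spec k *)

Definition formally_smooth X : Prop :=
  forall (C C0 : kalg k) (g : hom C C0), (forall y, exists x, g x = y) ->
    (forall x y, g x = 0 -> g y = 0 -> x * y = 0) ->
  forall x0 : X C0, exists x : X C, fmap g x = x0.

Definition is_smooth X : Prop :=
  covered_by_affines X finitely_presented /\ formally_smooth X.

(* the diagonal is a closed immersion *)
Definition is_separated X : Prop :=
  forall A (x y : X A), exists I : set A,
  forall B (f : hom A B), fmap f x = fmap f y <-> forall a, I a -> f a = 0.

End Geometry.

(* For every k-algebra B, the map from the space of X_B to that of Spec B is
   closed: the image of the complement of an open U is some V(J).  The kernel
   of e is a typical point of Spec B; it lies in that image if and only if,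
   after extending the field E, it lifts to a point of X_B not in U. *)
Definition universally_closed (k : comPzRingType) (X : functor k) : Prop :=
  forall (B : kalg k) (U : subfunctor (base_change (str B) X)), is_open U ->
  exists J : set B, forall (E : fieldType) (e : {rmorphism B -> E}),
    (forall b, J b -> e b = 0) <->
    exists (E' : fieldType) (i : {rmorphism E -> E'})
           (x : base_change (str B) X (KAlg (i \o e))), ~ U (KAlg (i \o e)) x.

Definition is_proper (k : comPzRingType) (X : functor k) : Prop :=
  [/\ finite_type X, is_separated X & universally_closed X].

Definition is_connected (k : comPzRingType) (X : functor k) : Prop :=
  forall U V : subfunctor X, is_open U -> is_open V ->
    (forall (E : fieldType) (e : {rmorphism k -> E}) (x : X (KAlg e)),
       (U (KAlg e) x \/ V (KAlg e) x) /\ ~ (U (KAlg e) x /\ V (KAlg e) x)) ->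
  (forall (E : fieldType) (e : {rmorphism k -> E}) x, U (KAlg e) x) \/
  (forall (E : fieldType) (e : {rmorphism k -> E}) x, V (KAlg e) x).

Definition geometrically_connected_fibres (k : comPzRingType) (X : functor k) :=
  forall (E : fieldType) (e : {rmorphism k -> E}),
    is_connected (base_change e X).

(** * Abelian schemes *)

Record group_functor (k : comPzRingType) := GroupFunctor {
  points : kalg k -> zmodType;
  gmap : forall A B, hom A B -> {additive points A -> points B};
  gmap_id : forall A (f : hom A A) x, f =1 id -> gmap f x = x;
  gmap_comp : forall A B C (f : hom A B) (g : hom B C) (h : hom A C) x,
    h =1 g \o f -> gmap h x = gmap g (gmap f x) }.

Coercion space (k : comPzRingType) (G : group_functor k) : functor k :=
  @Functor k (points G) (fun A B f => gmap G f) (@gmap_id k G) (@gmap_comp k G).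

Definition gbase_change (k k' : comPzRingType) (phi : {rmorphism k -> k'})
    (G : group_functor k) : group_functor k' :=
  @GroupFunctor k' (fun B => points G (restr phi B))
    (fun A B f => gmap G (restr_hom phi f))
    (fun A f x fE => @gmap_id k G _ (restr_hom phi f) x fE)
    (fun A B C f g h x hE => @gmap_comp k G _ _ _
       (restr_hom phi f) (restr_hom phi g) (restr_hom phi h) x hE).

(* Over a field this is the notion of an abelian variety.  Commutativity, which
   is automatic by the rigidity lemma, is part of [group_functor]. *)
Definition abelian_scheme (k : comPzRingType) (A : group_functor k) : Prop :=
  [/\ is_scheme A, is_smooth A, is_proper A &
      geometrically_connected_fibres A].

(** * Subrings of fields *)

Record subring (E : fieldType) := Subring {
  in_subring :> E -> Prop;
  subring1 : in_subring 1;
  subringB : forall x y, in_subring x -> in_subring y -> in_subring (x - y);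
  subringM : forall x y, in_subring x -> in_subring y -> in_subring (x * y) }.

Definition subring_pred (E : fieldType) (S : subring E) : {pred E} :=
  fun x => `[< S x >].

Lemma subring_pred_closed (E : fieldType) (S : subring E) :
  subring_closed (subring_pred S).
Proof.
split; first by apply/asboolP; exact: subring1.
- by move=> x y /asboolP Sx /asboolP Sy; apply/asboolP; exact: subringB.
- by move=> x y /asboolP Sx /asboolP Sy; apply/asboolP; exact: subringM.
Qed.

HB.instance Definition _ (E : fieldType) (S : subring E) :=
  GRing.isSubringClosed.Build E (subring_pred S) (subring_pred_closed S).

Record subring_type (E : fieldType) (S : subring E) := SubringType {
  elt : E;
  elt_in : elt \in subring_pred S }.

HB.instance Definition _ (E : fieldType) (S : subring E) :=
  [isSub for @elt E S].
HB.instance Definition _ (E : fieldType) (S : subring E) :=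
  [Choice of subring_type S by <:].
HB.instance Definition _ (E : fieldType) (S : subring E) :=
  [SubChoice_isSubComNzRing of subring_type S by <:].

Coercion subring_type : subring >-> Sortclass.

Definition incl (E : fieldType) (S : subring E) : {rmorphism S -> E} :=
  (val : S -> E).

Lemma inclP (E : fieldType) (S : subring E) (x : S) : S (incl S x).
Proof. exact/asboolP/(valP x). Qed.

Section SubringMap.
Variables (E E' : fieldType) (S : subring E) (T : subring E').
Variables (phi : {rmorphism E -> E'}).
Hypothesis ST : forall x, S x -> T (phi x).

Definition subring_map_fun (x : S) : T :=
  SubringType (asboolT (ST (inclP x))).

Lemma subring_map_is_zmod_morphism : zmod_morphism subring_map_fun.
Proof. by move=> x y; apply: val_inj; rewrite /= !rmorphB. Qed.

Lemma subring_map_is_monoid_morphism : monoid_morphism subring_map_fun.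
Proof.
by split=> [|x y]; apply: val_inj; rewrite /= ?rmorph1 ?rmorphM.
Qed.

HB.instance Definition _ :=
  GRing.isZmodMorphism.Build S T subring_map_fun subring_map_is_zmod_morphism.
HB.instance Definition _ :=
  GRing.isMonoidMorphism.Build S T subring_map_fun subring_map_is_monoid_morphism.

Definition subring_map : {rmorphism S -> T} := subring_map_fun.

End SubringMap.

(** * Rings of integers and their primes *)

Definition ring_of_integers (F : fieldType) : subring F :=
  @Subring F (integralOver (intr : int -> F))
    (integral1 (intr : int -> F))
    (@integral_sub int F intr) (@integral_mul int F intr).

Notation "''O_' F" := (ring_of_integers F)
  (at level 8, F at level 2, format "''O_' F").

Record finite_prime (F : fieldType) := FinitePrime {
  prime_set :> 'O_F -> Prop;
  prime_setP : prime_ideal prime_set;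
  prime_nonzero : exists2 x, prime_set x & x <> 0 }.

Section Local.
Variables (F : fieldType) (p : finite_prime F).

Definition local_set : set F := fun x =>
  exists a s : 'O_F, ~ p s /\ x = incl _ a / incl _ s.

Lemma notin_prime_neq0 (s : 'O_F) : ~ p s -> incl _ s != 0.
Proof.
move=> ps; apply/eqP => s0; apply: ps.
have -> : s = 0 by apply: val_inj.
exact: ideal0 (prime_is_ideal (prime_setP p)).
Qed.

Lemma notin_primeM (s t : 'O_F) : ~ p s -> ~ p t -> ~ p (s * t).
Proof. by move=> ps pt /(prime_mul (prime_setP p))[]. Qed.

Lemma local_set1 : local_set 1.
Proof.
by exists 1, 1; split; [exact: prime_proper (prime_setP p)|rewrite rmorph1 divr1].
Qed.

Lemma local_setB x y : local_set x -> local_set y -> local_set (x - y).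
Proof.
move=> [a [s [ps ->]]] [b [t [pt ->]]].
exists (a * t - b * s), (s * t); split; first exact: notin_primeM.
have s0 := notin_prime_neq0 ps; have t0 := notin_prime_neq0 pt.
by rewrite -mulNr addf_div // rmorphB !rmorphM mulNr.
Qed.

Lemma local_setM x y : local_set x -> local_set y -> local_set (x * y).
Proof.
move=> [a [s [ps ->]]] [b [t [pt ->]]].
exists (a * b), (s * t); split; first exact: notin_primeM.
by rewrite !rmorphM mulf_div.
Qed.

(* the localization of the ring of integers of F at p *)
Definition local_ring : subring F := Subring local_set1 local_setB local_setM.

Lemma integers_in_local x : 'O_F x -> local_ring (idfun x).
Proof.
move=> Ox; exists (SubringType (asboolT Ox)), 1.
by split; [exact: prime_proper (prime_setP p)|rewrite rmorph1 divr1].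
Qed.

Definition to_local : {rmorphism 'O_F -> local_ring} :=
  subring_map integers_in_local.

End Local.

(* An infinite place is a pair of conjugate embeddings, here given by either of
   them; the ring of S-integers depends only on the finite places in S. *)
Inductive place (F : fieldType) : Type :=
  | FinitePlace of finite_prime F
  | InfinitePlace of {rmorphism F -> algC}.

Section Extension.
Variables (K : fieldType) (L : fieldExtType K).
Variable (p : finite_prime K).

Definition lies_over (P : finite_prime L) : Prop :=
  forall (x : 'O_K) (y : 'O_L), incl _ y = (incl _ x)%:A -> (P y <-> p x).

Definition extended_ideal : set 'O_L :=
  span (fun y : 'O_L => exists2 x : 'O_K, p x & incl _ y = (incl _ x)%:A).

Definition totally_ramified : Prop :=
  exists P : finite_prime L, extended_ideal = ideal_pow P (\dim {:L}).

End Extension.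

(** * Completions *)

(* The completion of L at P, with its normalized discrete valuation extending
   the P-adic one; the value of [cval] at 0 is irrelevant. *)
Record completion (L : fieldType) (P : finite_prime L) := Completion {
  cfield :> fieldType;
  cemb : {rmorphism L -> cfield};
  cval : cfield -> int;
  cvalM : forall x y, x != 0 -> y != 0 -> cval (x * y) = cval x + cval y;
  cvalD : forall x y, x != 0 -> y != 0 -> x + y != 0 ->
    Num.min (cval x) (cval y) <= cval (x + y);
  cval_emb : forall x : 'O_L, x != 0 ->
    forall n : nat, n%:Z <= cval (cemb (incl _ x)) <-> ideal_pow P n x;
  cdense : forall x (n : int),
    exists a : L, x - cemb a = 0 \/ n <= cval (x - cemb a);
  ccomplete : forall u : nat -> cfield,
    (forall n : int, exists N : nat, forall i j, (N <= i)%N -> (N <= j)%N ->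
       u i - u j = 0 \/ n <= cval (u i - u j)) ->
    exists l, forall n : int, exists N : nat, forall i, (N <= i)%N ->
       u i - l = 0 \/ n <= cval (u i - l) }.

Section ValuationRing.
Variables (L : fieldType) (P : finite_prime L) (C : completion P).

Definition valuation_set : set C := fun x => x = 0 \/ 0 <= cval x.

Lemma cval1 : cval (1 : C) = 0.
Proof.
apply: (@addrI _ (cval (1 : C))).
by rewrite -cvalM ?oner_eq0 // mulr1 addr0.
Qed.

Lemma valuation_set1 : valuation_set 1.
Proof. by right; rewrite cval1. Qed.

Lemma valuation_setM x y :
  valuation_set x -> valuation_set y -> valuation_set (x * y).
Proof.
move=> [->|vx]; first by left; rewrite mul0r.
move=> [->|vy]; first by left; rewrite mulr0.
have [->|x0] := eqVneq x 0; first by left; rewrite mul0r.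
have [->|y0] := eqVneq y 0; first by left; rewrite mulr0.
by right; rewrite cvalM // addr_ge0.
Qed.

Lemma cvalN1 : cval (-1 : C) = 0.
Proof.
have: cval (-1 : C) + cval (-1 : C) = 0.
  by rewrite -cvalM ?oppr_eq0 ?oner_eq0 // mulrNN mulr1 cval1.
by rewrite -mulr2n => /eqP; rewrite mulrn_eq0 /= => /eqP.
Qed.

Lemma valuation_setB x y :
  valuation_set x -> valuation_set y -> valuation_set (x - y).
Proof.
move=> Vx Vy; have {Vy} : valuation_set (- y).
  by rewrite -mulN1r; apply: valuation_setM => //; right; rewrite cvalN1.
move: (- y) => z Vz; case: (Vx) => [->|vx]; first by rewrite add0r.
case: (Vz) => [->|vz]; first by rewrite addr0.
have [->|x0] := eqVneq x 0; first by rewrite add0r.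
have [->|z0] := eqVneq z 0; first by rewrite addr0.
have [->|xz0] := eqVneq (x + z) 0; first by left.
by right; apply: le_trans (cvalD x0 z0 xz0); rewrite le_min vx vz.
Qed.

Definition valuation_ring : subring C :=
  Subring valuation_set1 valuation_setB valuation_setM.

Lemma integers_in_valuation x : 'O_L x -> valuation_ring (cemb C x).
Proof.
move=> Ox; pose y : 'O_L := SubringType (asboolT Ox).
have [y0|y0] := eqVneq y 0.
  by left; rewrite (_ : x = incl _ y) // y0 !rmorph0.
by right; apply/(cval_emb C y0 0%N).
Qed.

Definition to_valuation_ring : {rmorphism 'O_L -> valuation_ring} :=
  subring_map integers_in_valuation.

End ValuationRing.

Section LocalMap.
Variables (K : fieldType) (L : fieldExtType K).
Variables (p : finite_prime K) (P : finite_prime L) (C : completion P).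
Hypothesis Pp : lies_over p P.

Definition emb_base : {rmorphism K -> C} := cemb C \o in_alg L.

Lemma integers_ext (x : 'O_K) : 'O_L (incl _ x)%:A.
Proof.
have [q q_monic q_root] := inclP x.
exists q => //; have := rmorph_root (in_alg L) q_root.
rewrite -map_poly_comp -(@eq_map_poly _ _ intr) //.
by move=> z; symmetry; exact: (rmorph_int (in_alg L) z).
Qed.

Lemma ideal_pow1 (y : 'O_L) : ideal_pow P 1 y -> P y.
Proof.
have [P0 PD PM] := prime_is_ideal (prime_setP P).
move=> [n [a [b [Pb ->]]]]; elim/big_rec: _ => // i z _ Pz.
apply: PD => //; apply: (PM); have [c [d [Pc _ ->]]] := Pb i.
by rewrite mulrC; exact: PM.
Qed.

Lemma local_in_valuation x :
  local_ring p x -> valuation_ring C (emb_base x).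
Proof.
move=> [a [s [ps ->]]].
pose a' : 'O_L := SubringType (asboolT (integers_ext a)).
pose s' : 'O_L := SubringType (asboolT (integers_ext s)).
have Ps' : ~ P s' by move=> /(Pp (x := s) (y := s') erefl).
have s0 := notin_prime_neq0 Ps'.
have es0 : cemb C (incl _ s') != 0 by rewrite fmorph_eq0.
have -> : emb_base (incl _ a / incl _ s) =
    cemb C (incl _ a') * (cemb C (incl _ s'))^-1.
  by rewrite fmorph_div.
apply: valuation_setM.
  exact: integers_in_valuation (inclP a').
right; suff -> : cval (cemb C (incl _ s'))^-1 = 0 by [].
have s'0 : s' != 0 by apply: contraNneq s0 => ->; rewrite rmorph0.
have vs : cval (cemb C (incl _ s')) = 0.
  apply/eqP; rewrite eq_le; apply/andP; split.
    rewrite leNgt; apply/negP => v_gt0; apply: Ps'.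
    by apply: ideal_pow1; apply/(cval_emb C s'0 1%N).
  by apply/(cval_emb C s'0 0%N).
by rewrite -[LHS]add0r -[in LHS]vs -cvalM ?invr_eq0 // divff // cval1.
Qed.

Definition local_to_valuation : {rmorphism local_ring p -> valuation_ring C} :=
  subring_map local_in_valuation.

End LocalMap.

(** * Good reduction *)

Definition extend_scalars (K : fieldType) (L : fieldExtType K)
    (A : group_functor K) : group_functor (L : fieldType) :=
  gbase_change (in_alg L) A.

(* an abelian scheme over the local ring of p with generic fibre A *)
Record good_model (K : fieldType) (A : group_functor K)
    (p : finite_prime K) := GoodModel {
  model : group_functor (local_ring p);
  model_abelian : abelian_scheme model;
  generic_fibre : forall B : kalg K,
    {additive points (gbase_change (incl (local_ring p)) model) B -> points A B};
  generic_fibre_nat : forall B B' (f : hom B B') x,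
    generic_fibre B' (gmap _ f x) = gmap A f (generic_fibre B x);
  generic_fibre_bij : forall B, bijective (generic_fibre B) }.

Section KernelOfReduction.
Variables (K : fieldType) (A : group_functor K) (p : finite_prime K).
Variables (M : good_model A p) (L : fieldExtType K) (P : finite_prime L).
Hypothesis Pp : lies_over p P.
Variables (C : completion P) (kP : fieldType).
Variable (r : {rmorphism valuation_ring C -> kP}).

Let V : kalg (local_ring p) := KAlg (local_to_valuation C Pp).

Definition valuation_to_residue : hom V (restr (str V) (KAlg r)) :=
  @Hom _ V (restr (str V) (KAlg r)) r (fun=> erefl).

Definition valuation_to_field :
  hom V (restr (incl _) (restr (in_alg L) (KAlg (cemb C)))) :=
  @Hom _ V (restr (incl _) (restr (in_alg L) (KAlg (cemb C))))
    (incl (valuation_ring C)) (fun=> erefl).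

(* A point of A over the completion belongs to the kernel if the point of the
   model over the valuation ring which extends it reduces to 0 (this point is
   unique, the model being separated). *)
Definition kernel_of_reduction : set (points (extend_scalars L A) (KAlg (cemb C))) := fun x =>
  exists y : points (model M) V,
    generic_fibre M (restr (in_alg L) (KAlg (cemb C)))
      (gmap (model M) valuation_to_field y) = x /\
    gmap (model M) valuation_to_residue y = 0.

End KernelOfReduction.

(** * Neron models and integral points *)

Section Neron.
Variables (L : fieldType) (A : group_functor L).

Record neron_model := NeronModel {
  neron : functor 'O_L;
  neron_scheme : is_scheme neron;
  neron_smooth : is_smooth neron;
  neron_separated : is_separated neron;
  neron_finite_type : finite_type neron;
  neron_generic : morphism (base_change (incl 'O_L) neron) A;
  neron_generic_iso : isomorphism neron_generic;
  neron_mapping : forall Y : functor 'O_L, is_scheme Y -> is_smooth Y ->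
    forall u : morphism (base_change (incl 'O_L) Y) A,
    exists w : morphism Y neron,
      (forall B (y : base_change (incl 'O_L) Y B),
         neron_generic B (w (restr (incl 'O_L) B) y) = u B y) /\
      forall w' : morphism Y neron,
        (forall B (y : base_change (incl 'O_L) Y B),
           neron_generic B (w' (restr (incl 'O_L) B) y) = u B y) ->
        forall B y, w' B y = w B y }.

Variable N : neron_model.

Definition extends (q : neron N (self 'O_L)) (Q : points A (self L)) : Prop :=
  neron_generic N (self L)
    (fmap (str_hom (restr (incl 'O_L) (self L))) q) = Q.

(* the points of A(L) other than 0 whose reduction differs from that of 0 at
   every finite prime outside S *)
Definition punctured_integral_points (S : set (place L)) :
    set (points A (self L)) := fun Q =>
  Q <> 0 /\
  forall q : finite_prime L, ~ S (FinitePlace q) ->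
  exists Q' O' : neron N (self 'O_L), [/\ extends Q' Q, extends O' 0 &
    forall (kq : fieldType) (r : {rmorphism 'O_L -> kq}),
      is_residue_field q r ->
      fmap (str_hom (KAlg r)) Q' <> fmap (str_hom (KAlg r)) O'].

End Neron.

(* Main.v *)
(* Let Q be in A(L).  As L is totally ramified at P, every K-embedding of L in a
   Galois closure N pulls a fixed prime of N over p back to P, and the residue
   field of P is that of p; hence all conjugates of Q have the same reduction as
   Q, which is a point of A over the residue field of p.  The sum of the m
   conjugates is in A(K) = 0, so that m kills the reduction of Q.  Since the
   order n of the group of points over the residue field is prime to m, the
   reduction is 0. *)
Require Import Defs.
From HB Require Import structures.
From mathcomp Require Import all_boot all_order all_algebra all_field.
From mathcomp Require Import boolp classical_sets functions cardinality.
From mathcomp Require Import fingroup ring.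
Import Defs.

Set Implicit Arguments.
Unset Strict Implicit.
Unset Printing Implicit Defensive.

Import Order.TTheory GRing.Theory Num.Theory.
Local Open Scope ring_scope.

(** Reductions are computed over localizations of rings of integers, and the completion enters only
    at the end, as a target of the local ring at P. Factorization of ideals is bypassed: the local
    ring is shown to be a discrete valuation ring from integer polynomial equations, and the residue
    degree is controlled by a linear relation over K among 1, pi, ..., pi ^ (m - 1), a. Conjugates
    are compared through coordinates: an x in the local ring at P is congruent to some b in the
    local ring at p, and every K-embedding fixes b. Since the model is separated, enlarging the ring
    loses no points, so relations found over larger rings descend. Integral points raise another
    obstacle: the Neron model lives over the integers of L, the abelian scheme over the local ring
    at p, and the mapping property concerns smooth schemes over the integers of L. So an affine open
    of the model containing Q and 0 is spread out, by inverting one element outside P, to a smooth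
    affine scheme there. Smoothness survives because it amounts to finitely many polynomial
    identities. *)

(** * Ideals generated by sets, and radicals *)

Section Span.
Variable R : comPzRingType.
Implicit Types (S I : set R).

Lemma ideal_sum I n (a b : 'I_n -> R) :
  ideal I -> (forall i, I (b i)) -> I (\sum_i a i * b i).
Proof.
move=> [I0 ID IM] Ib; elim/big_rec: _ => // i x _ Ix.
by apply: (ID) => //; apply: (IM).
Qed.

Lemma span_min S I : ideal I -> (forall x, S x -> I x) ->
  forall x, span S x -> I x.
Proof. by move=> idI SI x [n [a [b [Sb ->]]]]; apply: ideal_sum => // i;
  apply: SI. Qed.

Lemma span_in S x : S x -> span S x.
Proof.
move=> Sx; exists 1%N, (fun=> 1), (fun=> x); split=> //.
by rewrite big_ord1 mul1r.
Qed.

Lemma span_ideal S : ideal (span S).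
Proof.
split.
- by exists 0%N, (fun=> 0), (fun=> 0); split=> [[]|] //; rewrite big_ord0.
- move=> x y [n [a [b [Sb ->]]]] [m [c [d [Sd ->]]]].
  exists (n + m)%N.
  exists (fun i => match fintype.split i with inl j => a j | inr j => c j end).
  exists (fun i => match fintype.split i with inl j => b j | inr j => d j end).
  split=> [i|]; first by case: (fintype.split i).
  rewrite big_split_ord /=; congr (_ + _); apply: eq_bigr => i _.
    by rewrite (unsplitK (inl i)).
  by rewrite (unsplitK (inr i)).
- move=> c x [n [a [b [Sb ->]]]]; exists n, (fun i => c * a i), b; split=> //.
  by rewrite mulr_sumr; apply: eq_bigr => i _; rewrite mulrA.
Qed.

Lemma span_mono S I : (forall x, S x -> span I x) -> forall x, span S x ->
  span I x.
Proof. by move=> SI x; apply: span_min => //; apply: span_ideal. Qed.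

Definition radical I : set R := fun x => exists n, I (x ^+ n).

Lemma radical_ideal I : ideal I -> ideal (radical I).
Proof.
move=> [I0 ID IM]; split.
- by exists 1%N; rewrite expr1.
- move=> x y [n Ix] [m Iy]; exists (n + m)%N.
  rewrite exprDn; elim/big_rec: _ => // i z _ Iz; apply: (ID) => //.
  rewrite -mulr_natl; apply: (IM).
  have [mi|im] := leqP m i.
    by rewrite -[in y ^+ i](subnK mi) exprD mulrA; apply: (IM).
  have ni : (n <= n + m - i)%N by rewrite -addnBA ?leq_addr // ltnW.
  by rewrite -(subnK ni) exprD mulrC mulrA; apply: (IM).
- by move=> a x [n Ix]; exists n; rewrite exprMn; apply: (IM).
Qed.

Lemma radical1 I : radical I 1 -> I 1.
Proof. by move=> [n]; rewrite expr1n. Qed.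

(** This is how locality on a Zariski cover is used below: when S generates the unit ideal, it is
    enough to find a power of each member of S in I, which is what inverting that member yields. *)
Lemma span_radical S I : ideal I -> span S 1 ->
  (forall x, S x -> exists n, I (x ^+ n)) -> I 1.
Proof.
move=> idI S1 SI; apply: radical1.
exact: (span_min (radical_ideal idI)) S1.
Qed.

End Span.

Lemma preim_ideal (R R' : comPzRingType) (f : {rmorphism R ->
  R'}) (I : set R') :
  ideal I -> ideal (fun x => I (f x)).
Proof.
move=> [I0 ID IM]; split=> [|x y Ix Iy|a x Ix];
  rewrite ?rmorph0 ?rmorphD ?rmorphM //.
- exact: ID.
- exact: IM.
Qed.

Lemma span_image (R R' : comPzRingType) (f : {rmorphism R -> R'}) (S : set R)
  (T : set R') : (forall x, S x -> span T (f x)) ->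
  forall x, span S x -> span T (f x).
Proof.
move=> ST x; apply: (span_min (preim_ideal f (span_ideal T))) => //.
Qed.

(** * Rings given by a congruence *)

(** A general congruence, rather than an ideal, because the same quotient serves three times: for
    fractions with powers of one denominator, for residue classes, and for formal expressions modulo
    relations. *)
Record pre_ring := PreRing {
  pr_sort :> Type;
  pr_eqv : pr_sort -> pr_sort -> Prop;
  pr_zero : pr_sort; pr_one : pr_sort;
  pr_opp : pr_sort -> pr_sort;
  pr_add : pr_sort -> pr_sort -> pr_sort;
  pr_mul : pr_sort -> pr_sort -> pr_sort;
  pr_refl : forall x, pr_eqv x x;
  pr_sym : forall x y, pr_eqv x y -> pr_eqv y x;
  pr_trans : forall x y z, pr_eqv x y -> pr_eqv y z -> pr_eqv x z;
  pr_oppE : forall x x', pr_eqv x x' -> pr_eqv (pr_opp x) (pr_opp x');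
  pr_addE : forall x x' y y', pr_eqv x x' -> pr_eqv y y' ->
    pr_eqv (pr_add x y) (pr_add x' y');
  pr_mulE : forall x x' y y', pr_eqv x x' -> pr_eqv y y' ->
    pr_eqv (pr_mul x y) (pr_mul x' y');
  pr_addA : forall x y z,
    pr_eqv (pr_add x (pr_add y z)) (pr_add (pr_add x y) z);
  pr_addC : forall x y, pr_eqv (pr_add x y) (pr_add y x);
  pr_add0 : forall x, pr_eqv (pr_add pr_zero x) x;
  pr_addN : forall x, pr_eqv (pr_add (pr_opp x) x) pr_zero;
  pr_mulA : forall x y z,
    pr_eqv (pr_mul x (pr_mul y z)) (pr_mul (pr_mul x y) z);
  pr_mulC : forall x y, pr_eqv (pr_mul x y) (pr_mul y x);
  pr_mul1 : forall x, pr_eqv (pr_mul pr_one x) x;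
  pr_mulD : forall x y z,
    pr_eqv (pr_mul (pr_add x y) z) (pr_add (pr_mul x z) (pr_mul y z)) }.

Section PreRingQuotient.
Variable T : pre_ring.

Definition pr_quot : Type := {S : set T | exists x, S = pr_eqv x}.
HB.instance Definition _ := gen_eqMixin pr_quot.
HB.instance Definition _ := gen_choiceMixin pr_quot.

Definition pr_class (x : T) : pr_quot :=
  exist _ (pr_eqv x) (ex_intro _ x erefl).
Definition pr_repr (c : pr_quot) : T := projT1 (cid (projT2 c)).

Lemma pr_classP x y : pr_class x = pr_class y <-> pr_eqv x y.
Proof.
split=> [[->]|xy]; first exact: pr_refl.
apply: eq_exist; apply/funext => z; apply/propext; split.
  by apply: pr_trans; apply: pr_sym.
exact: pr_trans.
Qed.

Lemma pr_reprK c : pr_class (pr_repr c) = c.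
Proof. by case: c => S e; apply: eq_exist; rewrite /pr_repr; case: cid. Qed.

Lemma pr_repr_class x : pr_eqv (pr_repr (pr_class x)) x.
Proof. by apply/pr_classP; rewrite pr_reprK. Qed.

Lemma pr_class_surj c : exists x, c = pr_class x.
Proof. by exists (pr_repr c); rewrite pr_reprK. Qed.

Definition prq_add (c d : pr_quot) := pr_class (pr_add (pr_repr c) (pr_repr d)).
Definition prq_mul (c d : pr_quot) := pr_class (pr_mul (pr_repr c) (pr_repr d)).
Definition prq_opp (c : pr_quot) := pr_class (pr_opp (pr_repr c)).

Lemma prq_addE x y : prq_add (pr_class x) (pr_class y) = pr_class (pr_add x y).
Proof. by apply/pr_classP; apply: pr_addE; apply: pr_repr_class. Qed.
Lemma prq_mulE x y : prq_mul (pr_class x) (pr_class y) = pr_class (pr_mul x y).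
Proof. by apply/pr_classP; apply: pr_mulE; apply: pr_repr_class. Qed.
Lemma prq_oppE x : prq_opp (pr_class x) = pr_class (pr_opp x).
Proof. by apply/pr_classP; apply: pr_oppE; apply: pr_repr_class. Qed.

Lemma prq_addA : associative prq_add.
Proof.
move=> c d e; have [[[x ->] [y ->]] [z ->]] :=
  (pr_class_surj c, pr_class_surj d, pr_class_surj e).
by rewrite !prq_addE; apply/pr_classP/pr_addA.
Qed.
Lemma prq_addC : commutative prq_add.
Proof.
move=> c d; have [[x ->] [y ->]] := (pr_class_surj c, pr_class_surj d).
by rewrite !prq_addE; apply/pr_classP/pr_addC.
Qed.
Lemma prq_add0 : left_id (pr_class (pr_zero T)) prq_add.
Proof.
move=> c; have [x ->] := pr_class_surj c.
by rewrite !prq_addE; apply/pr_classP/pr_add0.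
Qed.
Lemma prq_addN : left_inverse (pr_class (pr_zero T)) prq_opp prq_add.
Proof.
move=> c; have [x ->] := pr_class_surj c.
by rewrite prq_oppE !prq_addE; apply/pr_classP/pr_addN.
Qed.
HB.instance Definition _ :=
  GRing.isZmodule.Build pr_quot prq_addA prq_addC prq_add0 prq_addN.

Lemma prq_mulA : associative prq_mul.
Proof.
move=> c d e; have [[[x ->] [y ->]] [z ->]] :=
  (pr_class_surj c, pr_class_surj d, pr_class_surj e).
by rewrite !prq_mulE; apply/pr_classP/pr_mulA.
Qed.
Lemma prq_mulC : commutative prq_mul.
Proof.
move=> c d; have [[x ->] [y ->]] := (pr_class_surj c, pr_class_surj d).
by rewrite !prq_mulE; apply/pr_classP/pr_mulC.
Qed.
Lemma prq_mul1 : left_id (pr_class (pr_one T)) prq_mul.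
Proof.
move=> c; have [x ->] := pr_class_surj c.
by rewrite !prq_mulE; apply/pr_classP/pr_mul1.
Qed.
Lemma prq_mulD : left_distributive prq_mul +%R.
Proof.
move=> c d e; have [[[x ->] [y ->]] [z ->]] :=
  (pr_class_surj c, pr_class_surj d, pr_class_surj e).
change (prq_mul (prq_add (pr_class x) (pr_class y)) (pr_class z) =
  prq_add (prq_mul (pr_class x) (pr_class z)) (prq_mul (pr_class y) (pr_class
    z))).
by rewrite !(prq_addE, prq_mulE); apply/pr_classP/pr_mulD.
Qed.
HB.instance Definition _ :=
  GRing.Zmodule_isComPzRing.Build pr_quot prq_mulA prq_mulC prq_mul1 prq_mulD.

Lemma pr_classD x y : pr_class (pr_add x y) = pr_class x + pr_class y.
Proof. by rewrite -prq_addE. Qed.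
Lemma pr_classM x y : pr_class (pr_mul x y) = pr_class x * pr_class y.
Proof. by rewrite -prq_mulE. Qed.
Lemma pr_classN x : pr_class (pr_opp x) = - pr_class x.
Proof. by rewrite -prq_oppE. Qed.
Lemma pr_class0 : pr_class (pr_zero T) = 0. Proof. by []. Qed.
Lemma pr_class1 : pr_class (pr_one T) = 1. Proof. by []. Qed.

Section Lift.
Variables (C : comPzRingType) (g : T -> C).
Hypothesis gE : forall x y, pr_eqv x y -> g x = g y.
Hypothesis g1 : g (pr_one T) = 1.
Hypothesis gD : forall x y, g (pr_add x y) = g x + g y.
Hypothesis gM : forall x y, g (pr_mul x y) = g x * g y.

Lemma pr_lift_exists :
  exists f : {rmorphism pr_quot -> C}, forall x, f (pr_class x) = g x.
Proof.
pose h (c : pr_quot) := g (pr_repr c).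
have hE x : h (pr_class x) = g x by apply: gE; apply: pr_repr_class.
have hN : zmod_morphism h.
  have hD : {morph h : x y / x + y}.
    move=> c d; have [[x ->] [y ->]] := (pr_class_surj c, pr_class_surj d).
    by rewrite -pr_classD !hE gD.
  move=> c d; apply: (addIr (h d)).
  by rewrite -hD !subrK.
have hM : monoid_morphism h.
  split=> [|c d]; first by rewrite -pr_class1 hE.
  have [[x ->] [y ->]] := (pr_class_surj c, pr_class_surj d).
  by rewrite -pr_classM !hE gM.
pose m1 := GRing.isZmodMorphism.Build _ _ h hN.
pose m2 := GRing.isMonoidMorphism.Build _ _ h hM.
pose f : {rmorphism pr_quot -> C} := HB.pack h m1 m2.
by exists f.
Qed.

End Lift.
End PreRingQuotient.

(** * Localization at one element *)

Section Localization.
Variables (A : comPzRingType) (a : A).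

(** The pair (x, i) stands for x / a ^ i. The factor a ^ k keeps the relation transitive when a is a
    zero divisor. *)
Definition loc_eqv (x y : A * nat) : Prop :=
  exists k, a ^+ k * (x.1 * a ^+ y.2 - y.1 * a ^+ x.2) = 0.

Definition loc_pre : pre_ring.
Proof.
apply: (@PreRing (A * nat) loc_eqv (0, 0%N) (1, 0%N) (fun x => (- x.1, x.2))
  (fun x y => (x.1 * a ^+ y.2 + y.1 * a ^+ x.2, (x.2 + y.2)%N))
  (fun x y => (x.1 * y.1, (x.2 + y.2)%N))); rewrite /loc_eqv /=.
- by move=> x; exists 0%N; rewrite subrr mulr0.
- by move=> x y [k e]; exists k; rewrite -[LHS]opprK -mulrN opprB e oppr0.
- move=> [x i] [y j] [z l] /= [k e] [k' e']; exists (k + k' + j)%N.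
  transitivity (a ^+ k' * a ^+ l * (a ^+ k * (x * a ^+ j - y * a ^+ i))
    + a ^+ k * a ^+ i * (a ^+ k' * (y * a ^+ l - z * a ^+ j))).
    by rewrite !exprD; ring.
  by rewrite e e' !mulr0 addr0.
- by move=> x y [k e]; exists k; rewrite -[RHS]oppr0 -e; ring.
- move=> [x i] [x' i'] [y j] [y' j'] /= [k e] [k' e']; exists (k + k')%N.
  transitivity (a ^+ k' * a ^+ j * a ^+ j' * (a ^+ k * (x * a ^+ i' - x' * a
    ^+ i))
    + a ^+ k * a ^+ i * a ^+ i' * (a ^+ k' * (y * a ^+ j' - y' * a ^+ j))).
    by rewrite !exprD; ring.
  by rewrite e e' !mulr0 addr0.
- move=> [x i] [x' i'] [y j] [y' j'] /= [k e] [k' e']; exists (k + k')%N.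
  transitivity (a ^+ k' * a ^+ j' * y * (a ^+ k * (x * a ^+ i' - x' * a ^+ i))
    + a ^+ k * a ^+ i * x' * (a ^+ k' * (y * a ^+ j' - y' * a ^+ j))).
    by rewrite !exprD; ring.
  by rewrite e e' !mulr0 addr0.
all: try by [move=> x y z; exists 0%N; rewrite !exprD; ring
            |move=> x y; exists 0%N; rewrite !exprD; ring
            |move=> x; exists 0%N; rewrite ?exprD; ring].
Defined.

Definition locring : comPzRingType := pr_quot loc_pre.

Lemma loc_exists : exists phi : {rmorphism A -> locring},
  [/\ exists u, u * phi a = 1,
      forall b, exists n x, b * phi a ^+ n = phi x,
      forall x, phi x = 0 -> exists n, a ^+ n * x = 0 &
      forall (C : comPzRingType) (h : {rmorphism A -> C}) u, u * h a = 1 ->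
        exists g : {rmorphism locring -> C}, forall x, g (phi x) = h x].
Proof.
pose cl (x : A * nat) : locring := pr_class (x : loc_pre).
pose h x := cl (x, 0%N).
have clP x y : cl x = cl y <-> loc_eqv x y by apply: pr_classP.
have hN : zmod_morphism h.
  move=> x y; rewrite /h -[- cl _]pr_classN -pr_classD; apply/clP.
  by exists 0%N => /=; ring.
have hM : monoid_morphism h.
  split=> [//|x y]; rewrite /h -pr_classM; apply/clP.
  by exists 0%N => /=; ring.
pose m1 := GRing.isZmodMorphism.Build _ _ h hN.
pose m2 := GRing.isMonoidMorphism.Build _ _ h hM.
pose f : {rmorphism A -> locring} := HB.pack h m1 m2.
have fE x : f x = cl (x, 0%N) by [].
exists f; split.
- exists (cl (1, 1%N)); rewrite fE -pr_classM -pr_class1; apply/clP.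
  by exists 0%N => /=; ring.
- move=> b; have [[x n] ->] := pr_class_surj b; exists n, x.
  rewrite -rmorphXn !fE -[_ * _]pr_classM; apply/clP; exists 0%N => /=.
  by rewrite addn0; ring.
- move=> x; rewrite fE -pr_class0 => /clP[k /= e]; exists k.
  by rewrite -[RHS]e; ring.
- move=> C g u uga.
  have uX i : u ^+ i * g a ^+ i = 1 by rewrite -exprMn uga expr1n.
  have [] := @pr_lift_exists loc_pre C (fun x => g x.1 * u ^+ x.2).
  + move=> [x i] [y j] [k /= e].
    have : u ^+ k * u ^+ i * u ^+ j * g (a ^+ k * (x * a ^+ j - y * a ^+ i)) =
      0.
      by rewrite e rmorph0 mulr0.
    rewrite rmorphM rmorphB !rmorphM !rmorphXn => e'.
    apply/eqP; rewrite -subr_eq0 -[X in _ == X]e'; apply/eqP.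
    transitivity ((u ^+ k * g a ^+ k) * (g x * u ^+ i * (u ^+ j * g a ^+ j)
       - g y * u ^+ j * (u ^+ i * g a ^+ i))); last by ring.
    by rewrite !uX; ring.
  + by change (g 1 * u ^+ 0 = 1); rewrite rmorph1 mul1r.
  + move=> [x i] [y j].
    change (g (x * a ^+ j + y * a ^+ i) * u ^+ (i + j) = g x * u ^+ i + g y *
      u ^+ j).
    rewrite rmorphD !rmorphM !rmorphXn exprD.
    transitivity (g x * u ^+ i * (u ^+ j * g a ^+ j)
       + g y * u ^+ j * (u ^+ i * g a ^+ i)); first by ring.
    by rewrite !uX; ring.
  + move=> [x i] [y j].
    change (g (x * y) * u ^+ (i + j) = g x * u ^+ i * (g y * u ^+ j)).
    by rewrite rmorphM exprD; ring.
  move=> f' f'E; exists f' => x; rewrite [LHS]f'E /= expr0 mulr1 //.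
Qed.

End Localization.

(** * Functoriality of points, and localization of algebras *)

Section Functors.
Variable k : comPzRingType.

Definition id_hom (A : kalg k) : hom A A := @Hom k A A idfun (fun=> erefl).

Lemma comp_hom_str (A B C : kalg k) (f : hom A B) (g : hom B C) c :
  (g \o f : {rmorphism A -> C}) (str A c) = str C c.
Proof. by rewrite /= !hom_str. Qed.

Definition comp_hom (A B C : kalg k) (g : hom B C) (f : hom A B) : hom A C :=
  @Hom k A C (g \o f) (comp_hom_str f g).

Section Maps.
Variable X : functor k.

Lemma fmap1 A (x : X A) : fmap (id_hom A) x = x.
Proof. exact: fmap_id. Qed.

Lemma fmap_ext A B (f g : hom A B) (x : X A) : f =1 g -> fmap f x = fmap g x.
Proof. by move=> fg; rewrite (@fmap_comp _ X _ _ _ (id_hom A) g f) ?fmap1. Qed.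

Lemma fmapM A B C (g : hom B C) (f : hom A B) (x : X A) :
  fmap g (fmap f x) = fmap (comp_hom g f) x.
Proof. by rewrite (@fmap_comp _ X _ _ _ f g (comp_hom g f)). Qed.

End Maps.

Lemma loc_alg (A : kalg k) (a : A) : exists (Aa : kalg k) (phi : hom A Aa),
  [/\ exists u, u * phi a = 1,
      forall b, exists n x, b * phi a ^+ n = phi x,
      forall x, phi x = 0 -> exists n, a ^+ n * x = 0 &
      forall (C : kalg k) (h : hom A C) u, u * h a = 1 ->
        exists g : hom Aa C, forall x, g (phi x) = h x].
Proof.
have [phi [inv num ker lift]] := loc_exists a.
exists (KAlg (phi \o str A)),
  (@Hom k A (KAlg (phi \o str A)) phi (fun=> erefl)).
split=> // C h u uh; have [g gE] := lift C h u uh.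
have gs c : g (str (KAlg (phi \o str A)) c) = str C c by rewrite /= gE hom_str.
by exists (Hom gs).
Qed.

(** Clear denominators in the relation that expresses 1 over the localization; the two sides then
    differ in A by an element that a power of a kills. *)
Lemma loc_span (A Aa : kalg k) (a : A) (phi : hom A Aa) (S : set A) :
    (forall b, exists n x, b * phi a ^+ n = phi x) ->
    (forall x, phi x = 0 -> exists n, a ^+ n * x = 0) ->
  span (phi @` S)%classic 1 -> exists n, span S (a ^+ n).
Proof.
move=> num ker [n [c [d [Sd e]]]].
have /choice[N NE] : forall i, exists N, exists x, c i * phi a ^+ N = phi x.
  by move=> i; have [N [y yE]] := num (c i); exists N, y.
pose M := (\max_i N i)%N.
have /choice[c' c'E] i : exists x, c i * phi a ^+ M = phi x.
  have [y yE] := NE i; exists (y * a ^+ (M - N i)).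
  by rewrite rmorphM rmorphXn -yE -mulrA -exprD subnKC // leq_bigmax.
have /choice[d' d'E] i : exists x, S x /\ phi x = d i.
  by have [x] := Sd i; exists x.
have /ker[l /eqP] : phi (a ^+ M - \sum_i c' i * d' i) = 0.
  rewrite rmorphB rmorphXn -[phi a ^+ M]mul1r e rmorph_sum mulr_suml.
  apply/eqP; rewrite subr_eq0; apply/eqP; apply: eq_bigr => i _.
  by rewrite rmorphM -c'E (d'E i).2 mulrAC.
rewrite mulrBr subr_eq0 -exprD => /eqP aE; exists (l + M)%N.
have [_ _ sM] := span_ideal S.
rewrite aE; apply: sM; apply: ideal_sum; first exact: span_ideal.
by move=> i; apply: span_in; have [] := d'E i.
Qed.

(** * Open subfunctors *)

(** Names the witness hidden in [is_open], so that the witnesses of a whole family of opens can be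
    collected. *)
Definition opens_at (X : functor k) (U : subfunctor X) A (x : X A) (I : set A)
  :=
  forall B (f : hom A B), U B (fmap f x) <-> span (f @` I)%classic 1.

Section Opens.
Variables (X : functor k).
Implicit Types U D : subfunctor X.

Lemma opens_at_self U A (x : X A) I : opens_at U x I -> (U A x <-> span I 1).
Proof.
move=> /(_ A (id_hom A)); rewrite fmap1.
suff -> : (id_hom A @` I)%classic = I by [].
by apply/seteqP; split=> [_ [z Iz <-]|z Iz] //; exists z.
Qed.

Lemma opens_at_fmap U A B (f : hom A B) (x : X A) I :
  opens_at U x I -> opens_at U (fmap f x) (f @` I)%classic.
Proof.
move=> Ux C g; rewrite fmapM Ux.
suff -> : (g @` (f @` I))%classic = (comp_hom g f @` I)%classic by [].
apply/seteqP; split=> [_ [_ [z Iz <-] <-]|_ [z Iz <-]]; first by exists z.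
by exists (f z) => //; exists z.
Qed.

Lemma open_fmap U A B (f : hom A B) (x : X A) :
  is_open U -> U A x -> U B (fmap f x).
Proof.
move=> oU Ux; have [I UI] := oU A x; apply/UI.
have I1 := (opens_at_self UI).1 Ux.
rewrite -(rmorph1 f); apply: (@span_image _ _ f I) => // y Iy.
by apply: span_in; exists y.
Qed.

(** A point over A lies in the union when the preimages of the members cover Spec A. The union of
    the sets of points would be too small, since Spec A need not map into a single member. *)
Definition open_union (P : subfunctor X -> Prop) : subfunctor X := fun A x =>
  span (fun a => exists D I, [/\ P D, opens_at D x I & I a]) 1.

Lemma sub_open_union P D A x : is_open D -> P D -> D A x -> open_union P x.
Proof.
move=> oD PD Dx; have [I DI] := oD A x.
have I1 := (opens_at_self DI).1 Dx.
apply: span_mono I1 => a Ia; apply: span_in.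
by exists D, I.
Qed.

(** A witness J for D over B need not come from A. But once c in J is inverted the point lies in D,
    and comparison with a witness I over A puts a power of c in the ideal generated by the image of
    I. *)
Lemma open_union_open P : (forall D, P D -> is_open D) ->
  is_open (open_union P).
Proof.
move=> oP A x; exists (fun a => exists D I, [/\ P D, opens_at D x I & I a]).
move=> B f; split.
- move=> I1; apply: (span_radical (span_ideal _) I1) => c [D [J [PD DJ Jc]]].
  have [I DI] := oP D PD A x.
  have [Bc [phi [[u uc] num ker lift]]] := loc_alg c.
  have : D Bc (fmap phi (fmap f x)).
    apply/DJ; rewrite -uc; apply: idealM; first exact: span_ideal.
    by apply: span_in; exists c.
  have fDI := opens_at_fmap f DI.
  move=> /fDI/(loc_span num ker)[m cm]; exists m.
  apply: span_mono cm => _ [d Id <-]; apply: span_in; exists d => //.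
  by exists D, I.
- move=> I1; apply: span_mono I1 => _ [a [D [I [PD DI Ia]]] <-].
  apply: span_in; exists D, (f @` I)%classic; split=> //.
  exact: opens_at_fmap.
Qed.

(* F is the graph of a function on the open U *)
Lemma invertible_locus_open U (F : forall A, X A -> A -> Prop) :
  is_open U ->
  (forall A (x : X A), U A x -> exists v, F A x v) ->
  (forall A (x : X A) v w, F A x v -> F A x w -> v = w) ->
  (forall A B (f : hom A B) x v, F A x v -> F B (fmap f x) (f v)) ->
  (forall A (x : X A) v, F A x v -> U A x) ->
  is_open (fun A x => exists v w, F A x v /\ w * v = 1).
Proof.
move=> oU Fex Funi Fmap FU A x; pose D B (y : X B) :=
  exists v w, F B y v /\ w * v = 1.
(* The witness consists of all c whose principal open in Spec A is sent into the invertible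
   locus. *)
exists (fun c => forall B (h : hom A B) u, u * h c = 1 -> D B (fmap h x)).
move=> B f; have [I UI] := oU A x; split; last first.
- set T := (T in span T) => T1.
  have UB : U B (fmap f x).
    apply/UI; apply: (span_radical (span_ideal _) T1) => _ [c Dc <-].
    have [Bc [phi [[u uc] num ker _]]] := loc_alg (f c).
    have [v [w [/FU Uc _]]] := Dc Bc (comp_hom phi f) u uc.
    have /(_ Bc phi) := opens_at_fmap f UI.
    by rewrite fmapM => -[/(_ Uc)/(loc_span num ker)].
  have [v Fv] := Fex _ _ UB; exists v.
  suff [w wv] : exists w, 1 = w * v by exists w.
  have idv : ideal (fun y => exists w, y = w * v).
    split=> [|_ _ [y ->] [z ->]|y _ [z ->]].
    + by exists 0; rewrite mul0r.
    + by exists (y + z); rewrite mulrDl.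
    + by exists (y * z); rewrite mulrA.
  apply: (span_radical idv T1) => _ [c Dc <-].
  have [Bc [phi [[u uc] num ker _]]] := loc_alg (f c).
  have [v' [w [Fv' wv]]] := Dc Bc (comp_hom phi f) u uc.
  move: Fv'; rewrite -fmapM => /(Funi _ _ _ _ (Fmap _ _ phi _ _ Fv)) vE.
  have [n [y yE]] := num w.
  have /ker[l /eqP] : phi (y * v - f c ^+ n) = 0.
    by rewrite rmorphB rmorphM rmorphXn -yE vE mulrAC wv mul1r subrr.
  rewrite mulrBr subr_eq0 -exprD => /eqP e; exists (l + n)%N.
  by exists (f c ^+ l * y); rewrite -e mulrA.
(* For a in I the value over A_a is a fraction s / a ^ n. Then a * s belongs to the witness, and
   since the value is invertible over B, a power of f a is a multiple of f (a * s). *)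
- move=> [v [w [Fv wv]]]; have /UI I1 := FU _ _ _ Fv.
  apply: (span_radical (span_ideal _) I1) => _ [a Ia <-].
  have [Aa [phi [[u ua] num _ lift]]] := loc_alg a.
  have Ua : U Aa (fmap phi x).
    apply/UI; rewrite -ua; apply: idealM; first exact: span_ideal.
    by apply: span_in; exists a.
  have [va Fva] := Fex _ _ Ua; have [n [s sE]] := num va.
  have [Ba [psi [[ub ub1] _ ker _]]] := loc_alg (f a).
  have [g gE] := lift _ (comp_hom psi f) ub ub1.
  have vE : g va = psi v.
    have := Fmap _ _ g _ _ Fva; rewrite fmapM (fmap_ext (g :=
      comp_hom psi f)) //.
    by rewrite -fmapM => /(Funi _ _ _ _ (Fmap _ _ psi _ _ Fv)).
  have /ker[l /eqP] : psi (f s * w - f a ^+ n) = 0.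
    have := gE s; rewrite -sE rmorphM vE rmorphXn gE /= => e.
    rewrite rmorphB rmorphM -e rmorphXn mulrAC -rmorphM [v * w]mulrC wv rmorph1.
    by rewrite mul1r subrr.
  rewrite mulrBr subr_eq0 -exprD => /eqP e; exists (l + n).+1.
  rewrite exprSr -e.
  have -> : f a ^+ l * (f s * w) * f a = f a ^+ l * w * f (a * s).
    by rewrite rmorphM; ring.
  apply: idealM; first exact: span_ideal.
  apply: span_in; exists (a * s) => // C h t tas.
  have ta : (t * h s) * h a = 1 by rewrite -mulrA [h s * _]mulrC -rmorphM.
  have [g' g'E] := lift _ h _ ta.
  exists (g' va), (t * h a * h a ^+ n); split.
    rewrite (fmap_ext (g := comp_hom g' phi)); last by move=> z; rewrite /= g'E.
    by rewrite -fmapM; apply: Fmap.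
  have := g'E s; rewrite -sE rmorphM rmorphXn g'E => e'.
  by rewrite -tas rmorphM -e'; ring.
Qed.

End Opens.
End Functors.

(** * Factoring algebra maps, and points of separated functors *)

Section Factor.
Variable k : comPzRingType.

Lemma hom_factor_inj (A B C : kalg k) (i : hom B C) (f : hom A C) :
  injective i -> (forall a, exists b, i b = f a) ->
  exists g : hom A B, forall a, i (g a) = f a.
Proof.
move=> i_inj /choice[g gE].
have gN : zmod_morphism g by move=> x y; apply: i_inj;
  rewrite rmorphB !gE rmorphB.
have gM : monoid_morphism g.
  by split=> [|x y]; apply: i_inj; rewrite ?rmorphM !gE ?rmorphM ?rmorph1.
pose g1 := GRing.isZmodMorphism.Build _ _ g gN.
pose g2 := GRing.isMonoidMorphism.Build _ _ g gM.
pose g' : {rmorphism A -> B} := HB.pack g g1 g2.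
have gs c : g' (str A c) = str B c by apply: i_inj; rewrite [LHS]gE !hom_str.
by exists (Hom gs).
Qed.

Lemma hom_factor_surj (A B C : kalg k) (s : hom A B) (f : hom A C) :
  (forall b, exists a, s a = b) -> (forall a, s a = 0 -> f a = 0) ->
  exists g : hom B C, forall a, g (s a) = f a.
Proof.
move=> /choice[r rK] sf.
have sfE x y : s x = s y -> f x = f y.
  by move=> e; apply/eqP; rewrite -subr_eq0 -rmorphB sf // rmorphB e subrr.
pose g b := f (r b); have gE a : g (s a) = f a by apply: sfE; rewrite rK.
have gN : zmod_morphism g.
  by move=> x y; rewrite -[x]rK -[y]rK -rmorphB !gE rmorphB.
have gM : monoid_morphism g.
  split=> [|x y]; first by rewrite -(rmorph1 s) gE rmorph1.
  by rewrite -[x]rK -[y]rK -rmorphM !gE rmorphM.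
pose g1 := GRing.isZmodMorphism.Build _ _ g gN.
pose g2 := GRing.isMonoidMorphism.Build _ _ g gM.
pose g' : {rmorphism B -> C} := HB.pack g g1 g2.
have gs c : g' (str B c) = str C c by rewrite -(hom_str s) [LHS]gE hom_str.
by exists (Hom gs).
Qed.

(** The locus where two points agree is closed, cut out by some I. If they agree over B then f kills
    I, so I is zero and they agree over A already. *)
Lemma separated_inj (X : functor k) (A B : kalg k) (f : hom A B) :
  is_separated X -> (forall a, f a = 0 -> a = 0) -> injective (@fmap k X A B f).
Proof.
move=> sX f0 x y xy; have [I IE] := sX A x y.
have /IE I0 := xy.
rewrite -(fmap1 x) -(fmap1 y); apply/IE => a /I0; exact: f0.
Qed.

End Factor.

Lemma base_change_open (k k' : comPzRingType) (phi : {rmorphism k -> k'})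
    (X : functor k) (U : subfunctor X) : is_open U ->
  @is_open k' (base_change phi X) (fun B => U (restr phi B)).
Proof.
move=> oU A x; have [I UI] := oU _ x; exists I => B f.
exact: (UI _ (restr_hom phi f)).
Qed.

Lemma affine_lift (k : comPzRingType) (X : functor k) (U : subfunctor X)
    (B : kalg k) (u : X B) (C : kalg k) (x : X C) : represents U u -> U C x ->
  exists f : hom B C, fmap f u = x /\ forall g, fmap g u = x -> g =1 f.
Proof. by move=> [_ /(_ C x)]. Qed.

(** * Valuative criterion and Galois descent *)

Section Valuative.
Variables (R : comPzRingType) (X : functor R) (P : kalg R -> Prop).
Hypotheses (Xclosed : universally_closed X) (Xcov : covered_by_affines X P).
Variables (V : kalg R) (E k : fieldType).
Variables (inc : {rmorphism V -> E}) (rho : {rmorphism V -> k}).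
Hypothesis inc_inj : injective inc.
(* V is a valuation ring of E with residue map rho *)
Hypothesis valV : forall x : E,
  (exists v, inc v = x) \/ (exists v, rho v = 0 /\ inc v * x = 1).

Definition frac_hom : hom V (KAlg (inc \o str V)) :=
  @Hom R V (KAlg (inc \o str V)) inc (fun=> erefl).

Lemma valuative_criterion (x : X (KAlg (inc \o str V))) :
  exists (U : subfunctor X) (B : kalg R) (u : X B) (f : hom B V),
    [/\ is_open U, represents U u, P B & fmap (comp_hom frac_hom f) u = x].
Proof.
(* Z is the complement of the closure of x in X over V.  That closure has a
   point z over the residue field; an affine open W containing z contains x as
   well, and the functions on W are integral at x: if the value f b were not,
   then b / f b = 1 would hold at x but not at z. *)
pose X' := base_change (str V) X.
pose x' : X' (KAlg inc) := x.
pose Px (D : subfunctor X') := is_open D /\ ~ D (KAlg inc) x'.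
pose Z := open_union Px.
have oZ : is_open Z by apply: open_union_open => D [].
have Zx : ~ Z (KAlg inc) x'.
  have i0 : @ideal E (fun a => a = 0).
    by split=> // [a b -> ->|a b ->]; rewrite ?addr0 ?mulr0.
  move=> /(span_min i0) z1; have /eqP := oner_neq0 E; apply.
  apply: z1 => a [D [I [[oD Dx] DI Ia]]].
  apply: contra_notP Dx => /eqP a0; apply/(opens_at_self DI).
  rewrite -(mulVf a0); apply: idealM; first exact: span_ideal.
  exact: span_in.
have ZP D (C : kalg V) (z : X' C) : is_open D -> ~ Z C z -> D C z ->
  D (KAlg inc) x'.
  move=> oD nZz Dz; apply: contra_notP nZz => nDx.
  by apply: sub_open_union Dz.
have [J JE] := Xclosed oZ.
(* The point x lies outside Z, so the generic point of Spec V is in the closed image V(J). Hence J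
   vanishes, and the closed point, the kernel of [rho], is in the image as well. *)
have J0 b : J b -> b = 0.
  move=> Jb; apply: inc_inj; rewrite rmorph0; apply: (JE E inc).2 Jb.
  pose h := @Hom V (KAlg inc) (KAlg (idfun \o inc)) idfun (fun=> erefl).
  pose h' := @Hom V (KAlg (idfun \o inc)) (KAlg inc) idfun (fun=> erefl).
  exists E, idfun, (@fmap _ X' _ _ h x'); apply: contra_not Zx.
  move=> /(open_fmap h' oZ); rewrite fmapM.
  by rewrite (fmap_ext (g := id_hom _)) ?fmap1.
have [E' [i [z Zz]]] : exists (E' : fieldType) (i : {rmorphism k -> E'})
    (z : X' (KAlg (i \o rho))), ~ Z (KAlg (i \o rho)) z.
  by apply/JE => b /J0 ->; rewrite rmorph0.
have [W [oW [B [u [Wu PB]]] Wz]] := Xcov (E := E') (e := i \o rho \o str V) z.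
have Wx : W _ x := ZP _ (KAlg (i \o rho)) z (@base_change_open _ _ (str V) _ _
  oW) Zz Wz.
have [f [fx _]] := affine_lift Wu Wx.
have [g [gz _]] := affine_lift Wu Wz.
have fV b : exists v, frac_hom v = f b.
  have [//|[t [rt0 tb1]]] := valV (f b); exfalso.
  (* Here t is 1 / f b, with residue 0. The function b * t - 1 on W vanishes at x and equals -1 at
     z, so the open locus where it is invertible contains z but not x, against [ZP]. *)
  pose F (C : kalg V) (y : X' C) (v : C) := exists h : hom B (restr (str V) C),
    fmap h u = y /\ v = h b * str C t - 1.
  have oD := @invertible_locus_open _ X' (fun C => W (restr (str V) C)) F.
  have [] := ZP _ _ _ (oD _ _ _ _ _) Zz _.
  - exact: base_change_open.
  - move=> C y Wy; have [h [hy _]] := affine_lift Wu Wy.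
    by exists (h b * str C t - 1), h.
  - move=> C y v w [h [hy ->]] [h' [hy' ->]].
    have Wy : W (restr (str V) C) y by rewrite -hy; apply: open_fmap => //;
      case: Wu.
    have [h0 [_ h0u]] := affine_lift Wu Wy.
    by rewrite (h0u _ hy) (h0u _ hy').
  - move=> C D h y v [h' [hy ->]].
    exists (comp_hom (restr_hom (str V) h) h'); split;
      first by rewrite -fmapM hy.
    by rewrite rmorphB rmorphM rmorph1 hom_str.
  - by move=> C y v [h [<- _]]; apply: open_fmap => //; case: Wu.
  - exists (-1), (-1); split; last by rewrite mulrNN mul1r.
    by exists g; split=> //=; rewrite rt0 rmorph0 mulr0 add0r.
  - move=> v [w [[h [hx ->]] w1]]; have [f' [_ f'u]] := affine_lift Wu Wx.
    move: w1; rewrite (f'u _ hx) -(f'u _ fx) /= mulrC in tb1 *.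
    by rewrite tb1 subrr mulr0 => /esym/eqP; rewrite oner_eq0.
have [f0 f0E] := @hom_factor_inj _ _ _ _ frac_hom f inc_inj fV.
exists W, B, u, f0; split=> //.
by rewrite -[RHS]fx; apply: fmap_ext.
Qed.

End Valuative.

(** An affine open U around x is defined over k, so x is a map from the coordinate ring of U to N.
    Invariance of x makes every coordinate invariant, hence an element of k. *)
Lemma galois_descent (k N : fieldType) (X : functor k) (iota : {rmorphism k ->
  N})
    (G : set (hom (KAlg iota) (KAlg iota))) (x : X (KAlg iota)) :
  covered_by_affines X (fun=> True) ->
  (forall y, (forall s, G s -> s y = y) -> exists c, iota c = y) ->
  (forall s, G s -> fmap s x = x) ->
  exists y : X (self k), fmap (str_hom (KAlg iota)) y = x.
Proof.
move=> Xcov Gfix Gx; have [U [oU [B [u [Uu _]]] Ux]] := Xcov _ _ x.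
have [f [fx funi]] := affine_lift Uu Ux.
have [|b|g gE] := @hom_factor_inj _ B (self k) (KAlg iota) (str_hom (KAlg
  iota)) f.
- exact: fmorph_inj.
- apply: Gfix => s Gs; apply: (funi (comp_hom s f)).
  by rewrite -fmapM fx Gx.
- by exists (fmap g u); rewrite fmapM -fx; apply: fmap_ext.
Qed.

(** * Primes of number fields *)

(* Finite dimension over Q is expressed by integral linear relations, so that it
   does not depend on a vector space structure. *)
Definition number_field (F : fieldType) : Prop :=
  injective (intr : int -> F) /\
  exists d, forall x : 'I_d -> F, exists c : 'I_d -> int,
    (exists i, c i != 0) /\ \sum_i (c i)%:~R * x i = 0.

Lemma number_field_algebraic (F : fieldType) (x : F) : number_field F ->
  exists2 p : {poly int}, p != 0 & root (map_poly intr p) x.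
Proof.
move=> [_ [d /(_ (fun i => x ^+ i))[c [[i ci] e]]]].
pose p := \poly_(j < d) oapp c 0 (insub j).
have pE (j : 'I_d) : p`_j = c j by rewrite coef_poly ltn_ord valK.
exists p; first by apply: contra_neq ci => p0; rewrite -pE p0 coef0.
rewrite rootE; apply/eqP; rewrite -[RHS]e (@horner_coef_wide _ d).
  by apply: eq_bigr => j _; rewrite coef_map pE.
by apply: leq_trans (size_poly _ _) _; apply: size_poly.
Qed.

Section Primes.
Variables (F : fieldType) (P : finite_prime F).

(* P and the maximal ideal of the local ring at P, as subsets of F *)
Definition in_prime : set F := fun x => exists2 a : 'O_F, P a & incl _ a = x.
Definition in_max : set F := fun x =>
  exists a s, [/\ in_prime a, 'O_F s, ~ in_prime s & x = a / s].

Lemma in_primeP (x : 'O_F) : in_prime (incl _ x) <-> P x.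
Proof. by split=> [[y Py /val_inj <-]|] //; exists x. Qed.

Lemma integersE x : 'O_F x -> exists y : 'O_F, incl _ y = x.
Proof. by move=> Ox; exists (SubringType (asboolT Ox)). Qed.

Lemma in_prime_int x : in_prime x -> 'O_F x.
Proof. by move=> [a _ <-]; apply: inclP. Qed.

Lemma integersD x y : 'O_F x -> 'O_F y -> 'O_F (x + y).
Proof. exact: integral_add. Qed.
Lemma integersN x : 'O_F x -> 'O_F (- x).
Proof. exact: integral_opp. Qed.
Lemma integersM x y : 'O_F x -> 'O_F y -> 'O_F (x * y).
Proof. exact: subringM. Qed.
Lemma integers1 : 'O_F 1. Proof. exact: subring1. Qed.
Lemma integers0 : 'O_F 0. Proof. exact: integral0. Qed.
Lemma integers_intr z : 'O_F z%:~R. Proof. exact: integral_id. Qed.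

Lemma in_prime0 : in_prime 0.
Proof. by rewrite -(rmorph0 (incl 'O_F)); apply/in_primeP;
  case: (prime_is_ideal (prime_setP P)). Qed.

Lemma in_primeD x y : in_prime x -> in_prime y -> in_prime (x + y).
Proof.
move=> [a Pa <-] [b Pb <-]; rewrite -rmorphD; apply/in_primeP.
by case: (prime_is_ideal (prime_setP P)) => _ + _; apply.
Qed.

Lemma in_primeMl a x : 'O_F a -> in_prime x -> in_prime (a * x).
Proof.
move=> /integersE[c <-] [b Pb <-]; rewrite -rmorphM; apply/in_primeP.
by case: (prime_is_ideal (prime_setP P)) => _ _; apply.
Qed.

Lemma in_primeN x : in_prime x -> in_prime (- x).
Proof. by rewrite -mulN1r; apply: in_primeMl; apply/integersN/integers1. Qed.

Lemma in_prime1 : ~ in_prime 1.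
Proof. by rewrite -(rmorph1 (incl 'O_F)) => /in_primeP;
  exact: prime_proper (prime_setP P). Qed.

Lemma in_prime_mul x y : 'O_F x -> 'O_F y -> in_prime (x * y) ->
  in_prime x \/ in_prime y.
Proof.
move=> /integersE[a <-] /integersE[b <-]; rewrite -rmorphM.
by move=> /in_primeP/(prime_mul (prime_setP P))[]Pa; [left|right];
  apply/in_primeP.
Qed.

Lemma notin_prime_unit s : ~ in_prime s -> s != 0.
Proof. by move=> Ps; apply/eqP => s0; apply: Ps; rewrite s0;
  apply: in_prime0. Qed.

Notation R := (local_ring P).

Lemma localP x : R x <-> exists a s, [/\ 'O_F a, 'O_F s,
  ~ in_prime s & x = a / s].
Proof.
split=> [[a [s [Ps ->]]]|[_ [_ [/integersE[a <-] /integersE[s <-] Ps ->]]]].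
  exists (incl _ a), (incl _ s); split=> //; try exact: inclP.
  by move/in_primeP.
by exists a, s; split=> // /in_primeP.
Qed.

Lemma local_int x : 'O_F x -> R x.
Proof.
move=> Ox; apply/localP; exists x, 1; split=> //; first exact: integers1.
  exact: in_prime1.
by rewrite divr1.
Qed.

Lemma local0 : R 0. Proof. exact/local_int/integers0. Qed.
Lemma local1 : R 1. Proof. exact: subring1. Qed.
Lemma localN x : R x -> R (- x).
Proof. by move=> Rx; rewrite -sub0r; apply: subringB => //; apply: local0. Qed.
Lemma localD x y : R x -> R y -> R (x + y).
Proof. by move=> Rx Ry; rewrite -[y]opprK; apply: subringB => //;
  apply: localN. Qed.
Lemma localM x y : R x -> R y -> R (x * y). Proof. exact: subringM. Qed.
Lemma localX x n : R x -> R (x ^+ n).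
Proof. by move=> Rx; elim: n => [|n IHn]; rewrite ?expr0 ?exprS;
  [exact: local1|exact: localM]. Qed.

Lemma in_max_local x : in_max x -> R x.
Proof.
move=> [a [s [Pa Os Ps ->]]]; apply/localP; exists a, s; split=> //.
exact: in_prime_int.
Qed.

Lemma in_max_prime x : in_prime x -> in_max x.
Proof.
move=> Px; exists x, 1; split=> //; first exact: integers1.
  exact: in_prime1.
by rewrite divr1.
Qed.

Lemma in_max_int x : 'O_F x -> in_max x -> in_prime x.
Proof.
move=> Ox [a [s [Pa Os Ps xE]]].
have : in_prime (x * s) by rewrite xE divfK // notin_prime_unit.
by case/in_prime_mul.
Qed.

Lemma in_max0 : in_max 0. Proof. exact/in_max_prime/in_prime0. Qed.

Lemma in_max1 : ~ in_max 1.
Proof. by move=> /(in_max_int integers1); exact: in_prime1. Qed.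

Lemma in_maxM x y : R x -> in_max y -> in_max (x * y).
Proof.
move=> /localP[a [s [Oa Os Ps ->]]] [b [t [Pb Ot Pt ->]]].
exists (a * b), (s * t); split; [exact: in_primeMl|exact: integersM| |].
  by move=> /in_prime_mul[].
by rewrite mulf_div.
Qed.

Lemma in_maxD x y : in_max x -> in_max y -> in_max (x + y).
Proof.
move=> [a [s [Pa Os Ps ->]]] [b [t [Pb Ot Pt ->]]].
exists (a * t + b * s), (s * t); split.
- by apply: in_primeD; rewrite mulrC; apply: in_primeMl.
- exact: integersM.
- by move=> /in_prime_mul[].
- by rewrite addf_div // notin_prime_unit.
Qed.

Lemma in_maxN x : in_max x -> in_max (- x).
Proof. by move=> mx; rewrite -mulN1r; apply: in_maxM => //;
  apply/localN/local1. Qed.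

Lemma in_max_sum (I : Type) (r : seq I) (Q : pred I) (f : I -> F) :
  (forall i, Q i -> in_max (f i)) -> in_max (\sum_(i <- r | Q i) f i).
Proof. by move=> Rf; elim/big_rec: _ => [|i x Qi Rx];
  [exact: in_max0|apply: in_maxD => //; apply: Rf]. Qed.

Lemma local_inv x : R x -> ~ in_max x -> R x^-1.
Proof.
move=> /localP[a [s [Oa Os Ps ->]]] mx; apply/localP; exists s, a; split=> //.
  by move=> Pa; apply: mx; exists a, s.
by rewrite invf_div.
Qed.

Hypothesis Fnum : number_field F.

Lemma horner_int (p : {poly int}) x : 'O_F x -> 'O_F (map_poly intr p).[x].
Proof.
move=> Ox; apply: integral_horner => //; apply/integral_poly => i.
by rewrite coef_map; apply: integers_intr.
Qed.

(** Take a nonzero x in P and an integer polynomial with root x; after division by powers of X, its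
    nonzero constant term is a multiple of x. *)
Lemma prime_nonzero_int : exists n, (0 < n)%N /\ in_prime n%:R.
Proof.
have [x Px x0] := prime_nonzero P.
have {}x0 : incl _ x != 0 by apply: contra_not_neq x0 => x0; apply: val_inj.
have [p p0 px] := number_field_algebraic (incl _ x) Fnum.
elim/poly_ind: p p0 px => [|p c IHp]; first by rewrite eqxx.
have [->|c0] := eqVneq c 0.
  rewrite addr0 mulf_eq0 negb_or => /andP[p0 _].
  by rewrite rmorphM /= map_polyX rootM rootX (negPf x0) orbF => /(IHp p0).
move=> _ /eqP; rewrite rmorphD rmorphM /= map_polyX map_polyC hornerD hornerM.
rewrite hornerX hornerC => /eqP; rewrite addrC addr_eq0 => /eqP cE.
have Pc : in_prime c%:~R.
  rewrite cE; apply/in_primeN/in_primeMl; last by apply/in_primeP.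
  exact/horner_int/inclP.
exists `|c|%N; split; first by rewrite absz_gt0.
case: c Pc {c0 cE} => n //; rewrite NegzE rmorphN => /in_primeN.
by rewrite opprK.
Qed.

(** The least positive integer in P, by Euclidean division: the residue characteristic. *)
Lemma residue_char_exists : exists l : nat, [/\ (0 < l)%N, in_prime l%:R &
  forall z : int, in_prime z%:~R <-> (l %| z)%Z].
Proof.
have Pex : exists n, (0 < n)%N && `[< in_prime n%:R >].
  by have [n [n0 Pn]] := prime_nonzero_int; exists n; rewrite n0; apply/asboolP.
case: (ex_minnP Pex) => l /andP[l0 /asboolP Pl] lmin; exists l; split=> // z;
  split.
  move=> Pz; apply/dvdz_mod0P.
  have : in_prime (z %% l)%Z%:~R.
    have -> : (z %% l)%Z%:~R = z%:~R - (z %/ l)%Z%:~R * l%:R :> F.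
      have := congr1 (intr : int -> F) (divz_eq z l).
      by rewrite rmorphD rmorphM /= => ->; rewrite addrC addKr.
    by apply: in_primeD => //; apply/in_primeN/in_primeMl => //;
      apply: integers_intr.
  have l0' : l%:Z != 0 by rewrite eqz_nat -lt0n.
  have := ltz_pmod z (l0 : 0 < l%:Z); have := modz_ge0 z l0'.
  case: (z %% l)%Z => // -[//|r] _; rewrite ltz_nat => rl /= Pr.
  have /lmin : (0 < r.+1)%N && `[< in_prime r.+1%:R >] by apply/asboolP.
  by rewrite leqNgt rl.
move=> /dvdzP[q ->]; rewrite rmorphM; apply: in_primeMl => //.
exact: integers_intr.
Qed.

(** Bezout for c and l. That their gcd is 1 comes from primality of P applied to the factorization
    of l through the gcd: if the gcd were in P, so would be c; if the cofactor is in P, then l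
    divides it. *)
Lemma int_inverse_mod (c : int) : ~ in_prime c%:~R ->
  exists d : int, in_prime (c * d - 1)%:~R.
Proof.
have [l [l0 Pl lP]] := residue_char_exists => Pc.
have [u [v uv]] := Bezoutz c l.
have g1 : gcdz c l = 1.
  have /dvdzP[h lE] := dvdz_gcdr c l; have /dvdzP[e cE] := dvdz_gcdl c l.
  have := Pl; rewrite -[l%:R]/((Posz l)%:~R) {1}lE rmorphM /=.
  move=> /in_prime_mul; case; try exact: integers_intr.
    move=> /lP/dvdzP[w hE].
    have : l%:Z * (w * gcdz c l) = l%:Z * 1 by rewrite mulr1 {3}lE hE; ring.
    move/mulfI; rewrite eqz_nat -lt0n l0 => /(_ isT) wg.
    have : (gcdz c l %| 1)%Z by apply/dvdzP; exists w.
    by rewrite dvdz1 /gcdz absz_nat => /eqP ->.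
  by move=> /(in_primeMl (integers_intr e)); rewrite -rmorphM /= -cE.
exists u; have -> : c * u - 1 = - v * l by rewrite -g1 -uv; ring.
by rewrite rmorphM; apply: in_primeMl => //; apply: integers_intr.
Qed.

(** In a monic integer equation for s, constant terms that lie in P are dropped and s is cancelled
    modulo P. The first constant term outside P is invertible modulo P, and so is s; monicity
    ensures that one is met. *)
Lemma prime_maximal s : 'O_F s -> ~ in_prime s ->
  exists2 t, 'O_F t & in_prime (s * t - 1).
Proof.
move=> Os Ps; have [p pm /eqP ps] := Os.
have {ps} : in_prime (map_poly intr p).[s] by rewrite ps; apply: in_prime0.
elim/poly_ind: p pm => [|p c IHp pm]; first by rewrite monicE lead_coef0.
rewrite rmorphD rmorphM /= map_polyX map_polyC hornerD hornerM hornerX hornerC.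
move=> Pp; have Op := horner_int p Os.
have [Pc|Pc] := pselect (in_prime c%:~R).
  have p0 : p != 0.
    apply/eqP => p0; move: pm Pc; rewrite p0 mul0r add0r monicE lead_coefC.
    by move=> /eqP ->; exact: in_prime1.
  apply: IHp; first by move: pm;
    rewrite !monicE lead_coefDl ?lead_coefMX // size_mulX // (leq_ltn_trans
    (size_polyC_leq1 _)) // ltnS size_poly_gt0.
  have : in_prime ((map_poly intr p).[s] * s).
    by rewrite -[X in in_prime X](addrK c%:~R); apply/in_primeD/in_primeN.
  by case/in_prime_mul.
have [d Pd] := int_inverse_mod Pc.
exists (- (map_poly intr p).[s] * d%:~R).
  by apply: integersM; [apply: integersN|apply: integers_intr].
have -> : s * (- (map_poly intr p).[s] * d%:~R) - 1 =
   (c * d - 1)%:~R - d%:~R * ((map_poly intr p).[s] * s + c%:~R).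
  by rewrite rmorphB rmorphM /=; ring.
apply: in_primeD => //; apply/in_primeN/in_primeMl => //; exact: integers_intr.
Qed.

End Primes.

(** * The localization at a prime as a discrete valuation ring *)

Lemma integral_lead_coef_mul (F : fieldType) (q : {poly F}) x :
  (forall i, 'O_F q`_i) -> root q x -> 'O_F (lead_coef q * x).
Proof.
move=> Oq qx; set a := lead_coef q.
have Oa : 'O_F a by apply: Oq.
have [q0|q0] := eqVneq q 0.
  by rewrite /a q0 lead_coef0 mul0r; apply: integers0.
have [d sq] : exists d, size q = d.+2.
  case: (size q) (root_size_gt1 q0 qx) => [|[|d]] // _; by exists d.
have aE : q`_d.+1 = a by rewrite /a lead_coefE sq.
(* The monic polynomial determined by r(a X) = a ^ d q(X), where q has degree d + 1. *)
pose r := \poly_(i < d.+2) (if i == d.+1 then 1 else q`_i * a ^+ (d - i)).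
have rm : r \is monic.
  have r1 : (if d.+1 == d.+1 then 1 else q`_d.+1 * a ^+ (d - d.+1)) != 0 :> F.
    by rewrite eqxx oner_eq0.
  by rewrite monicE lead_coef_poly // eqxx.
apply: (@integral_root_monic int F intr _ r rm).
  rewrite rootE; apply/eqP; rewrite horner_poly.
  move/eqP: qx; rewrite horner_coef sq => qx.
  rewrite -[RHS](mulr0 (a ^+ d)) -[in RHS]qx mulr_sumr; apply: eq_bigr =>
    -[i /= id] _.
  have [->|ne] := eqVneq i d.+1;
    first by rewrite mul1r aE exprMn [a ^+ d.+1]exprSr mulrA.
  have le : (i <= d)%N by rewrite -ltnS ltn_neqAle ne.
  rewrite exprMn -[in RHS](subnK le) exprD; ring.
apply/integral_poly => i; rewrite coef_poly.
case: ifP => _; last exact: integers0.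
case: ifP => _; first exact: integers1.
apply: integersM => //; elim: (d - i)%N => [|n IHn]; rewrite ?expr0 ?exprS.
  exact: integers1.
exact: integersM.
Qed.

Section LocalRing.
Variables (F : fieldType) (P : finite_prime F).
Notation R := (local_ring P).
Notation m := (in_max P).
Notation pr := (in_prime P).

(* Either the leading coefficient can be removed from the equation, or it
   shows that x or its inverse is in R. *)
Lemma local_or_inv_of_root (q : {poly F}) x :
  (forall i, 'O_F q`_i) -> root q x -> (exists i, ~ pr q`_i) ->
  R x \/ m x^-1.
Proof.
have [n] := ubnP (size q); elim: n q => // n IHn q sqn Oq qx [i Pi].
have q0 : q != 0.
  by apply/eqP => q0; apply: Pi; rewrite q0 coef0; apply: in_prime0.
have Oax := integral_lead_coef_mul Oq qx.
set a := lead_coef q in Oax; have Oa : 'O_F a by apply: Oq.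
have [Pa|Pa] := pselect (pr a); last first.
  left; apply/localP; exists (a * x), a; split=> //.
  by rewrite mulrC mulKf // (notin_prime_unit Pa).
have [Pax|Pax] := pselect (pr (a * x)); last first.
  right; exists a, (a * x); split=> //.
  have := notin_prime_unit Pax; rewrite mulf_eq0 negb_or => /andP[a0 x0].
  by rewrite invfM mulrA divff // mul1r.
have [d sq] : exists d, size q = d.+2.
  case: (size q) (root_size_gt1 q0 qx) => [|[|d]] // _; by exists d.
have aE : q`_d.+1 = a by rewrite /a lead_coefE sq.
(* The leading term is folded into the next one: x remains a root, a * x is integral, and since a
   and a * x are both in P some coefficient is still outside P. *)
pose q' := q - a *: 'X^(d.+1) + (a * x) *: 'X^d.
have q'E j : q'`_j = q`_j - a * (j == d.+1)%:R + a * x * (j == d)%:R.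
  by rewrite coefD coefB !coefZ !coefXn.
apply: (IHn q').
- have : (size q' <= d.+1)%N.
    apply/leq_sizeP => j dj; rewrite q'E; have [->|jd] := eqVneq j d.+1.
      by rewrite aE mulr1 subrr add0r (negPf (_ : d.+1 != d)) ?mulr0 // gtn_eqF.
    have dj' : (d.+2 <= j)%N by rewrite ltn_neqAle eq_sym jd.
    by rewrite nth_default ?sq // (gtn_eqF dj) !mulr0 subrr addr0.
  by move=> /leq_ltn_trans; apply; rewrite -ltnS -sq.
- move=> j; rewrite q'E; apply: integersD; last first.
    by apply: integersM => //; case: eqP => _;
      [exact: integers1|exact: integers0].
  apply: integersD => //; apply: integersN; apply: integersM => //.
  by case: eqP => _; [exact: integers1|exact: integers0].
- rewrite rootE !hornerE (eqP qx) sub0r; apply/eqP; rewrite ?exprS; ring.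
- exists i; rewrite q'E; have [id|_] := eqVneq i d.+1.
    by case: Pi; rewrite id aE.
  rewrite mulr0 subr0; have [_|_] := eqVneq i d; last by rewrite mulr0 addr0.
  rewrite mulr1 => Pq; apply: Pi; rewrite -[q`_i](addrK (a * x)).
  by apply: in_primeD => //; apply: in_primeN.
Qed.

Hypothesis Fnum : number_field F.

(** A primitive integer polynomial with root x has a coefficient not divisible by l, hence outside
    P. This makes the local ring a valuation ring. *)
Lemma local_or_inv x : R x \/ m x^-1.
Proof.
have [l [l0 Pl lP]] := residue_char_exists P Fnum.
have [p p0 px] := number_field_algebraic x Fnum.
apply: (@local_or_inv_of_root (map_poly intr (zprimitive p))).
- by move=> i; rewrite coef_map; apply: integers_intr.
- move: px; rewrite {1}[p]zpolyEprim map_polyZ rootZ //.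
  rewrite -(rmorph0 (intr : int -> F)) (inj_eq Fnum.1) zcontents_eq0 //.
- apply: contrapT => /forallNP all.
  have : zprimitive p \is a polyOver (dvdz l).
    apply/polyOverP => i; have /contrapT := all i.
    by rewrite coef_map => /lP.
  rewrite -dvdz_contents zcontents_primitive p0 => /lP.
  exact: in_prime1.
Qed.

Lemma local_or_max_div x y : y != 0 -> x != 0 -> R (x / y) \/ m (y / x).
Proof. by move=> y0 x0; case: (local_or_inv (x / y)) => [|];
  [left|rewrite invf_div; right]. Qed.

(** Elements are compared two at a time. The maximum is one of absolute value: y has the least
    additive valuation. *)
Lemma exists_max_valuation (s : seq F) : (exists2 x, x \in s & x != 0) ->
  exists y, [/\ y \in s, y != 0 & forall z, z \in s -> R (z / y)].
Proof.
elim: s => [[]|a s IHs] //; rewrite /= => -[x xs x0].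
have [[y ys y0]|none] := pselect (exists2 y, y \in s & y != 0); last first.
  have s0 y : y \in s -> y = 0.
    by move=> ys; apply/eqP; apply: contra_notT none => y0; exists y.
  have a0 : a != 0.
    by move: xs; rewrite inE => /predU1P[<- //|/s0 /eqP]; rewrite (negPf x0).
  exists a; split=> //; first exact: mem_head.
  move=> z; rewrite inE => /predU1P[->|/s0 ->].
    by rewrite divff //; apply: local1.
  by rewrite mul0r; apply: local0.
have [|b [bs b0 bmax]] := IHs; first by exists y.
have [->|a0] := eqVneq a 0.
  exists b; split=> //; first by rewrite inE bs orbT.
  move=> z; rewrite inE => /predU1P[->|/bmax//].
  by rewrite mul0r; apply: local0.
have [Rab|/in_max_local Rba] := local_or_max_div b0 a0.
  exists b; split=> //; first by rewrite inE bs orbT.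
  by move=> z; rewrite inE => /predU1P[->|/bmax//].
exists a; split=> //; first exact: mem_head.
move=> z; rewrite inE => /predU1P[->|/bmax Rzb].
  by rewrite divff //; apply: local1.
by rewrite (_ : z / a = z / b * (b / a)); [exact: localM|rewrite mulrA divfK].
Qed.

(** Used to normalize linear relations: after division by c j, all coefficients are in the local
    ring and one of them is 1. *)
Lemma scale_to_local n (c : 'I_n -> F) : (exists i, c i != 0) ->
  exists j, c j != 0 /\ forall i, R (c i / c j).
Proof.
move=> [i ci]; have [|_ [/codomP[j ->] cj cmax]] :=
  @exists_max_valuation (codom c).
  by exists (c i) => //; apply: codom_f.
by exists j; split=> // k; apply: cmax; apply: codom_f.
Qed.

(* The valuations of the x_i are distinct and less than that of t, and the
   valuation of a coefficient is either 0 or at least that of t: the terms with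
   unit coefficient cannot cancel modulo t. *)
Lemma sum_not_dvd n (x c : 'I_n -> F) t :
  (forall i, R (x i)) -> (forall i, x i != 0) -> t != 0 ->
  (forall i j : 'I_n, (i < j)%N -> m (x i / x j)) ->
  (forall i, m (t / x i)) ->
  (forall i, R (c i)) -> (forall i, m (c i) -> R (c i / t)) ->
  (exists i, ~ m (c i)) ->
  ~ R ((\sum_i c i * x i) / t).
Proof.
move=> Rx x0 t0 xx tx Rc mc [i0 ci0] Rsum.
(* J is the last index with unit coefficient. As valuations decrease with the index, x J has the
   least valuation among the terms with unit coefficient, and division by x J will force c J into
   the maximal ideal. *)
have := @arg_maxnP _ i0 (fun i => ~~ `[< m (c i) >]) (@nat_of_ord n).
case=> [|J /asboolPn mcJ Jmax]; first exact/asboolPn.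
apply: mcJ.
have -> : c J = (\sum_i c i * x i) / t * (t / x J)
    - \sum_(i | i != J) c i * x i / x J.
  rewrite mulrA divfK // (bigD1 J) //= mulrDl mulfK // mulr_suml.
  by rewrite addrK.
apply: in_maxD; first exact: in_maxM.
apply/in_maxN/in_max_sum => i iJ.
have [iltJ|Jlti|/val_inj iJ'] := ltngtP i J; last by rewrite iJ' eqxx in iJ.
  by rewrite -mulrA; apply: in_maxM => //; apply: xx.
have mci : m (c i).
  by apply: contrapT => /asboolPn/Jmax /=; rewrite leqNgt Jlti.
have -> : c i * x i / x J = c i / t * x i * (t / x J).
  by rewrite -[in LHS](divfK t0 (c i)); ring.
apply: in_maxM => //; apply: localM => //; exact: mc.
Qed.

(** In lowest terms l divides the numerator and not the denominator. So rational coefficients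
    satisfy the hypothesis of [sum_not_dvd] with t = l. *)
Lemma int_ratio_dvd (l : nat) (a b : int) :
  (forall z : int, pr z%:~R <-> (l %| z)%Z) -> (0 < l)%N ->
  b != 0 -> m (a%:~R / b%:~R) -> R (a%:~R / b%:~R / l%:R).
Proof.
move=> lP l0 b0 mab.
have intr_neq0 (z : int) : z != 0 -> z%:~R != 0 :> F.
  by move=> z0; rewrite -(rmorph0 (intr : int -> F)) (inj_eq Fnum.1).
have l0' : l%:R != 0 :> F by apply: (intr_neq0 l); rewrite eqz_nat -lt0n.
have [b1 gb] := dvdzP (dvdz_gcdr a b); have [a1 ga] := dvdzP (dvdz_gcdl a b).
set g := gcdz a b in ga gb.
have g0 : g != 0 by apply: contra_neq b0 => g0; rewrite gb g0 mulr0.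
have b10 : b1 != 0 by apply: contra_neq b0 => b10; rewrite gb b10 mul0r.
have gg : `|g|%:Z = g by rewrite /g /gcdz.
have cop : gcdz a1 b1 = 1.
  by apply: (mulIf g0); rewrite mul1r -[in LHS]gg mulz_gcdl -ga -gb.
have ab : a%:~R / b%:~R = a1%:~R / b1%:~R :> F.
  by rewrite ga gb !rmorphM /= -mulf_div divff ?mulr1 ?intr_neq0.
have Pa1 : (l %| a1)%Z.
  apply/lP/in_max_int; first exact: integers_intr.
  rewrite -(divfK (intr_neq0 _ b10) a1%:~R) mulrC -ab; apply: in_maxM => //.
  exact/local_int/integers_intr.
have [q qE] := dvdzP Pa1.
rewrite ab {1}qE rmorphM /= mulrAC mulfK //; apply/localP.
exists q%:~R, b1%:~R; split=> //; try exact: integers_intr.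
move=> /lP lb1; apply: (@in_prime1 _ P); apply/(lP 1).
by rewrite -cop dvdz_gcd Pa1.
Qed.

(* Otherwise there are elements x_0 = l, x_1, x_2, ... with strictly decreasing
   positive valuations, and x_1, x_2, ... are linearly independent over Q. *)
Lemma uniformizer_exists : exists w, [/\ pr w, w != 0 & forall x, m x ->
  R (x / w)].
Proof.
have [l [l0 Pl lP]] := residue_char_exists P Fnum.
(* A generator of the maximal ideal can be multiplied by its denominator, a unit of the local ring,
   so as to lie in P itself. *)
suff [w [mw w0 wP]] : exists w, [/\ m w, w != 0 & forall x, m x -> R (x / w)].
  have [a [s [Pa Os Ps wE]]] := mw; have s0 := notin_prime_unit Ps.
  exists a; split=> //.
    by apply: contra_neq w0; rewrite wE => ->; rewrite mul0r.
  move=> x mx; have -> : x / a = x / w / s.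
    by rewrite wE invf_div mulrA mulrAC mulfK.
  apply: localM; first exact: wP.
  by apply/localP; exists 1, s; rewrite div1r; split=> //; apply: integers1.
apply: contrapT => none.
have /choice[g gP] : forall y, exists z, m y -> y != 0 ->
  [/\ m z, z != 0 & m (y / z)].
  move=> y; have [[my y0]|n] := pselect (m y /\ y != 0); last by exists 0 =>
    my y0; case: n.
  apply: contrapT => /forallNP nz; apply: none; exists y; split=> // z mz.
  have [->|z0] := eqVneq z 0; first by rewrite mul0r; apply: local0.
  have [//|myz] := local_or_max_div y0 z0.
  by case: (nz z).
pose x n := iter n g (l%:R : F).
have xP n : m (x n) /\ x n != 0.
  elim: n => [|n [mx x0]] /=; last by have [] := gP _ mx x0.
  split; first exact: in_max_prime.
  by rewrite -[l%:R]/((Posz l)%:~R) -(rmorph0 (intr : int ->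
    F)) (inj_eq Fnum.1) eqz_nat -lt0n.
have xx i j : (i < j)%N -> m (x i / x j).
  elim: j => // j IHj; rewrite ltnS leq_eqVlt => /predU1P[->|ij].
    by have [mx x0] := xP j; have [] := gP _ mx x0.
  have [mx x0] := xP j; have [_ _ mj] := gP _ mx x0.
  rewrite (_ : x i / x j.+1 = x i / x j * (x j / x j.+1));
    last by rewrite mulrA divfK.
  by apply: in_maxM => //; apply/in_max_local/IHj.
(* The relation starts at x 1: the term x 0 = l plays the part of t in [sum_not_dvd], and each later
   term has smaller valuation. *)
have [_ [d /(_ (fun i => x i.+1))[c [[i0 ci0] e]]]] := Fnum.
have [|j [cj cmax]] := @scale_to_local _ (fun i => (c i)%:~R : F).
  by exists i0; rewrite -(rmorph0 (intr : int -> F)) (inj_eq Fnum.1).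
have l0' : l%:R != 0 :> F := (xP 0%N).2.
apply: (@sum_not_dvd _ (fun i : 'I_d => x i.+1) (fun i =>
  (c i)%:~R / (c j)%:~R) l%:R) => //.
- by move=> i; apply/in_max_local; case: (xP i.+1).
- by move=> i; case: (xP i.+1).
- by move=> i i' ii'; apply: xx.
- by move=> i; apply: (xx 0%N).
- move=> i; apply: int_ratio_dvd => //.
  by apply: contra_neq cj => ->.
- by exists j; rewrite divff //; apply: in_max1.
- rewrite (eq_bigr (fun i : 'I_d => (c j)%:~R^-1 * ((c i)%:~R * x i.+1))).
    by rewrite -mulr_sumr e mulr0 mul0r; apply: local0.
  by move=> i _; rewrite mulrAC mulrC.
Qed.

(** Of two elements of the maximal ideal one divides the other ([lub] below), so all the factors
    occurring in a sum of products can be written as multiples of a single pi, which depends on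
    x. *)
Lemma ideal_pow_sub n (x : 'O_F) : ideal_pow P n x ->
  exists pi r, [/\ m pi, R r & incl _ x = pi ^+ n * r].
Proof.
elim: n x => [|n IHn] x /=.
  move=> _; exists 0, (incl _ x); split;
    [exact: in_max0|exact/local_int/inclP|].
  by rewrite expr0 mul1r.
have lub a b : m a -> m b -> exists c, [/\ m c, (exists2 r, R r & a = c * r)
    & exists2 r, R r & b = c * r].
  move=> ma mb; have [->|a0] := eqVneq a 0.
    exists b; split=> //; [exists 0 => //|exists 1 => //];
      rewrite ?mulr0 ?mulr1 //.
      exact: local0.
    exact: local1.
  have [->|b0] := eqVneq b 0.
    exists a; split=> //; [exists 1 => //|exists 0 => //];
      rewrite ?mulr0 ?mulr1 //.
      exact: local1.
    exact: local0.
  have [Rab|/in_max_local Rba] := local_or_max_div b0 a0.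
    exists b; split=> //; last by exists 1; rewrite ?mulr1 //; apply: local1.
    by exists (a / b) => //; rewrite mulrCA divff ?mulr1.
  exists a; split=> //; first by exists 1; rewrite ?mulr1 //; apply: local1.
  by exists (b / a) => //; rewrite mulrCA divff ?mulr1.
pose I : set 'O_F := fun x => exists pi r, [/\ m pi,
  R r & incl _ x = pi ^+ n.+1 * r].
have idI : ideal I.
  split.
  - by exists 0, 0; split; [exact: in_max0|exact: local0|rewrite rmorph0 mulr0].
  - move=> y z [p1 [r1 [m1 R1 e1]]] [p2 [r2 [m2 R2 e2]]].
    have [c [mc [s1 S1 s1E] [s2 S2 s2E]]] := lub _ _ m1 m2.
    exists c, (s1 ^+ n.+1 * r1 + s2 ^+ n.+1 * r2); split=> //.
      by apply: localD; apply: localM => //; apply: localX.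
    by rewrite rmorphD e1 e2 s1E s2E !exprMn; ring.
  - move=> a y [p1 [r1 [m1 R1 e1]]]; exists p1, (incl _ a * r1); split=> //.
      by apply: localM => //; apply/local_int/inclP.
    by rewrite rmorphM e1 mulrCA.
apply: (span_min idI) => _ [a [b [Pa /IHn[p1 [r1 [m1 R1 e1]]] ->]]].
have ma : m (incl _ a) by apply/in_max_prime/in_primeP.
have [c [mc [s1 S1 s1E] [s2 S2 s2E]]] := lub _ _ ma m1.
exists c, (s1 * (s2 ^+ n * r1)); split=> //.
  by apply: localM => //; apply: localM => //; apply: localX.
by rewrite rmorphM e1 s1E s2E exprMn exprS; ring.
Qed.

End LocalRing.

Lemma linear_dependence (k : fieldType) (V : vectType k) n (x : 'I_n -> V) :
  (\dim {:V} < n)%N ->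
  exists c : 'I_n -> k, (exists i, c i != 0) /\ \sum_i c i *: x i = 0.
Proof.
move=> dn; pose X := [tuple x i | i < n].
have nfree : ~~ free X.
  rewrite /free size_tuple; apply: contraL dn => /eqP <-.
  by rewrite -leqNgt dimvS ?subvf.
apply: contrapT => none; move/negP: nfree; apply; apply/freeP => c cX i.
apply: contrapT => /eqP ci; apply: none; exists c; split; first by exists i.
by rewrite -[RHS]cX; apply: eq_bigr => j _; rewrite -tnth_nth tnth_mktuple.
Qed.

Lemma rat_ext_number_field (E : fieldExtType rat) : number_field E.
Proof.
have intr_scale (z : int) (x : E) : z%:~R * x = (z%:~R : rat) *: x.
  by rewrite scaler_int mulrzl.
split.
  move=> x y xy; apply/eqP; rewrite -subr_eq0 -(intr_eq0 rat).
  have : ((x - y)%:~R : rat) *: (1 : E) = 0.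
    by rewrite -intr_scale mulr1 rmorphB /= xy subrr.
  by move/eqP; rewrite scaler_eq0 oner_eq0 orbF.
exists (\dim {:E}).+1 => x; have [c [[i0 ci0] e]] :=
  linear_dependence x (ltnSn _).
pose D := \prod_j denq (c j).
pose b i := numq (c i) * \prod_(j | j != i) denq (c j).
have bE i : (b i)%:~R = c i * D%:~R.
  rewrite /b /D [in RHS](bigD1 i) //= !rmorphM /= mulrA; congr (_ * _).
  by rewrite -{2}(divq_num_den (c i)) divfK // intr_eq0 denq_neq0.
have D0 : D != 0 by apply/prodf_neq0 => j _; apply: denq_neq0.
exists b; split.
  by exists i0; rewrite -(intr_eq0 rat) bE mulf_neq0 // intr_eq0.
rewrite -[RHS](scaler0 _ (D%:~R : rat)) -[in RHS]e scaler_sumr.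
by apply: eq_bigr => i _; rewrite intr_scale bE scalerA mulrC.
Qed.

Lemma tower_number_field (K : fieldExtType rat) (L : fieldExtType K) :
  number_field L.
Proof. exact: (rat_ext_number_field (baseFieldType L)). Qed.

(** * Local rings along a field embedding *)

Section Integers.
Variables (F E : fieldType) (iota : {rmorphism F -> E}).

Lemma integers_map x : 'O_F x -> 'O_E (iota x).
Proof.
move=> [q qm qx]; exists q => //; have := rmorph_root iota qx.
by rewrite -map_poly_comp -(@eq_map_poly _ _ intr) // => z;
  rewrite /= rmorph_int.
Qed.

Lemma integers_map_inv x : 'O_E (iota x) -> 'O_F x.
Proof.
move=> [q qm qx]; exists q => //; rewrite -(fmorph_root iota) -map_poly_comp.
by rewrite -(@eq_map_poly _ _ intr) // => z; rewrite /= rmorph_int.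
Qed.

Variables (P : finite_prime F) (Q : finite_prime E).
Hypothesis QP : forall x, 'O_F x -> (in_prime Q (iota x) <-> in_prime P x).

Lemma local_map x : local_ring P x -> local_ring Q (iota x).
Proof.
move=> /localP[a [s [Oa Os Ps ->]]]; apply/localP; exists (iota a), (iota s).
by split; [exact: integers_map|exact: integers_map|move=> /(QP Os)|rewrite
  fmorph_div].
Qed.

Lemma in_max_map x : in_max P x -> in_max Q (iota x).
Proof.
move=> [a [s [Pa Os Ps ->]]]; exists (iota a), (iota s).
split; [|exact: integers_map|by move=> /(QP Os)|by rewrite fmorph_div].
by apply/QP => //; exact: in_prime_int Pa.
Qed.

Hypothesis Fnum : number_field F.

(** Otherwise 1 / x is in the maximal ideal at P, its image is in the one at Q, and multiplying by
    the image of x puts 1 there. *)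
Lemma local_map_inv x : local_ring Q (iota x) -> local_ring P x.
Proof.
move=> Rx; have [//|mx] := local_or_inv P Fnum x.
have [->|x0] := eqVneq x 0; first exact: local0.
case: (@in_max1 _ Q); have := in_maxM Rx (in_max_map mx).
by rewrite -rmorphM divff // rmorph1.
Qed.

Lemma in_max_map_inv x : in_max Q (iota x) -> in_max P x.
Proof.
move=> mx; have Rx := local_map_inv (in_max_local mx).
apply: contrapT => nmx; have /local_map Rx' := local_inv Rx nmx.
have [x0|x0] := eqVneq x 0; first by case: nmx; rewrite x0; apply: in_max0.
case: (@in_max1 _ Q); have := in_maxM Rx' mx.
by rewrite -rmorphM mulVf // rmorph1.
Qed.

End Integers.

Lemma finite_prime_ext (F : fieldType) (P Q : finite_prime F) :
  (forall x, P x <-> Q x) -> P = Q.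
Proof.
case: P Q => P P1 P2 [Q Q1 Q2] /= PQ.
have e : P = Q by apply/funext => x; apply/propext.
by case: _ / e in Q1 Q2 {PQ} *; congr FinitePrime; apply: Prop_irrelevance.
Qed.

Lemma ideal_powX (R : comPzRingType) (I : set R) n x : I x ->
  ideal_pow I n (x ^+ n).
Proof.
move=> Ix; elim: n => // n IHn; apply: span_in.
by exists x, (x ^+ n); rewrite exprS.
Qed.

Lemma ideal_pow_sub1 (F : fieldType) (P : finite_prime F) n (y : 'O_F) : (0 <
  n)%N -> ideal_pow P n y -> P y.
Proof.
case: n => // n _; have idP := prime_is_ideal (prime_setP P).
apply: (span_min idP) => _ [a [b [Pa _ ->]]]; rewrite mulrC.
by case: idP => _ _; apply.
Qed.

(** * Totally ramified primes *)

Section TotallyRamified.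
Variables (K : fieldType) (L : fieldExtType K) (p : finite_prime K).
Variable (P : finite_prime L).
Hypothesis pP : @extended_ideal K L p = ideal_pow P (\dim {:L}).
Hypothesis Knum : number_field K.
Hypothesis Lnum : number_field L.
Notation dim := (\dim {:L}).

Lemma in_alg_integers (x : 'O_K) : exists y : 'O_L, incl _ y = (incl _ x)%:A.
Proof. by apply: integersE; apply: (integers_map (in_alg L)); apply: inclP. Qed.

Lemma dim_gt0 : (0 < dim)%N.
Proof. by rewrite adim_gt0. Qed.

Lemma extended_ideal_in (x : 'O_K) (y : 'O_L) : incl _ y = (incl _ x)%:A ->
  p x -> @extended_ideal K L p y.
Proof. by move=> yx px; apply: span_in; exists x. Qed.

Lemma ramified_lies_over : lies_over p P.
Proof.
have up (x : 'O_K) (y : 'O_L) : incl _ y = (incl _ x)%:A -> p x -> P y.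
  move=> yx px; apply: (@ideal_pow_sub1 _ _ dim); first exact: dim_gt0.
  by rewrite -pP; apply: extended_ideal_in yx px.
move=> x y yx; split=> [Py|]; last exact: up.
apply: contrapT => px.
have [|t /integersE[{}t <-]] := prime_maximal Knum (inclP x) (P := p).
  by move/in_primeP.
rewrite -rmorphM -(rmorph1 (incl 'O_K)) -rmorphB => /in_primeP pxt.
have [t' t'E] := in_alg_integers t.
have Pyt : P (y * t' - 1).
  by apply: up pxt; rewrite -[RHS]/(in_alg L _) !rmorphB !rmorphM !rmorph1 yx
    t'E.
apply: (prime_proper (prime_setP P)).
have -> : 1 = t' * y + (-1) * (y * t' - 1) by ring.
by have [_ D M] := prime_is_ideal (prime_setP P); apply: D; apply: M.
Qed.

(** P' contains the extension of p, which is a power of P, hence P by primality; and P is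
    maximal. *)
Lemma ramified_unique (P' : finite_prime L) : lies_over p P' -> P' = P.
Proof.
move=> P'p.
have idP' := prime_is_ideal (prime_setP P').
have PP' x : P x -> P' x.
  move=> Px; have : P' (x ^+ dim).
    have := ideal_powX dim Px; rewrite -pP.
    apply: (span_min idP') => y [z pz yz]; exact/(P'p _ _ yz).
  elim: dim => [|n IHn]; first by rewrite expr0 =>
    /(prime_proper (prime_setP P')).
  by rewrite exprS => /(prime_mul (prime_setP P'))[].
apply: finite_prime_ext => x; split=> [P'x|/PP'//].
apply: contrapT => Px.
have [|t /integersE[{}t <-]] := prime_maximal Lnum (inclP x) (P := P).
  by move/in_primeP.
rewrite -rmorphM -(rmorph1 (incl 'O_L)) -rmorphB => /in_primeP/PP' P'xt.
apply: (prime_proper (prime_setP P')).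
have -> : 1 = t * x + (-1) * (x * t - 1) by ring.
by have [_ D M] := idP'; apply: D; apply: M.
Qed.

Lemma ramified_in_prime x : 'O_K x ->
  (in_prime P (in_alg L x) <-> in_prime p x).
Proof.
move=> /integersE[{}x <-]; have [y yx] := in_alg_integers x.
by rewrite -[in_alg L _]yx !in_primeP; apply: ramified_lies_over.
Qed.

(* The residue degree is 1: if a is not congruent to an element of K, then
   1, pi, ..., pi ^ (m - 1), a are linearly independent over K. *)
Lemma ramified_residue a : local_ring P a ->
  exists2 b, local_ring p b & in_max P (a - in_alg L b).
Proof.
move=> Ra; apply: contrapT => none.
have [w [pw w0 wP]] := uniformizer_exists p Knum.
have [pi [r [mpi Rr wE]]] : exists pi r, [/\ in_max P pi, local_ring P r &
    in_alg L w = pi ^+ dim * r].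
  have [w' pw' w'E] := pw; have [y yw] := in_alg_integers w'.
  have /(extended_ideal_in yw) : p w' by [].
  rewrite pP => /(ideal_pow_sub Lnum)[pi [r [mpi Rr e]]].
  by exists pi, r; rewrite -e yw -w'E.
have iw0 : in_alg L w != 0 by rewrite fmorph_eq0.
have pi0 : pi != 0.
  apply: contra_neq iw0 => pi0; rewrite wE pi0 expr0n.
  by rewrite (gtn_eqF dim_gt0) mul0r.
(* Decreasing powers, so that valuations decrease with the index as in [sum_not_dvd] and the last
   term is 1. All are less than the valuation of w, since pi ^ dim divides w. *)
pose x (i : 'I_dim) := pi ^+ (dim.-1 - i).
have x0 i : x i != 0 by apply: expf_neq0.
pose y (i : 'I_dim.+1) := oapp x a (unlift ord0 i).
have [c [ci ce]] := linear_dependence y (ltnSn _).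
have [j [cj cmax]] := scale_to_local p Knum ci.
pose b i := (c j)^-1 * c i.
have bR i : local_ring p (b i) by rewrite /b mulrC; apply: cmax.
have be : in_alg L (b ord0) * a + \sum_i in_alg L (b (lift ord0 i)) * x i = 0.
  rewrite -[RHS](scaler0 _ (c j)^-1) -[in RHS]ce scaler_sumr big_ord_recl.
  rewrite /y unlift_none /= scalerA mulr_algl; congr (_ + _).
  by apply: eq_bigr => i _; rewrite liftK /= scalerA mulr_algl.
have RL := local_map ramified_in_prime.
have mL := in_max_map ramified_in_prime.
have wd z : in_max p z -> local_ring P (in_alg L z / in_alg L w).
  by move=> /wP/RL; rewrite fmorph_div.
have Rx i : local_ring P (x i) by apply/localX/in_max_local.
have tx i : in_max P (in_alg L w / x i).
  have -> : in_alg L w / x i = r * pi ^+ i * pi.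
    have di : (dim = dim.-1 - i + i.+1)%N.
      by rewrite addnS subnK ?prednK ?dim_gt0 // -ltnS prednK ?dim_gt0.
    rewrite wE [in LHS]di exprD exprS /x mulrC; field.
    by rewrite -/(x i) x0.
  by apply: in_maxM => //; apply: localM => //; apply/localX/in_max_local.
have last_lt : (dim.-1 < dim)%N by rewrite prednK ?dim_gt0.
pose last := Ordinal last_lt.
(* If the coefficient of a is a unit, solving for a modulo P leaves only the term of 1, an element
   of K. If not, w divides the term of a, hence also the combination of powers of pi, against
   [sum_not_dvd]. *)
have [mb0|nmb0] := pselect (in_max p (b ord0)); last first.
  have b00 : b ord0 != 0 by apply/eqP => b00; apply: nmb0; rewrite b00;
    apply: in_max0.
  have Rb i : local_ring p (b i / b ord0) by apply: localM => //;
    apply: local_inv.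
  apply: none; exists (- (b (lift ord0 last) / b ord0)); first exact: localN.
  have -> : a - in_alg L (- (b (lift ord0 last) / b ord0)) =
      - \sum_(i | i != last) in_alg L (b (lift ord0 i) / b ord0) * x i.
    have ib00 : in_alg L (b ord0) != 0 by rewrite fmorph_eq0.
    apply: (mulfI ib00); rewrite mulrBr rmorphN mulrN opprK mulrN mulr_sumr.
    move/eqP: be; rewrite addr_eq0 => /eqP ->.
    have xl : x last = 1 by rewrite /x /= subnn expr0.
    rewrite (bigD1 last) // xl mulr1 opprD fmorph_div.
    rewrite [_ (b ord0) * (_ / _)]mulrC divfK // addrAC addNr add0r;
      congr (- _).
    by apply: eq_bigr => i _;
      rewrite fmorph_div mulrA [_ (b ord0) * (_ / _)]mulrC divfK.
  apply/in_maxN/in_max_sum => i il; apply: in_maxM; first exact: RL.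
  rewrite /x; have : (0 < dim.-1 - i)%N.
    rewrite subn_gt0 ltn_neqAle -ltnS prednK ?dim_gt0 // ltn_ord andbT.
    by apply: contra_neq il => il; apply: val_inj.
  case: (_ - _)%N => // k _; rewrite exprSr; apply: in_maxM => //.
  exact/localX/in_max_local.
apply: (@sum_not_dvd _ P _ x (fun i =>
  in_alg L (b (lift ord0 i))) (in_alg L w)) => //.
- move=> i i' ii'; have i'd : (i' <= dim.-1)%N by rewrite -ltnS prednK ?dim_gt0.
  have di : (dim.-1 - i = dim.-1 - i' + (i' - i).-1.+1)%N.
    by rewrite prednK ?subn_gt0 // addnBA ?(ltnW ii') // subnK.
  rewrite /x di exprD mulrAC divff ?expf_neq0 // mul1r exprSr.
  by apply: in_maxM => //; apply/localX/in_max_local.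
- by move=> i; apply: RL.
- by move=> i /(in_max_map_inv ramified_in_prime Knum)/wd.
- have [i ji|j0] := unliftP ord0 j; last first.
    by case: (@in_max1 _ p); rewrite -(mulVf cj); move: mb0; rewrite /b -j0.
  by exists i; rewrite -ji /b mulVf // rmorph1; apply: in_max1.
- move/eqP: be; rewrite addrC addr_eq0 => /eqP ->; rewrite mulNr mulrAC.
  by apply/localN/localM => //; apply: wd.
Qed.

End TotallyRamified.

(** * Galois closure *)

(** A ring morphism between extensions of the rationals is linear over them, so its image is a
    subspace of the same dimension. *)
Lemma rmorph_image (E N : fieldExtType rat) (f : {rmorphism E -> N}) :
  exists V : {subfield N}, \dim V = \dim {:E} /\
    forall y, y \in V <-> exists x, f x = y.
Proof.
have fZ : scalable f.
  by move=> a x; rewrite rmorphZ_num -mulr_algl alg_num_field.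
pose fZm := GRing.isScalable.Build _ _ _ _ f fZ.
pose g : {lrmorphism E -> N} := HB.pack (GRing.RMorphism.sort f) fZm.
pose V := (linfun g @: {:E})%AS.
exists V; split.
  rewrite limg_dim_eq //; apply/eqP; rewrite -subv0; apply/subvP => x.
  rewrite memv_cap memvf memv_ker lfunE /= fmorph_eq0 => /eqP ->; exact: mem0v.
move=> y; split=> [/memv_imgP[x _ ->]|[x <-]]; first by exists x; rewrite lfunE.
by have -> : f x = linfun g x; [rewrite lfunE|apply: memv_img; rewrite memvf].
Qed.

Lemma rat_ext_pchar (L : fieldExtType rat) : [pchar L] =i pred0.
Proof.
move=> l; apply/negP => /andP[lp /eqP l0].
have /eqP := (rat_ext_number_field L).1 l 0 l0.
by rewrite eqz_nat => /eqP l0'; rewrite l0' in lp.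
Qed.

(** Evaluation at th makes L an algebra over the polynomial ring, as evaluation at z does for N. The
    first map is onto with kernel generated by p, which the second kills. *)
Lemma embedding_of_root (L N : fieldExtType rat) (p : {poly rat}) (th : L) (z
  : N) :
  <<1; th>>%VS = fullv -> minPoly 1 th = map_poly (in_alg L) p ->
  root (map_poly (in_alg N) p) z -> exists tau : {rmorphism L -> N}, True.
Proof.
move=> gen pE pz; pose k : comPzRingType := {poly rat}.
pose ev (E : fieldExtType rat) (x : E) : {rmorphism k -> E} := horner_alg x.
have evE (E : fieldExtType rat) (x : E) q : ev E x q = (map_poly (in_alg E)
  q).[x] by [].
have [b|q /eqP|g _] := @hom_factor_surj k (self k) (KAlg (ev L th)) (KAlg (ev
  N z))
  (str_hom (KAlg (ev L th))) (str_hom (KAlg (ev N z))); last by exists g.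
- have /Fadjoin_poly_eq bE : b \in <<1; th>>%VS by rewrite gen memvf.
  have /polyOver1P[q qE] := Fadjoin_polyOver 1 th b.
  by exists q; rewrite /= evE -qE.
rewrite /= !evE => /eqP qth; apply/eqP; move: pz.
have : minPoly 1 th %| map_poly (in_alg L) q.
  by apply: minPoly_dvdp; [apply/polyOver1P; exists q|apply/rootP].
by rewrite pE dvdp_map => /dvdpP[q' ->] /rootP pz;
  rewrite rmorphM hornerM pz mulr0.
Qed.

(** N is a splitting field over the rationals of the minimal polynomial of a primitive element; it
    is then Galois over the images of both K and L. *)
Lemma splitting_embedding (L : fieldExtType rat) :
  exists (N : splittingFieldType rat) (tau : {rmorphism L -> N}), True.
Proof.
have sep : separable 1 {:L}.
  by apply/separableP => y _; apply: pcharf0_separable; apply: rat_ext_pchar.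
have thE := eq_adjoin_separable_generator sep (sub1v _).
set th := separable_generator _ _ in thE.
have /polyOver1P[p pE] := minPolyOver 1 th.
have p0 : p != 0.
  by rewrite -(map_poly_eq0 (in_alg L)) -pE monic_neq0 // monic_minPoly.
have [r rE] := closed_field_poly_normal (map_poly ratr p : {poly algC}).
have [N [NC [s sr gen]]] := num_field_exists r.
have pN : map_poly (in_alg N) p %= \prod_(z <- s) ('X - z%:P).
  rewrite -(eqp_map NC) -map_poly_comp (@eq_map_poly _ _ _ ratr); last first.
    by move=> a; rewrite /= alg_num_field fmorph_rat.
  rewrite rE rmorph_prod /=;
    under [X in _ %= X]eq_bigr do rewrite map_polyXsubC.
  rewrite -(big_map NC xpredT (fun z => 'X - z%:P)) sr.
  by apply: eqp_scale; rewrite lead_coef_eq0 map_poly_eq0.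
have splitN : splitting_field_axiom N.
  exists (map_poly (in_alg N) p); first by apply/polyOver1P; exists p.
  by exists s.
pose Nm := FieldExt_isSplittingField.Build rat N splitN.
pose N' : splittingFieldType rat := HB.pack (FieldExt.sort N) Nm.
exists N'.
have [z zs] : exists z, z \in s.
  have : size (\prod_(z <- s) ('X - z%:P)) != 1%N.
    rewrite -(eqp_size pN) size_map_poly -(size_map_poly (in_alg L)) -pE.
    by rewrite size_minPoly eqSS -lt0n.
  rewrite size_prod_XsubC eqSS; case: (s) => // a s' _; exists a.
  exact: mem_head.
apply: (@embedding_of_root L N p th z) => //.
by rewrite (eqp_root pN) root_prod_XsubC.
Qed.

Section GaloisConjugates.
Local Open Scope group_scope.

(* The T i represent the cosets of Gal(N / L) in Gal(N / K). *)
Lemma galois_conjugates (K : fieldExtType rat) (L : fieldExtType K) :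
  exists (N : fieldExtType rat) (tau : {rmorphism L -> N})
    (G : set {rmorphism N -> N}) (T : 'I_(\dim {:L}) -> {rmorphism N -> N}),
  [/\ forall g, G g -> forall a : K, g (tau a%:A) = tau a%:A,
      forall y, (forall g, G g -> g y = y) -> exists a : K, tau a%:A = y,
      forall i, G (T i) &
      forall g, G g -> exists2 s : 'I_(\dim {:L}) ->
        'I_(\dim {:L}), injective s &
        forall i x, g (T i (tau x)) = T (s i) (tau x)].
Proof.
have [N [tau _]] := splitting_embedding (baseFieldType L).
have [L' [dL L'P]] := rmorph_image tau.
have [K' [dK K'P]] := @rmorph_image K N (tau \o in_alg L)%FUN.
have KL : (K' <= L')%VS.
  by apply/subvP => y /K'P[x <-]; apply/L'P; exists (in_alg L x).
have gal (V : {subfield N}) : galois V {:N}.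
  rewrite /galois subvf normalFieldf andbT.
  by apply/separableP => y _; apply: pcharf0_separable; apply: rat_ext_pchar.
pose GK := 'Gal({:N} / K')%G; pose GL := 'Gal({:N} / L')%G.
have GLK : GL \subset GK by apply: galS.
(* The index is computed from degrees over the rationals, where N, L and K are all vector spaces
   over the same field. *)
have idx : #|rcosets GL GK| = \dim {:L}.
  rewrite -[LHS]/(#|GK : GL|%g) -divgS // -!galois_dim //.
  have dLK : \dim L' = (\dim {:L} * \dim K')%N.
    rewrite dK -dim_baseVspace dL; congr (\dim _).
    apply/vspaceP => x; rewrite memvf mem_baseVspace; exact/esym/memvf.
  have /dvdnP[e eE] := field_dimS (subvf L').
  have L0 : (0 < \dim L')%N by rewrite adim_gt0.
  have e0 : (0 < e)%N.
    by have := adim_gt0 {:N}%AS; rewrite /= eE; case: (e).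
  rewrite /= eE.
  by rewrite mulnK // dLK mulnA mulnK ?adim_gt0 // mulKn.
pose C (i : 'I_(\dim {:L})) : {set gal_of {:N}} :=
  enum_val (cast_ord (esym idx) i).
have CP i : C i \in rcosets GL GK by apply: enum_valP.
have Cinj : injective C by move=> i j /enum_val_inj/cast_ord_inj.
have Csurj A : A \in rcosets GL GK -> exists i, C i = A.
  move=> AP; exists (cast_ord idx (enum_rank_in AP A)).
  by rewrite /C cast_ordK enum_rankK_in.
pose aut (x : gal_of {:N}) : {rmorphism N -> N} := (x : 'AEnd(N)).
have autE x y : aut x y = x y by [].
have CK i : repr (C i) \in GK.
  have /rcosetsP[x xK ->] := CP i.
  have /rcosetP[y yL ->] := mem_repr_rcoset GL x.
  by rewrite groupM // (fintype.subsetP GLK).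
have Crepr i : C i = GL :* repr (C i).
  have /rcosetsP[x xK ->] := CP i; exact/esym/rcoset_repr.
exists N, tau, (fun g => exists2 x, x \in GK & g =1 aut x), (fun i =>
  aut (repr (C i))).
split.
- move=> g [x xK gx] a; rewrite gx autE (fixed_gal (subvf K') xK) //.
  by apply/K'P; exists a.
- move=> y fy; have : y \in fixedField GK.
    apply/fixedFieldP; first exact: memvf.
    by move=> x xK; rewrite -autE; apply: fy; exists x.
  by rewrite (galois_fixedField (gal K')) => /K'P[a <-]; exists a.
- by move=> i; exists (repr (C i)).
- move=> g [x xK gx].
  (* In a Galois group the left factor of a product acts first. So a right coset of Gal(N / L)
     determines the restriction to L, and composing with g multiplies the coset by x on the
     right. *)
  have /choice[s sE] i : exists j, C j = C i :* x.
    by apply: Csurj; rewrite Crepr -rcosetM; apply/rcosetsP;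
      exists (repr (C i) * x); rewrite ?groupM.
  exists s.
    move=> i j ij; apply: Cinj; have := sE i; rewrite ij sE.
    by move=> /(congr1 (fun A => A :* x^-1)); rewrite -!rcosetM mulgV !rcoset1.
  move=> i z; rewrite gx !autE -galM ?memvf //.
  have : repr (C i) * x \in GL :* repr (C (s i)).
    rewrite -Crepr sE mem_rcoset mulgK; move: (Crepr i) => {2}->;
      exact: rcoset_refl.
  move=> /rcosetP[h hL ->]; rewrite galM ?memvf //; congr (_ _).
  by rewrite (fixed_gal (subvf L') hL) //; apply/L'P; exists z.
Qed.

End GaloisConjugates.

(** * Primes above and below a given prime, and residue rings *)

Lemma exists_prime_ideal (R : comPzRingType) (I : set R) : ideal I -> ~ I 1 ->
  exists2 M, prime_ideal M & forall x, I x -> M x.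
Proof.
move=> idI I1.
pose T := {J : set R | [/\ ideal J, (forall x, I x -> J x) & ~ J 1]}.
pose le (J J' : T) := `[< forall x, sval J x -> sval J' x >].
have [||||[M [idM IM M1]] Mmax] := @Zorn T le.
- by move=> J; apply/asboolP.
- by move=> J K H /asboolP JK /asboolP KH; apply/asboolP => x /JK/KH.
- move=> [J PJ] [K PK] /asboolP JK /asboolP KJ; apply: eq_exist.
  by apply/seteqP; split=> x; [apply: JK|apply: KJ].
- move=> C Ctot; have [[J0 CJ0]|none] := pselect (exists J, C J); last first.
    exists (exist _ I (And3 idI (fun x Ix => Ix) I1)) => J CJ.
    by case: none; exists J.
  pose U x := exists2 J, C J & sval J x.
  have PU : [/\ ideal U, (forall x, I x -> U x) & ~ U 1].
    split.
    - split.
      + by exists J0 => //; case: (svalP J0) => -[].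
      + move=> x y [J CJ Jx] [K CK Ky].
        have [/asboolP JK|/asboolP KJ] := Ctot _ _ CJ CK.
          by exists K => //; have [[_ D _] _ _] := svalP K; apply: D => //;
            apply: JK.
        by exists J => //; have [[_ D _] _ _] := svalP J; apply: D => //;
          apply: KJ.
      + by move=> a x [J CJ Jx]; exists J => //; have [[_ _ X] _ _] :=
        svalP J; apply: X.
    - by move=> x Ix; exists J0 => //; have [_ IJ _] := svalP J0; apply: IJ.
    - by move=> [J CJ]; have [_ _] := svalP J.
  by exists (exist _ U PU) => J CJ; apply/asboolP => x Jx; exists J.
exists M => //; split=> // x y Mxy.
have [Mx|Mx] := pselect (M x); [by left|right].
pose J z := exists m a, M m /\ z = m + a * x.
have [M0 MD MM] := idM.
have idJ : ideal J.
  split.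
  - by exists 0, 0; rewrite mul0r addr0.
  - move=> _ _ [m [a [Mm ->]]] [m' [a' [Mm' ->]]].
    by exists (m + m'), (a + a'); split; [exact: MD|ring].
  - by move=> b _ [m [a [Mm ->]]]; exists (b * m), (b * a); split;
    [exact: MM|ring].
have MJ z : M z -> J z by exists z, 0; rewrite mul0r addr0.
have [[m [a [Mm e]]]|J1] := pselect (J 1).
  have -> : y = y * m + a * (x * y) by rewrite mulrA -[LHS]mulr1 e; ring.
  by apply: MD; apply: MM.
have eMJ : M = J.
  apply: (esym (congr1 sval (Mmax (exist _ J (And3 idJ (fun z Iz =>
    MJ z (IM z Iz)) J1) : T) _))).
  exact/asboolP.
by case: Mx; rewrite eMJ; exists 0, 1; rewrite add0r mul1r.
Qed.

Section LyingOver.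
Variables (F E : fieldType) (iota : {rmorphism F -> E}) (P : finite_prime F).
Hypothesis Fnum : number_field F.

Lemma common_denominator n (y : 'I_n -> F) : (forall i, local_ring P (y i)) ->
  exists s, [/\ 'O_F s, ~ in_prime P s & forall i, 'O_F (s * y i)].
Proof.
elim: n y => [|n IHn] y Ry.
  by exists 1; split; [exact: integers1|exact: in_prime1|case].
have [s [Os Ps sy]] := IHn (fun i => y (lift ord0 i)) (fun i => Ry _).
have /localP[a [t [Oa Ot Pt yE]]] := Ry ord0.
exists (s * t); split; [exact: integersM|by move=> /in_prime_mul[]|move=> i].
have [j ->|->] := unliftP ord0 i.
  by rewrite -mulrA [t * _]mulrC mulrA; apply: integersM.
by rewrite yE -mulrA [t * _]mulrC divfK ?(notin_prime_unit Pt) //;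
  apply: integersM.
Qed.

(* If 1 = sum a_i x_i with x_i in P,
  let x_j have minimal valuation: then s / x_j
   is integral for a common denominator s of the x_i / x_j, and s is in P. *)
Lemma lying_over : exists Q : finite_prime E,
  forall x, 'O_F x -> (in_prime Q (iota x) <-> in_prime P x).
Proof.
pose S (y : 'O_E) := exists2 x, in_prime P x & incl _ y = iota x.
have S1 : ~ span S 1.
  move=> [n [a [b [Sb e]]]].
  have /choice[x xP] i : exists x, in_prime P x /\ incl _ (b i) = iota x.
    by have [x Px xE] := Sb i; exists x.
  have {}e : 1 = \sum_i incl _ (a i) * iota (x i).
    rewrite -(rmorph1 (incl 'O_E)) e rmorph_sum; apply: eq_bigr => i _.
    by rewrite rmorphM; have [_ ->] := xP i.
  have [|j [xj0 xmax]] := @scale_to_local _ P Fnum _ x.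
    apply: contrapT => none; have /eqP := oner_neq0 E; apply;
      rewrite e big1 // => i _.
    have [->|xi] := eqVneq (x i) 0; first by rewrite rmorph0 mulr0.
    by case: none; exists i.
  have [s [Os Ps sx]] := common_denominator xmax.
  have /integers_map_inv Ow : 'O_E (iota (s / x j)).
    rewrite -[iota _]mulr1 e mulr_sumr; elim/big_rec: _ => [|i y _ Oy].
      exact: integers0.
    apply: integersD => //; rewrite mulrCA -rmorphM; apply: integersM;
      first exact: inclP.
    by rewrite -mulrA [_^-1 * _]mulrC; apply: integers_map.
  apply: Ps; rewrite -(divfK xj0 s); apply: in_primeMl => //; by have [] :=
    xP j.
have [M Mprime SM] := exists_prime_ideal (span_ideal S) S1.
have [x0 Px0 x00] := prime_nonzero P.
have [y0 y0E] := integersE (integers_map iota (inclP x0)).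
have M0 : exists2 x, M x & x <> 0.
  exists y0; first by apply/SM/span_in; exists (incl _ x0) => //;
    apply/in_primeP.
  move=> y00; apply: x00; apply: val_inj; apply: (fmorph_inj iota).
  by rewrite -[LHS]y0E y00 !rmorph0.
pose Q := FinitePrime Mprime M0; exists Q => x Ox.
have up z : in_prime P z -> in_prime Q (iota z).
  move=> Pz; have [y yE] := integersE (integers_map iota (in_prime_int Pz)).
  by rewrite -yE; apply/in_primeP/SM/span_in; exists z.
split=> [Qx|]; last exact: up.
apply: contrapT => Px; have [t Ot Pt] := prime_maximal Fnum Ox Px.
apply: (@in_prime1 _ Q).
have -> : 1 = iota t * iota x - iota (x * t - 1).
  by rewrite rmorphB rmorphM rmorph1; ring.
apply: in_primeD; last by apply/in_primeN/up.
by apply: in_primeMl => //; apply: integers_map.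
Qed.

End LyingOver.

Section QuotientRing.
Variables (R : comPzRingType) (I : set R).
Hypothesis idI : ideal I.

Definition quot_pre : pre_ring.
Proof.
apply: (@PreRing R (fun x y => I (x - y)) 0 1 -%R +%R *%R).
all: have [I0 ID IM] := idI; have IE (x y : R) : x = y -> I x ->
  I y by move=> ->.
- by move=> x; rewrite subrr.
- by move=> x y; move/(IM (-1)); apply: IE; ring.
- by move=> x y z xy yz; apply: IE (ID _ _ xy yz); ring.
- by move=> x y; move/(IM (-1)); apply: IE; ring.
- by move=> x x' y y' xx yy; apply: IE (ID _ _ xx yy); ring.
- by move=> x x' y y' xx yy; apply: IE (ID _ _ (IM y _ xx) (IM x' _ yy)); ring.
- by move=> x y z; apply: IE I0; ring.
- by move=> x y; apply: IE I0; ring.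
- by move=> x; apply: IE I0; ring.
- by move=> x; apply: IE I0; ring.
- by move=> x y z; apply: IE I0; ring.
- by move=> x y; apply: IE I0; ring.
- by move=> x; apply: IE I0; ring.
- by move=> x y z; apply: IE I0; ring.
Defined.

Lemma quotient_ring :
  exists (C : comPzRingType) (r : {rmorphism R ->
    C}), forall x, r x = 0 <-> I x.
Proof.
pose C : comPzRingType := pr_quot quot_pre.
pose h (x : R) : C := @pr_class quot_pre x.
have hN : zmod_morphism h by move=> x y;
  rewrite /h -[- pr_class _]pr_classN -pr_classD.
have hM : monoid_morphism h by split=> // x y; rewrite /h -pr_classM.
pose m1 := GRing.isZmodMorphism.Build _ _ h hN.
pose m2 := GRing.isMonoidMorphism.Build _ _ h hM.
pose f : {rmorphism R -> C} := HB.pack h m1 m2.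
exists C, f => x; rewrite -[f x]/(h x) /h -pr_class0 pr_classP /=.
by rewrite -[X in _ <-> I X]subr0.
Qed.

End QuotientRing.

(** Translation by x permutes the n elements of V; comparing the sum of all elements before and
    after gives n x = 0. *)
Lemma finite_zmod_order (V : zmodType) n (x : V) :
  ([set: V] #= `I_n)%card -> x *+ n = 0.
Proof.
move=> /card_set_bijP[f [fn finj fsurj]].
have /choice[g gK] (i : 'I_n) : exists v, f v = i.
  by have [v _ vE] := fsurj i (ltn_ord i); exists v.
have gf v : exists i : 'I_n, g i = v.
  have vn : (f v < n)%N by apply: fn.
  by exists (Ordinal vn); apply: finj; rewrite ?in_setT // gK.
have ginj : injective g by move=> i j ij; apply: val_inj; rewrite /= -!gK ij.
have /choice[s sE] i : exists j, g j = g i + x by apply: gf.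
have sinj : injective s.
  by move=> i j ij; apply: ginj; apply: (addIr x); rewrite -!sE ij.
have : \sum_i g i = \sum_i g (s i) by apply: (reindex_inj sinj).
under [RHS]eq_bigr do rewrite sE.
rewrite big_split /= sumr_const card_ord.
by move=> /esym/(canRL (addKr _)) ->; rewrite addNr.
Qed.

(** The preimage of Q is nonzero because Q contains a positive integer. *)
Lemma contraction (F E : fieldType) (iota : {rmorphism F -> E})
    (Q : finite_prime E) : number_field E ->
  exists P : finite_prime F,
    forall x, 'O_F x -> (in_prime Q (iota x) <-> in_prime P x).
Proof.
move=> Enum; pose S (x : 'O_F) := in_prime Q (iota (incl _ x)).
have OE (x : 'O_F) : 'O_E (iota (incl _ x)) by apply: integers_map;
  apply: inclP.
have Sprime : prime_ideal S.
  split.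
  - split; rewrite /S.
    + by rewrite !rmorph0; apply: in_prime0.
    + by move=> x y Sx Sy; rewrite !rmorphD; apply: in_primeD.
    + by move=> a x Sx; rewrite !rmorphM; apply: in_primeMl => //; apply: OE.
  - by rewrite /S !rmorph1; apply: in_prime1.
  - by move=> x y; rewrite /S !rmorphM; apply: in_prime_mul; apply: OE.
have [n [n0 Qn]] := prime_nonzero_int Q Enum.
have S0 : exists2 x, S x & x <> 0.
  exists n%:R; first by rewrite /S !rmorph_nat.
  move=> n00; have : iota (incl _ (n%:R : 'O_F)) = 0 by rewrite n00 !rmorph0.
  rewrite !rmorph_nat -[n%:R]/((Posz n)%:~R) -(rmorph0 (intr : int -> E)).
  by move=> /Enum.1; case: n n0 {Qn n00}.
by exists (FinitePrime Sprime S0) => x /integersE[y <-]; rewrite in_primeP.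
Qed.

(** A denominator s outside P is invertible modulo P, so h sends it to a unit, and h kills a / s as
    soon as it kills a. *)
Lemma local_kernel (F : fieldType) (P : finite_prime F) (C : comPzRingType)
    (h : {rmorphism local_ring P -> C}) : number_field F ->
  (forall x : 'O_F, P x -> h (to_local P x) = 0) ->
  forall y : local_ring P, in_max P (incl _ y) -> h y = 0.
Proof.
move=> Fnum hP y [a [s [[a' Pa' aE] Os Ps yE]]].
have [t Ot] := prime_maximal Fnum Os Ps.
have [s' s'E] := integersE Os; have [t' t'E] := integersE Ot.
rewrite -s'E -t'E -rmorphM -(rmorph1 (incl 'O_F)) -rmorphB => /in_primeP/hP.
rewrite !rmorphB !rmorphM !rmorph1 => /eqP; rewrite subr_eq0 => /eqP st.
have ya : y * to_local P s' = to_local P a'.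
  apply: val_inj; rewrite /= -/(incl _ _) -[val y]/(incl _ y) -[LHS]/(incl _ y
    * incl _ s').
  by rewrite yE -aE s'E divfK // (notin_prime_unit Ps).
by rewrite -[h y]mulr1 -st mulrA -(rmorphM h y) ya hP ?mul0r.
Qed.

(** * Reduction of points *)

Lemma local_elt (F : fieldType) (P : finite_prime F) x : local_ring P x ->
  exists y : local_ring P, incl _ y = x.
Proof. by move=> Rx; exists (SubringType (asboolT Rx)). Qed.

Lemma incl_inj (F : fieldType) (S : subring F) : injective (incl S).
Proof. exact: val_inj. Qed.

Section Reduction.
Variables (K : fieldExtType rat) (p : finite_prime K).
Variables (kp : fieldType) (rp : {rmorphism local_ring p -> kp}).
Hypothesis rpP : is_residue_field p (rp \o to_local p).
Variables (L : fieldExtType K) (P : finite_prime L).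
Hypothesis pP : @extended_ideal K L p = ideal_pow P (\dim {:L}).

Let Knum : number_field K := rat_ext_number_field K.
Let Lnum : number_field L := tower_number_field L.
Notation Rp := (local_ring p).

Lemma residue_ker (y : Rp) : rp y = 0 <-> in_max p (incl _ y).
Proof.
split; last by apply: local_kernel => // x px; apply/rpP.2.
move=> ry; apply: contrapT => my.
have y0 : incl _ y != 0.
  by apply/eqP => y0; apply: my; rewrite y0; apply: in_max0.
have [z zE] := local_elt (local_inv (inclP y) my).
have : rp (y * z) = 1.
  by rewrite -(rmorph1 rp); congr (rp _); apply: incl_inj;
    rewrite rmorphM zE divff ?rmorph1.
by rewrite rmorphM ry mul0r => /esym/eqP; rewrite oner_eq0.
Qed.

Lemma residue_surj c : exists y, rp y = c.
Proof. by have [x xE] := rpP.1 c; exists (to_local p x). Qed.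

Definition local_ext : kalg Rp :=
  KAlg (subring_map (local_map (ramified_in_prime pP Knum))).

Lemma local_ext_str c : incl _ (str local_ext c) = in_alg L (incl _ c).
Proof. by []. Qed.

(** Residue degree 1 lets reduction modulo P take values in the residue field of p: x goes to the
    residue of any b in the local ring at p congruent to x, and [rb] shows that the choice of b is
    immaterial. *)
Lemma residue_hom : exists rho : hom local_ext (KAlg rp),
  (forall c, exists x, rho x = c) /\
  (forall x, rho x = 0 <-> in_max P (incl _ (x : local_ring P))).
Proof.
have /choice[b bP] (x : local_ring P) :
    exists b : Rp, in_max P (incl _ x - in_alg L (incl _ b)).
  have [b /local_elt[b' <-] mb] := ramified_residue pP Knum Lnum (inclP x).
  by exists b'.
have rb x c : in_max P (incl _ x - in_alg L (incl _ c)) -> rp (b x) = rp c.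
  move=> xc; apply/eqP; rewrite -subr_eq0 -rmorphB; apply/eqP/residue_ker.
  suff : in_max P (in_alg L (incl _ (b x - c))).
    exact: (in_max_map_inv (ramified_in_prime pP Knum) Knum).
  have -> : in_alg L (incl _ (b x - c)) =
     (incl _ x - in_alg L (incl _ c)) - (incl _ x - in_alg L (incl _ (b x))).
    by rewrite !rmorphB; ring.
  by apply: in_maxD => //; apply/in_maxN.
pose h x := rp (b x).
have hN : zmod_morphism h.
  move=> x y; rewrite /h -rmorphB; apply: rb.
  have -> : incl _ (x - y) - in_alg L (incl _ (b x - b y)) =
     (incl _ x - in_alg L (incl _ (b x))) - (incl _ y - in_alg L (incl _ (b
       y))).
    by rewrite !rmorphB; ring.
  by apply: in_maxD => //; apply/in_maxN.
have hM : monoid_morphism h.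
  split=> [|x y].
    rewrite /h -(rmorph1 rp); apply: rb.
    by rewrite !rmorph1 subrr; apply: in_max0.
  rewrite /h -rmorphM; apply: rb.
  have -> : incl _ (x * y) - in_alg L (incl _ (b x * b y)) =
     incl _ x * (incl _ y - in_alg L (incl _ (b y))) +
     in_alg L (incl _ (b y)) * (incl _ x - in_alg L (incl _ (b x))).
    by rewrite !rmorphM; ring.
  apply: in_maxD; apply: in_maxM => //; first exact: inclP.
  by rewrite -local_ext_str; apply: inclP.
pose m1 := GRing.isZmodMorphism.Build _ _ h hN.
pose m2 := GRing.isMonoidMorphism.Build _ _ h hM.
pose f : {rmorphism local_ring P -> kp} := HB.pack h m1 m2.
have hs c : f (str local_ext c) = str (KAlg rp) c.
  by apply: rb; rewrite local_ext_str subrr; apply: in_max0.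
exists (@Hom Rp local_ext (KAlg rp) f hs); split=> [c|x].
  by have [y <-] := residue_surj c; exists (str local_ext y); rewrite [LHS]hs.
rewrite -[_ x]/(rp (b x)) residue_ker; split=> mx.
  rewrite -[incl _ x](subrK (in_alg L (incl _ (b x)))); apply: in_maxD => //.
  exact: (in_max_map (ramified_in_prime pP Knum)).
suff : in_max P (in_alg L (incl _ (b x))).
  exact: (in_max_map_inv (ramified_in_prime pP Knum) Knum).
rewrite -[in_alg L _](subKr (incl _ x)); apply: in_maxD => //.
exact: in_maxN.
Qed.

End Reduction.

Lemma gmap_ext (k : comPzRingType) (G : group_functor k) (A B : kalg k)
  (f g : hom A B) x : f =1 g -> gmap G f x = gmap G g x.
Proof. exact: (@fmap_ext k G A B f g x). Qed.

Lemma gmapM (k : comPzRingType) (G : group_functor k) (A B C : kalg k)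
  (g : hom B C) (f : hom A B) x : gmap G g (gmap G f x) = gmap G (comp_hom g
    f) x.
Proof. exact: (@fmapM k G A B C g f x). Qed.

Section PointReduction.
Variables (K : fieldExtType rat) (A : group_functor K).
Hypothesis HA : abelian_scheme A.
Hypothesis AK0 : forall x : points A (self K), x = 0.
Variables (p : finite_prime K) (M : good_model A p).
Variables (kp : fieldType) (rp : {rmorphism local_ring p -> kp}).
Hypothesis rpP : is_residue_field p (rp \o to_local p).
Variables (L : fieldExtType K) (P : finite_prime L).
Hypothesis pP : @extended_ideal K L p = ideal_pow P (\dim {:L}).

Let Knum : number_field K := rat_ext_number_field K.
Let Lnum : number_field L := tower_number_field L.
Notation Rp := (local_ring p).
Notation RL := (local_ext pP).

Variable rho : hom RL (KAlg rp).
Hypothesis rho_ker : forall x,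
  rho x = 0 <-> in_max P (incl _ (x : local_ring P)).

Definition gen_hom : hom RL (restr (incl Rp) (restr (in_alg L) (self L))) :=
  @Hom Rp RL (restr (incl Rp) (restr (in_alg L) (self L)))
    (incl (local_ring P)) (fun=> erefl).

(* The point Q of A(L) extends to a point of the model over the local ring of L,
   contained in an affine open subfunctor. *)
Inductive integral_lift (Q : points (extend_scalars L A) (self L)) : Prop :=
  IntegralLift (U : subfunctor (model M)) (B : kalg Rp) (u : model M B) (f :
    hom B RL)
    of is_open U & represents U u & finitely_presented B
     & generic_fibre M (restr (in_alg L) (self L))
         (gmap (model M) gen_hom (gmap (model M) f u)) = Q.

Lemma lift_point Q : integral_lift Q.
Proof.
have [_ [Mcov _] [_ _ Mclosed] _] := model_abelian M.
have [g gK Kg] := generic_fibre_bij M (restr (in_alg L) (self L)).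
pose i : {rmorphism RL -> L} := incl (local_ring P).
(* [C1] and [C2] are both the field L over [Rp], with structure maps presented as different
   composites; the identity of L passes between them. *)
pose C1 : kalg Rp := KAlg (i \o str RL).
pose C2 := restr (incl Rp) (restr (in_alg L) (self L)).
pose h12 : hom C1 C2 := @Hom Rp C1 C2 idfun (fun=> erefl).
pose h21 : hom C2 C1 := @Hom Rp C2 C1 idfun (fun=> erefl).
have val (x : L) : (exists v, i v = x) \/ (exists v, rho v = 0 /\ i v * x = 1).
  have [->|x0] := eqVneq x 0; first by left; exists 0; rewrite rmorph0.
  have [/local_elt[v vx]|mx] := local_or_inv P Lnum x; first by left; exists v.
  have [v vx] := local_elt (in_max_local mx); right; exists v.
  split; first by apply/rho_ker; rewrite vx.
  by rewrite [i v]vx mulVf.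
pose X : functor Rp := model M.
pose gQ : X C2 := g Q.
have [U [B [u [f [oU Uu fpB fuE]]]]] :=
  @valuative_criterion _ X (@finitely_presented Rp) Mclosed Mcov RL L kp i rho
    (@incl_inj _ _) val
    (@fmap _ X C2 C1 h21 gQ).
apply: (IntegralLift oU Uu fpB (f := f)).
rewrite -[RHS]Kg; congr (generic_fibre M _ _).
change (@fmap _ X RL C2 gen_hom (fmap f u) = gQ).
rewrite -[gQ]fmap1 (fmap_ext (g := comp_hom h12 h21)) // -fmapM -fuE !fmapM.
exact: fmap_ext.
Qed.

(* The sum of the conjugates of q is a point of A over K, hence 0;
  as the residue
   degree is 1, all conjugates of q have the reduction of q. *)
Lemma reduction_torsion (q : points (model M) RL) :
  gmap (model M) rho q *+ \dim {:L} = 0.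
Proof.
have [_ _ [_ Msep _] _] := model_abelian M.
have [[_ Acov] _ _ _] := HA.
have [N [tau [G [T [Gfix Ginv GT Gperm]]]]] := galois_conjugates L.
have Nnum := rat_ext_number_field N.
pose iota : {rmorphism K -> N} := tau \o in_alg L.
have [PN PNp] := lying_over iota p Knum.
pose RN : kalg Rp := KAlg (subring_map (local_map PNp)).
pose sigma i : {rmorphism L -> N} := T i \o tau.
have sK i a : sigma i (in_alg L a) = iota a by exact: Gfix.
have sP i x : 'O_L x -> (in_prime PN (sigma i x) <-> in_prime P x).
  have [P' P'P] := contraction (sigma i) PN Nnum.
  suff <- : P' = P by apply: P'P.
  apply: (ramified_unique pP Lnum) => {}x y yx.
  rewrite -!in_primeP -P'P; last exact: inclP.
  by rewrite yx -[_%:A]/(in_alg L _) sK PNp //; exact: inclP.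
pose sR i : {rmorphism RL -> local_ring PN} := subring_map (local_map (sP i)).
have sRs i c : sR i (str RL c) = str RN c by apply: incl_inj; apply: sK.
pose sH i : hom RL RN := @Hom Rp RL RN (sR i) (sRs i).
pose CN : kalg K := KAlg iota.
pose toN : hom RN (restr (incl Rp) CN) :=
  @Hom Rp RN (restr (incl Rp) CN) (incl (local_ring PN)) (fun=> erefl).
pose CL : kalg K := restr (in_alg L) (self L).
have sKs i c : sigma i (str CL c) = str CN c by apply: sK.
pose sN i : hom CL CN := @Hom K CL CN (sigma i) (sKs i).
pose Q : points A CL := generic_fibre M CL (gmap (model M) gen_hom q).
pose S : points A CN := \sum_i gmap A (sN i) Q.
have S0 : S = 0.
  have [||y yS] := @galois_descent K N A iota
      (fun s => exists2 g, G g & forall x, s x = g x) S Acov.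
  - move=> y fy; have [|a aE] := Ginv y; last by exists a.
    move=> g Gg; have gs c : g (str CN c) = str CN c by apply: Gfix.
    by apply: (fy (@Hom K CN CN g gs)); exists g.
  - move=> s [g Gg gE]; have [pi pi_inj piE] := Gperm _ Gg.
    change (gmap A s S = S); rewrite /S raddf_sum [RHS](reindex_inj pi_inj).
    apply: eq_bigr => i _; rewrite gmapM; apply: gmap_ext => x.
    by rewrite /= gE; apply: piE.
  - by rewrite -yS (AK0 y); exact: (raddf0 (gmap A (str_hom CN))).
(* The relation in A(N) holds already for the integral points, as the local ring of N embeds in N
   and the model is separated. *)
have sum0 : \sum_i gmap (model M) (sH i) q = 0.
  have toN_inj : injective (gmap (model M) toN).
    apply: (@separated_inj _ (model M)) => // a a0.
    by apply: incl_inj; rewrite rmorph0.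
  apply: toN_inj; apply: (bij_inj (generic_fibre_bij M CN)).
  rewrite !raddf0 -[RHS]S0 !raddf_sum; apply: eq_bigr => i _.
  rewrite -generic_fibre_nat; congr (generic_fibre M CN _).
  change (gmap (model M) toN (gmap (model M) (sH i) q) =
    gmap (model M) (restr_hom (incl Rp) (sN i)) (gmap (model M) gen_hom q)).
  by rewrite !gmapM; apply: gmap_ext.
have idN : ideal (fun x : local_ring PN => in_max PN (incl _ x)).
  split=> [|x y mx my|a x mx]; rewrite ?rmorph0 ?rmorphD ?rmorphM.
  - exact: in_max0.
  - exact: in_maxD.
  - by apply: in_maxM => //; apply: inclP.
(* C is the local ring of N modulo its maximal ideal, used only as a nonzero ring. The field [kp]
   maps to it injectively, hence so do its points by separatedness, and the relation can be checked
   over C. *)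
have [C [r rP]] := quotient_ring idN.
pose CC : kalg Rp := KAlg (r \o str RN).
pose rH : hom RN CC := @Hom Rp RN CC r (fun=> erefl).
have [j jE] : exists j : hom (KAlg rp) CC, forall c, j (rp c) = r (str RN c).
  have [||j jE] := @hom_factor_surj Rp (self Rp) (KAlg rp) CC
    (str_hom (KAlg rp)) (str_hom CC); last by exists j.
  - exact: residue_surj.
  - move=> c /(residue_ker rpP) mc; apply/rP.
    exact: (in_max_map PNp).
have j_inj : injective (gmap (model M) j).
  apply: (@separated_inj _ (model M)) => // a ja.
  apply: contrapT => /eqP a0.
  have : j 1 = 0 by rewrite -(mulVf a0) rmorphM ja mulr0.
  rewrite rmorph1 -(rmorph1 r) => /rP; rewrite rmorph1; exact: in_max1.
apply: j_inj; rewrite raddf0 raddfMn /= -[RHS](raddf0 (gmap (model M) rH))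
  -sum0.
rewrite raddf_sum -[in LHS](card_ord (\dim {:L})) -sumr_const.
apply: eq_bigr => i _; rewrite !gmapM; apply: gmap_ext => x.
(* Take b in [Rp] with the same residue as x. Then x - b is in the maximal ideal at P and sigma i
   fixes b, so sigma i x is congruent to b at [PN] for every i. *)
have [b bx] := residue_surj rpP (rho x).
rewrite /= -bx jE.
have : in_max P (incl _ ((x : local_ring P) - str RL b)).
  apply/rho_ker; rewrite rmorphB hom_str /= bx; exact: subrr.
move=> /(in_max_map (sP i)) mx.
apply/eqP; rewrite -subr_eq0 -opprB oppr_eq0 -(sRs i) -!rmorphB; apply/eqP/rP.
exact: mx.
Qed.

Variable n : nat.
Hypothesis Hn : ([set: points (model M) (KAlg rp)] #= `I_n)%card.
Hypothesis Hcoprime : coprime n (\dim {:L}).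

Lemma reduction_zero (q : points (model M) RL) : gmap (model M) rho q = 0.
Proof.
have mq := reduction_torsion q.
have nq := finite_zmod_order (gmap (model M) rho q) Hn.
have d0 : (0 < \dim {:L})%N by rewrite adim_gt0.
have [u v uv _] := egcdnP n d0.
have := congr1 (fun k => gmap (model M) rho q *+ k) uv.
rewrite /= gcdnC (eqP Hcoprime) [(v * n)%N]mulnC mulrnDr mulnC !mulrnA nq mq.
by rewrite !mul0rn add0r.
Qed.

End PointReduction.

(** * Passage to the completion *)

Lemma local_in_completion (F : fieldType) (P : finite_prime F) (C : completion
  P) x :
  local_ring P x -> valuation_ring C (cemb C x).
Proof.
move=> [a [s [Ps ->]]]; have s0 := notin_prime_neq0 Ps.
have es0 : cemb C (incl _ s) != 0 by rewrite fmorph_eq0.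
have s0' : s != 0 by apply: contraNneq s0 => ->; rewrite rmorph0.
rewrite fmorph_div; apply: valuation_setM;
  first exact: integers_in_valuation (inclP a).
have vs : cval (cemb C (incl _ s)) = 0.
  apply/eqP; rewrite eq_le; apply/andP; split; last exact/(cval_emb C s0' 0%N).
  rewrite leNgt; apply/negP => v0; apply: Ps;
    apply: (@ideal_pow_sub1 _ _ 1) => //.
  exact/(cval_emb C s0' 1%N).
right; suff -> : cval (cemb C (incl _ s))^-1 = 0 by [].
by rewrite -[LHS]add0r -[in LHS]vs -cvalM ?invr_eq0 // divff // cval1.
Qed.

Section Completion.
Variables (K : fieldExtType rat) (A : group_functor K).
Hypothesis HA : abelian_scheme A.
Hypothesis AK0 : forall x : points A (self K), x = 0.
Variables (p : finite_prime K) (M : good_model A p).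
Variables (kp : fieldType) (rp : {rmorphism local_ring p -> kp}).
Hypothesis rpP : is_residue_field p (rp \o to_local p).
Variables (L : fieldExtType K) (P : finite_prime L).
Hypothesis pP : @extended_ideal K L p = ideal_pow P (\dim {:L}).
Variable n : nat.
Hypothesis Hn : ([set: points (model M) (KAlg rp)] #= `I_n)%card.
Hypothesis Hcoprime : coprime n (\dim {:L}).

(** The point over the valuation ring of C is the image of the one over the local ring. Restricted
    to the local ring, the residue map [rP] kills the maximal ideal and so factors through [rho],
    where the point is already 0. *)
Lemma points_in_kernel (Pp : lies_over p P) (C : completion P) (kP : fieldType)
    (rP : {rmorphism valuation_ring C -> kP}) :
  is_residue_field P (rP \o to_valuation_ring C) ->
  forall Q : points (extend_scalars L A) (self L),
    kernel_of_reduction M Pp rP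
      (gmap (extend_scalars L A) (str_hom (KAlg (cemb C))) Q).
Proof.
move=> rPP Q; have [rho [rho_surj rho_ker]] := residue_hom rpP pP.
have [U B u f _ _ _ fuQ] := lift_point M rho_ker Q.
have := reduction_zero HA AK0 rpP rho_ker Hn Hcoprime (gmap (model M) f u).
set q := gmap (model M) f u in fuQ *; clearbody q => q0.
pose V : kalg (local_ring p) := KAlg (local_to_valuation C Pp).
pose c : {rmorphism local_ext pP -> valuation_ring C} :=
  subring_map (@local_in_completion L P C).
have cs z : c (str (local_ext pP) z) = str V z by apply: incl_inj.
pose cH : hom (local_ext pP) V := @Hom _ (local_ext pP) V c cs.
exists (gmap (model M) cH q); split.
  rewrite -fuQ.
  pose h := restr_hom (in_alg L) (str_hom (KAlg (cemb C))).
  rewrite -[RHS]/(gmap A h (generic_fibre M (restr (in_alg L) (self L))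
    (gmap (model M) (gen_hom pP) q))).
  rewrite -generic_fibre_nat; congr (generic_fibre M _ _).
  change (gmap (model M) (valuation_to_field Pp C) (gmap (model M) cH q) =
    gmap (model M) (restr_hom (incl (local_ring p)) h) (gmap (model M)
      (gen_hom pP) q)).
  by rewrite !gmapM; apply: gmap_ext.
rewrite gmapM; have [|g gE] := hom_factor_surj (f :=
  comp_hom (valuation_to_residue Pp rP) cH) rho_surj.
  move=> a /rho_ker ma /=.
  apply: (@local_kernel L P kP (rP \o c))  => //;
    first exact: tower_number_field.
  move=> x Px; have /= e := rPP.2 x; rewrite -[RHS](e.2 Px); congr (rP _).
  exact: incl_inj.
transitivity (gmap (model M) (comp_hom g rho) q).
  by apply: gmap_ext => x; rewrite /= gE.
by rewrite -gmapM q0 raddf0.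
Qed.

End Completion.

(** * Algebras given by generators and relations *)

Section Presented.
Variables (k : comPzRingType) (n : nat).
Notation expr := (pexpr k n).
Notation cst := (@Const k n).

Lemma peval_hom (A B : kalg k) (f : hom A B) (v : 'I_n -> A) (e : expr) :
  f (peval v e) = peval (f \o v) e.
Proof.
elim: e => [c|i|e1 IH1 e2 IH2|e1 IH1 e2 IH2] //=; first exact: hom_str.
  by rewrite rmorphD IH1 IH2.
by rewrite rmorphM IH1 IH2.
Qed.

Lemma eq_peval (A : kalg k) (v w : 'I_n -> A) (e : expr) :
  v =1 w -> peval v e = peval w e.
Proof. by move=> vw; elim: e => //= e1 -> e2 ->. Qed.

Fixpoint psubst (t : 'I_n -> expr) (e : expr) : expr :=
  match e with
  | Const c => cst c
  | Var i => t i
  | Add e1 e2 => Add (psubst t e1) (psubst t e2)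
  | Mul e1 e2 => Mul (psubst t e1) (psubst t e2)
  end.

Lemma peval_psubst (A : kalg k) (v : 'I_n -> A) t (e : expr) :
  peval v (psubst t e) = peval (fun i => peval v (t i)) e.
Proof. by elim: e => //= e1 -> e2 ->. Qed.

Variable rel : set expr.

(** Equality in the polynomial ring modulo [rel], generated inductively: a proof of equality is then
    a finite derivation, on which [pequiv_spread] does induction to find the denominators it
    involves. *)
Inductive pequiv : expr -> expr -> Prop :=
  | pequiv_refl e : pequiv e e
  | pequiv_sym e e' : pequiv e e' -> pequiv e' e
  | pequiv_trans e e' e'' : pequiv e e' -> pequiv e' e'' -> pequiv e e''
  | pequiv_add e1 e1' e2 e2' : pequiv e1 e1' -> pequiv e2 e2' ->
      pequiv (Add e1 e2) (Add e1' e2')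
  | pequiv_mul e1 e1' e2 e2' : pequiv e1 e1' -> pequiv e2 e2' ->
      pequiv (Mul e1 e2) (Mul e1' e2')
  | pequiv_addA e1 e2 e3 : pequiv (Add e1 (Add e2 e3)) (Add (Add e1 e2) e3)
  | pequiv_addC e1 e2 : pequiv (Add e1 e2) (Add e2 e1)
  | pequiv_add0 e : pequiv (Add (cst 0) e) e
  | pequiv_addN e : pequiv (Add (Mul (cst (-1)) e) e) (cst 0)
  | pequiv_mulA e1 e2 e3 : pequiv (Mul e1 (Mul e2 e3)) (Mul (Mul e1 e2) e3)
  | pequiv_mulC e1 e2 : pequiv (Mul e1 e2) (Mul e2 e1)
  | pequiv_mul1 e : pequiv (Mul (cst 1) e) e
  | pequiv_mulD e1 e2 e3 :
      pequiv (Mul (Add e1 e2) e3) (Add (Mul e1 e3) (Mul e2 e3))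
  | pequiv_cstD a b : pequiv (cst (a + b)) (Add (cst a) (cst b))
  | pequiv_cstM a b : pequiv (cst (a * b)) (Mul (cst a) (cst b))
  | pequiv_rel e : rel e -> pequiv e (cst 0).

Lemma pequiv_sound (A : kalg k) (v : 'I_n -> A) e e' :
  (forall e, rel e -> peval v e = 0) -> pequiv e e' -> peval v e = peval v e'.
Proof.
move=> relv; elim=> {e e'} /=; rewrite ?rmorphN ?rmorph1 ?rmorph0.
- by [].
- by [].
- by move=> e e' e'' _ -> _ ->.
- by move=> e1 e1' e2 e2' _ -> _ ->.
- by move=> e1 e1' e2 e2' _ -> _ ->.
- by move=> *; ring.
- by move=> *; ring.
- by move=> *; ring.
- by move=> *; ring.
- by move=> *; ring.
- by move=> *; ring.
- by move=> *; ring.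
- by move=> *; ring.
- by move=> a b; rewrite rmorphD.
- by move=> a b; rewrite rmorphM.
- by move=> e /relv.
Qed.

Definition presented_pre : pre_ring.
Proof.
apply: (@PreRing expr pequiv (cst 0) (cst 1) (Mul (cst (-1))) (@Add k n) (@Mul
  k n));
  try by constructor.
- exact: pequiv_trans.
- by move=> *; apply: pequiv_mul => //; constructor.
Defined.

Let C : comPzRingType := pr_quot presented_pre.
Definition presented_class (e : expr) : C := @pr_class presented_pre e.

Lemma presented_classP e e' :
  presented_class e = presented_class e' <-> pequiv e e'.
Proof. exact: (@pr_classP presented_pre). Qed.

Lemma presented_exists : exists (B : kalg k) (x : 'I_n -> B),
  [/\ forall y, exists e, y = peval x e,
      forall e e', peval x e = peval x e' <-> pequiv e e' &
      forall (D : kalg k) (v : 'I_n -> D), (forall e, rel e -> peval v e = 0) ->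
        exists g : hom B D, forall i, g (x i) = v i].
Proof.
pose h (c : k) : C := presented_class (cst c).
have hN : zmod_morphism h.
  have hD a b : h (a + b) = h a + h b.
    by rewrite /h /presented_class -pr_classD;
      apply/presented_classP/pequiv_cstD.
  by move=> a b; apply: (addIr (h b)); rewrite -hD !subrK.
have hM : monoid_morphism h.
  split=> // a b; rewrite /h /presented_class -pr_classM.
  exact/presented_classP/pequiv_cstM.
pose m1 := GRing.isZmodMorphism.Build _ _ h hN.
pose m2 := GRing.isMonoidMorphism.Build _ _ h hM.
pose f : {rmorphism k -> C} := HB.pack h m1 m2.
pose B : kalg k := KAlg f; pose x i : B := presented_class (@Var k n i).
have xE e : peval x e = presented_class e.
  elim: e => [c|i|e1 IH1 e2 IH2|e1 IH1 e2 IH2] //=.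
    by rewrite IH1 IH2 /presented_class -pr_classD.
  by rewrite IH1 IH2 /presented_class -pr_classM.
exists B, x; split.
- by move=> y; have [e ->] := pr_class_surj y; exists e; rewrite xE.
- by move=> e e'; rewrite !xE; exact: presented_classP.
- move=> D v relv.
  have [||||g gE] := @pr_lift_exists presented_pre D (peval v).
  + by move=> e e'; apply: pequiv_sound.
  + exact: rmorph1.
  + by [].
  + by [].
  have gs c : g (str B c) = str D c by exact: gE.
  by exists (@Hom k B D g gs) => i; exact: gE.
Qed.

End Presented.

Lemma presented_hom_unique (k : comPzRingType) n (B D : kalg k) (x : 'I_n -> B)
    (g h : hom B D) : (forall y, exists e, y = peval x e) ->
  (forall i, g (x i) = h (x i)) -> g =1 h.
Proof.
move=> gen gh y; have [e ->] := gen y; rewrite !peval_hom; exact: eq_peval.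
Qed.

(** * Sheaf property of systems of equations *)

Section RingSheaf.
Variable k : comPzRingType.

Lemma localization_lift (A B C : kalg k) (f : A) (phi : hom A B) (h : hom A C)
  u :
  is_localization f phi -> u * h f = 1 -> exists g : hom B C, g \o phi =1 h.
Proof.
move=> [[w wf] num ker] uf.
have uX i : u ^+ i * h f ^+ i = 1 by rewrite -exprMn uf expr1n.
have /choice[r rP] (b : B) : exists na : nat * A, b * phi f ^+ na.1 = phi na.2.
  by have [n [a e]] := num b; exists (n, a).
pose g b := h (r b).2 * u ^+ (r b).1.
have gE b n a : b * phi f ^+ n = phi a -> g b = h a * u ^+ n.
  move=> e; have e' := rP b; rewrite /g; case: (r b) e' => m a' /= e'.
  have /ker[l /(congr1 h)] : phi (a' * f ^+ n - a * f ^+ m) = 0.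
    by rewrite rmorphB !rmorphM !rmorphXn -e -e'; ring.
  rewrite rmorph0 rmorphM rmorphXn rmorphB !rmorphM !rmorphXn => e0.
  apply/eqP; rewrite -subr_eq0; apply/eqP.
  transitivity (u ^+ l * u ^+ m * u ^+ n *
    (h f ^+ l * (h a' * h f ^+ n - h a * h f ^+ m))); last by rewrite e0 mulr0.
  transitivity (u ^+ l * h f ^+ l * (h a' * u ^+ m * (u ^+ n * h f ^+ n)
    - h a * u ^+ n * (u ^+ m * h f ^+ m))); last by ring.
  by rewrite !uX; ring.
have gphi a : g (phi a) = h a by rewrite (gE _ 0%N a) expr0 mulr1.
have gN : zmod_morphism g.
  move=> b b'; have e := rP b; have e' := rP b'.
  rewrite (gE (b - b') ((r b).1 + (r b').1)%N
    ((r b).2 * f ^+ (r b').1 - (r b').2 * f ^+ (r b).1)); last first.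
    by rewrite rmorphB !rmorphM !rmorphXn -e -e' exprD; ring.
  rewrite rmorphB !rmorphM !rmorphXn exprD /g.
  transitivity (h (r b).2 * u ^+ (r b).1 * (u ^+ (r b').1 * h f ^+ (r b').1)
    - h (r b').2 * u ^+ (r b').1 * (u ^+ (r b).1 * h f ^+ (r b).1));
      first by ring.
  by rewrite !uX !mulr1.
have gM : monoid_morphism g.
  split=> [|b b']; first by rewrite -(rmorph1 phi) gphi rmorph1.
  rewrite (gE (b * b') ((r b).1 + (r b').1)%N ((r b).2 * (r b').2)).
    by rewrite rmorphM exprD /g; ring.
  by rewrite rmorphM -!rP exprD; ring.
pose m1 := GRing.isZmodMorphism.Build _ _ g gN.
pose m2 := GRing.isMonoidMorphism.Build _ _ g gM.
pose g' : {rmorphism B -> C} := HB.pack g m1 m2.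
have gs c : g' (str B c) = str C c by rewrite -(hom_str phi) [LHS]gphi hom_str.
by exists (Hom gs).
Qed.

Variables (A : kalg k) (n : nat) (f : 'I_n -> A).
Hypothesis f1 : span (range f) 1.
Variables (B : 'I_n -> kalg k) (phi : forall i, hom A (B i)).
Hypothesis locP : forall i, is_localization (f i) (phi i).

Lemma locally_zero a : (forall i, phi i a = 0) -> a = 0.
Proof.
move=> a0; have idI : ideal (fun b => b * a = 0).
  split=> [|x y|b x]; first by rewrite mul0r.
    by rewrite mulrDl => -> ->; rewrite addr0.
  by rewrite -mulrA => ->; rewrite mulr0.
rewrite -[a]mul1r; apply: (span_radical idI f1) => _ [i _ <-].
by have [_ _ ker] := locP i; exact: ker.
Qed.

Lemma glue (x : forall i, B i) :
  (forall i j C (g : hom (B i) C) (h : hom (B j) C),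
     g \o phi i =1 h \o phi j -> g (x i) = h (x j)) ->
  exists y, forall i, phi i y = x i.
Proof.
move=> xx.
have /choice[N0 /choice[a0 aE0]] : forall i, exists N, exists a,
    x i * phi i (f i) ^+ N = phi i a.
  by move=> i; have [_ num _] := locP i; exact: num.
pose N := (\max_i N0 i)%N.
have /choice[a aE] i : exists a, x i * phi i (f i) ^+ N = phi i a.
  exists (a0 i * f i ^+ (N - N0 i)).
  by rewrite rmorphM rmorphXn -aE0 -mulrA -exprD subnKC // leq_bigmax.
have ov i j : exists l,
  (f i * f j) ^+ l * (a i * f j ^+ N - a j * f i ^+ N) = 0.
  have [C [psi [[u uf] _ ker _]]] := loc_alg (f i * f j).
  have [|g gE] := @localization_lift A (B i) C (f i) (phi i) psi (u * psi (f
    j)) (locP i).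
    by rewrite -mulrA [psi _ * _]mulrC -rmorphM.
  have [|h hE] := @localization_lift A (B j) C (f j) (phi j) psi (u * psi (f
    i)) (locP j).
    by rewrite -mulrA -rmorphM.
  have e : g (x i) = h (x j) by apply: xx => z; rewrite [LHS]gE [RHS]hE.
  apply: ker; rewrite rmorphB !rmorphM !rmorphXn.
  have -> : psi (a i) = g (x i) * psi (f i) ^+ N.
    by rewrite -!gE /= -aE rmorphM rmorphXn.
  have -> : psi (a j) = h (x j) * psi (f j) ^+ N.
    by rewrite -!hE /= -aE rmorphM rmorphXn.
  by rewrite e; ring.
have /choice[l0 lE] (ij : 'I_n * 'I_n) : exists l,
    (f ij.1 * f ij.2) ^+ l * (a ij.1 * f ij.2 ^+ N - a ij.2 * f ij.1 ^+ N) = 0.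
  exact: ov.
pose l := (\max_ij l0 ij)%N.
(* The factor f i ^ l absorbs the annihilating powers found on overlaps: x i is b i / f i ^ (N + l),
   and the cross relations [bb] hold in A itself. *)
pose b i := f i ^+ l * a i.
have bE i : x i * phi i (f i) ^+ (N + l) = phi i (b i).
  by rewrite exprD mulrA aE rmorphM rmorphXn mulrC.
have bb i j : b i * f j ^+ (N + l) = b j * f i ^+ (N + l).
  apply/eqP; rewrite -subr_eq0; apply/eqP.
  transitivity ((f i * f j) ^+ (l - l0 (i, j)) * ((f i * f j) ^+ l0 (i, j) *
      (a i * f j ^+ N - a j * f i ^+ N))); last by rewrite (lE (i, j)) mulr0.
  rewrite mulrA -exprD subnK; last exact: (leq_bigmax (i, j)).
  by rewrite /b exprMn !exprD; ring.
have [m [c [d [Sd dE]]]] : span (range (fun i => f i ^+ (N + l))) 1.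
  apply: (span_radical (span_ideal _) f1) => _ [i _ <-].
  by exists (N + l)%N; apply: span_in; exists i.
have /choice[t tE] (i : 'I_m) : exists j, f j ^+ (N + l) = d i.
  by have [j] := Sd i; exists j.
(* The coefficients come from 1 as the sum of the c i * f (t i) ^ (N + l). By [bb], multiplying this
   element by f j ^ (N + l) gives b j. *)
exists (\sum_i c i * b (t i)) => j.
have [[w wf] _ _] := locP j.
have wX i : w ^+ i * phi j (f j) ^+ i = 1 by rewrite -exprMn wf expr1n.
rewrite -[LHS]mul1r -[RHS]mul1r -(wX (N + l)%N) -!mulrA; congr (_ * _).
rewrite [RHS]mulrC bE -rmorphXn -rmorphM; congr (phi j _).
rewrite -[RHS]mulr1 dE !mulr_sumr; apply: eq_bigr => i _.
by rewrite -tE mulrCA [f j ^+ _ * _]mulrC bb; ring.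
Qed.

End RingSheaf.

Section Solutions.
Variables (k : comPzRingType) (n m : nat) (f : 'I_m -> pexpr k n).

Definition solution (B : kalg k) : Type :=
  {v : 'I_n -> B | forall j, peval v (f j) = 0}.

Lemma solution_eq (B : kalg k) (x y : solution B) :
  (forall i, sval x i = sval y i) -> x = y.
Proof. by case: x y => [v p] [w q] /= vw; apply: eq_exist; apply/funext. Qed.

Lemma solution_map_subproof (A B : kalg k) (g : hom A B) (x : solution A) j :
  peval (g \o sval x) (f j) = 0.
Proof. by rewrite -peval_hom (svalP x) rmorph0. Qed.

Definition solution_map (A B : kalg k) (g : hom A B) (x : solution A) :
  solution B :=
  exist _ (g \o sval x) (solution_map_subproof g x).

Lemma solution_map_id (A : kalg k) (g : hom A A) x : g =1 id ->
  solution_map g x = x.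
Proof. by move=> gE; apply: solution_eq => i; apply: gE. Qed.

Lemma solution_map_comp (A B C : kalg k) (g : hom A B) (h : hom B C) (l : hom
  A C) x :
  l =1 h \o g -> solution_map l x = solution_map h (solution_map g x).
Proof. by move=> lE; apply: solution_eq => i; apply: lE. Qed.

Definition solutions : functor k := Functor solution_map_id solution_map_comp.

Lemma solutions_sheaf : zariski_sheaf solutions.
Proof.
move=> A r g g1 B phi locP x xx.
have /choice[v vE] (c : 'I_n) : exists y, forall i, phi i y = sval (x i) c.
  apply: (glue g1 locP (x := fun i => sval (x i) c)) => i j C p q pq.
  by have := congr1 (fun z : solution C => sval z c) (xx i j C p q pq).
have vP j : peval v (f j) = 0.
  apply: (locally_zero g1 locP) => i; rewrite peval_hom.
  by rewrite (eq_peval _ (w := sval (x i))) ?(svalP (x i)) // => c; apply: vE.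
exists (exist _ v vP); split; first by move=> i; apply: solution_eq => c;
  apply: vE.
move=> y yx; apply: solution_eq => c; apply/eqP; rewrite -subr_eq0; apply/eqP.
apply: (locally_zero g1 locP) => i; rewrite rmorphB vE -(yx i).
exact: subrr.
Qed.

Lemma solutions_affine : exists (B : kalg k) (u : solutions B),
  represents (fun _ _ => True) u /\ finitely_presented B.
Proof.
have [B [x [gen xP lift]]] := presented_exists (range f).
have xf j : peval x (f j) = 0.
  by rewrite -[RHS](rmorph0 (str B)) -[RHS]/(peval x (@Const k n 0));
    apply/xP/pequiv_rel; exists j.
exists B, (exist _ x xf); split.
  split=> // C y _.
  have [|g gE] := lift C (sval y); first by move=> _ [j _ <-]; apply: (svalP y).
  exists g; split; first by apply: solution_eq => i; apply: gE.
  move=> h hE; apply: (presented_hom_unique gen) => i.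
  by rewrite gE -hE.
exists n, m, f, x; split=> // C c cf.
have [|g gE] := lift C c; first by move=> _ [j _ <-].
by exists g; split=> // h hE; apply: (presented_hom_unique gen) => i;
  rewrite gE hE.
Qed.

Lemma solutions_cover (P : kalg k -> Prop) :
  (forall B : kalg k, finitely_presented B -> P B) ->
    covered_by_affines solutions P.
Proof.
move=> fpP E e x; exists (fun _ _ => True); split=> //.
  move=> A y; exists (fun a => a = 1) => B g; split=> // _.
  by apply: span_in; exists 1; rewrite ?rmorph1.
by have [B [u [uB fpB]]] := solutions_affine; exists B, u; split=> //;
  apply: fpP.
Qed.

Lemma solutions_scheme : is_scheme solutions.
Proof. by split; [exact: solutions_sheaf|exact: solutions_cover]. Qed.

End Solutions.

Section SmoothData.
Variables (k : comPzRingType) (X : functor k) (U : subfunctor X).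
Variables (B : kalg k) (u : X B).
Hypotheses (oU : is_open U) (Uu : represents U u) (Xsmooth : formally_smooth X).
Variables (n m : nat) (f : 'I_m -> pexpr k n) (b : 'I_n -> B).
Hypothesis bf : forall j, peval b (f j) = 0.
Hypothesis blift : forall (C : kalg k) (c : 'I_n ->
  C), (forall j, peval c (f j) = 0) ->
  exists g : hom B C, (forall i, g (b i) = c i) /\
    forall h : hom B C, (forall i, h (b i) = c i) -> h =1 g.

Definition pairs : set (pexpr k n) := fun e => exists i j, e = Mul (f i) (f j).

(* A section of k[X]/(f_i f_j) -> B = k[X]/(f_i), given by formal smoothness
   and written with expressions. *)
Lemma smooth_section : exists e : 'I_n -> pexpr k n,
  (forall i, pequiv (range f) (e i) (@Var k n i)) /\
  (forall j, pequiv pairs (psubst e (f j)) (@Const k n 0)).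
Proof.
have [C [x [gen xP lift]]] := presented_exists pairs.
(* C1 has the same universal property as B, but its equalities are derivations; it serves to turn
   equalities in B into [pequiv]. *)
have [C1 [x1 [gen1 x1P lift1]]] := presented_exists (range f).
have x1f j : peval x1 (f j) = 0.
  by rewrite -[RHS](rmorph0 (str C1)) -[RHS]/(peval x1 (@Const k n 0));
    apply/x1P/pequiv_rel; exists j.
have [g1 [g1b _]] := blift x1f.
have [|h1 h1x] := lift1 B b; first by move=> _ [j _ <-].
have h1g1 : h1 \o g1 =1 id.
  have [g0 [_ g0u]] := blift bf => z.
  transitivity (g0 z); first by apply: (g0u (comp_hom h1 g1)) => i;
    rewrite /= g1b h1x.
  by apply/esym/(g0u (id_hom B)).
have [|g gx] := lift B b.
  by move=> _ [i [j ->]] /=; rewrite !bf mulr0.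
have gsurj y : exists z, g z = y.
  have [e eE] := gen1 (g1 y); exists (peval x e).
  rewrite peval_hom (eq_peval _ gx) -[RHS]h1g1 /= eE peval_hom.
  by apply: eq_peval => i; rewrite /= h1x.
pose J := span (range (fun j => peval x (f j))).
have gJ z : g z = 0 -> J z.
  have [D [r rP]] := quotient_ring (span_ideal (range (fun j =>
    peval x (f j)))).
  pose DD : kalg k := KAlg (r \o str C).
  pose rH : hom C DD := @Hom k C DD r (fun=> erefl).
  have [|h hb] := blift (C := DD) (c := r \o x).
    move=> j; rewrite -(peval_hom rH); apply/rP; apply: span_in; by exists j.
  have hg : h \o g =1 r.
    apply: (presented_hom_unique (g := comp_hom h g) (h := rH) gen) => i.
    by rewrite /= gx hb.1.
  by move=> gz; apply/rP; rewrite -hg /= gz rmorph0.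
have JJ y z : J y -> J z -> y * z = 0.
  move=> Jy Jz; have idl : ideal (fun w => y * w = 0).
    split=> [|w w' e e'|w w' e]; rewrite ?mulr0 //.
      by rewrite mulrDr e e' addr0.
    by rewrite mulrCA e mulr0.
  apply: (span_min idl _ Jz) => _ [j _ <-].
  have idr : ideal (fun w => w * peval x (f j) = 0).
    split=> [|w w' e e'|w w' e]; rewrite ?mul0r //.
      by rewrite mulrDl e e' addr0.
    by rewrite -mulrA e mulr0.
  apply: (span_min idr _ Jy) => _ [i _ <-].
  rewrite -[RHS](rmorph0 (str C)) -[RHS]/(peval x (@Const k n 0)).
  rewrite -[LHS]/(peval x (Mul (f i) (f j))); apply/xP/pequiv_rel.
  by exists i, j.
have [y yu] := Xsmooth gsurj (fun y z gy gz => JJ y z (gJ y gy) (gJ z gz)) u.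
(* Opens do not see square-zero ideals: some z in the ideal of U is 1 modulo J, so (z - 1) ^ 2 = 0
   and z is a unit. *)
have Uy : U y.
  have [I UI] := oU y; apply/(opens_at_self UI).
  have [N [c [d [Id]]]] : span (g @` I)%classic 1 by apply/UI; rewrite yu;
    case: Uu.
  have /choice[c' c'E] i : exists z, g z = c i by exact: gsurj.
  have /choice[d' d'E] i : exists z, I z /\ g z = d i by have [z] := Id i;
    exists z.
  move=> e; pose z := \sum_i c' i * d' i.
  have Iz : span I z.
    by apply: ideal_sum; [exact: span_ideal|move=> i; apply: span_in;
      have [] := d'E i].
  have z1 : g (z - 1) = 0.
    rewrite rmorphB rmorph1 rmorph_sum e; apply/eqP; rewrite subr_eq0;
      apply/eqP.
    by apply: eq_bigr => i _; rewrite rmorphM c'E (d'E i).2.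
  have zz := JJ _ _ (gJ _ z1) (gJ _ z1).
  have -> : 1 = (2%:R - z) * z + (z - 1) * (z - 1) by ring.
  rewrite zz addr0; apply: idealM => //; exact: span_ideal.
have [h [hu _]] := affine_lift Uu Uy.
have gh : g \o h =1 id.
  have [g' [_ g'u]] := affine_lift Uu (Uu.1) => z.
  transitivity (g' z); first by apply: (g'u (comp_hom g h)); rewrite -fmapM hu.
  by apply/esym/(g'u (id_hom B)); rewrite fmap1.
have /choice[e eE] i : exists e, h (b i) = peval x e by exact: gen.
exists e; split=> [i|j].
  apply/x1P; rewrite /= -g1b -[b i]gh /= eE !peval_hom.
  by apply: eq_peval => i'; rewrite /= gx g1b.
apply/xP; rewrite peval_psubst /= rmorph0 -[RHS](rmorph0 h) -(bf j) peval_hom.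
by apply: eq_peval => i; rewrite -eE.
Qed.

End SmoothData.

(** * Spreading out *)

(* R is contained in the localization of O at S, both embedded in T. *)
Section Spread.
Variables (O R T : comPzRingType) (tO : {rmorphism O ->
  T}) (tR : {rmorphism R -> T}).
Variable S : set O.
Hypothesis tO_inj : injective tO.
Hypotheses (S1 : S 1) (SM : forall s t, S s -> S t -> S (s * t)).
Hypothesis frac : forall r, exists s a, S s /\ tR r * tO s = tO a.

(** P holds for all sufficiently divisible s. Quantifying over every multiple lets finitely many
    such conditions be met at once, by multiplying their s0. *)
Definition large (P : O -> Prop) := exists s0, S s0 /\ forall t, P (t * s0).

Lemma large_all n (P : 'I_n -> O -> Prop) : (forall i, large (P i)) ->
  large (fun s => forall i, P i s).
Proof.
elim: n P => [|n IHn] P lP; first by exists 1; split=> // t [].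
have [s [Ss sP]] := IHn (fun i => P (lift ord0 i)) (fun i => lP _).
have [s' [Ss' sP']] := lP ord0; exists (s * s'); split=> [|t i];
  first exact: SM.
have [j ->|->] := unliftP ord0 i; last by rewrite mulrA; apply: sP'.
by rewrite [s * s']mulrC mulrA; apply: sP.
Qed.

Lemma large_and P Q : large P -> large Q -> large (fun s => P s /\ Q s).
Proof.
move=> [s [Ss sP]] [s' [Ss' sP']]; exists (s * s'); split=> [|t];
  first exact: SM.
by split; [rewrite [s * s']mulrC mulrA; apply: sP|rewrite mulrA; apply: sP'].
Qed.

Lemma large_imp (P Q : O -> Prop) : (forall s, P s -> Q s) -> large P ->
  large Q.
Proof. by move=> PQ [s [Ss sP]]; exists s; split=> // t; apply: PQ. Qed.

Lemma large_true (P : O -> Prop) : (forall s, P s) -> large P.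
Proof. by move=> Pall; exists 1. Qed.

Definition has_num (s : O) (r : R) := exists a, tR r * tO s = tO a.

(* the numerator of r with denominator s; junk value 0 if there is none *)
Definition num (s : O) (r : R) : O :=
  if pselect (has_num s r) is left e then projT1 (cid e) else 0.

Lemma numP s r : has_num s r -> tR r * tO s = tO (num s r).
Proof. by move=> e; rewrite /num; case: pselect => // e'; case: cid. Qed.

Lemma numE s r a : tR r * tO s = tO a -> num s r = a.
Proof. by move=> e; apply: tO_inj; rewrite -numP //; exists a. Qed.

Lemma has_num_large r : large (has_num^~ r).
Proof.
have [s [a [Ss e]]] := frac r; exists s; split=> // t; exists (t * a).
by rewrite !rmorphM -e; ring.
Qed.

(* d stands for 1 / s *)
Fixpoint speval n (D : kalg O) (s : O) (v : 'I_n ->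
  D) (d : D) (e : pexpr R n) : D :=
  match e with
  | Const r => str D (num s r) * d
  | Var i => v i
  | Add e1 e2 => speval s v d e1 + speval s v d e2
  | Mul e1 e2 => speval s v d e1 * speval s v d e2
  end.

Lemma speval_psubst n (D : kalg O) s (v : 'I_n -> D) d t (e : pexpr R n) :
  speval s v d (psubst t e) = speval s (fun i => speval s v d (t i)) d e.
Proof. by elim: e => //= e1 -> e2 ->. Qed.

Lemma speval_hom n (D D' : kalg O) (g : hom D D') s (v : 'I_n ->
  D) d (e : pexpr R n) :
  g (speval s v d e) = speval s (g \o v) (g d) e.
Proof.
elim: e => [c|i|e1 IH1 e2 IH2|e1 IH1 e2 IH2] //=;
  first by rewrite rmorphM hom_str.
  by rewrite rmorphD IH1 IH2.
by rewrite rmorphM IH1 IH2.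
Qed.

Lemma eq_speval n (D : kalg O) s (v w : 'I_n -> D) d (e : pexpr R n) :
  v =1 w -> speval s v d e = speval s w d e.
Proof. by move=> vw; elim: e => //= e1 -> e2 ->. Qed.

(* A derivation involves finitely many constants of R,
  hence holds over O[1/s]. *)
Lemma pequiv_spread n (rel : set (pexpr R n)) e e' : pequiv rel e e' ->
  large (fun s => forall (D : kalg O) (v : 'I_n -> D) d, d * str D s = 1 ->
    (forall r, rel r -> speval s v d r = 0) ->
      speval s v d e = speval s v d e').
Proof.
have num0 s : num s 0 = 0 by apply: numE; rewrite !rmorph0 mul0r.
have num1 s : num s 1 = s by apply: numE; rewrite rmorph1 mul1r.
have numN1 s : num s (-1) = - s by apply: numE; rewrite !rmorphN rmorph1 mulN1r.
elim=> {e e'}.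
- by move=> e; apply: large_true.
- by move=> e e' _; apply: large_imp => s IH D v d ds rv; rewrite (IH D v d).
- move=> e1 e2 e3 _ IH1 _ IH2; apply: large_imp (large_and IH1 IH2) =>
  s [H1 H2] D v d ds rv.
  by rewrite H1 // H2.
- move=> e1 e2 e3 e4 _ IH1 _ IH2; apply: large_imp (large_and IH1 IH2) =>
  s [H1 H2] D v d ds rv.
  by rewrite /= H1 // H2.
- move=> e1 e2 e3 e4 _ IH1 _ IH2; apply: large_imp (large_and IH1 IH2) =>
  s [H1 H2] D v d ds rv.
  by rewrite /= H1 // H2.
- by move=> *; apply: large_true => s D v d ds rv /=; ring.
- by move=> *; apply: large_true => s D v d ds rv /=; ring.
- by move=> *; apply: large_true => s D v d ds rv /=; rewrite num0 rmorph0;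
  ring.
- move=> e; apply: large_true => s D v d ds rv /=.
  by rewrite num0 numN1 rmorph0 rmorphN mulNr [str D s * d]mulrC ds; ring.
- by move=> *; apply: large_true => s D v d ds rv /=; ring.
- by move=> *; apply: large_true => s D v d ds rv /=; ring.
- move=> e; apply: large_true => s D v d ds rv /=.
  by rewrite num1 [str D s * d]mulrC ds mul1r.
- by move=> *; apply: large_true => s D v d ds rv /=; ring.
- move=> a b; apply: large_imp (large_and (has_num_large a) (has_num_large b)).
  move=> s [na nb] D v d ds rv /=.
  rewrite (numE (a := num s a + num s b)) ?rmorphD ?mulrDl //.
  by rewrite -!numP.
- move=> a b; apply: large_imp (large_and (has_num_large (a * b))
    (large_and (has_num_large a) (has_num_large b))).
  move=> s [nab [na nb]] D v d ds rv /=.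
  have e : num s (a * b) * s = num s a * num s b.
    by apply: tO_inj; rewrite !rmorphM -!numP // rmorphM; ring.
  transitivity (str D (num s (a * b) * s) * d * d).
    by rewrite rmorphM -[LHS]mulr1 -ds; ring.
  by rewrite e rmorphM; ring.
- move=> e re; apply: large_true => s D v d ds rv /=.
  by rewrite rv // num0 rmorph0 mul0r.
Qed.

(** Ensures that [num] takes no junk value on the constants of e. *)
Fixpoint has_den n (s : O) (e : pexpr R n) : Prop :=
  match e with
  | Const r => has_num s r
  | Var _ => True
  | Add e1 e2 => has_den s e1 /\ has_den s e2
  | Mul e1 e2 => has_den s e1 /\ has_den s e2
  end.

Lemma has_den_large n (e : pexpr R n) : large (fun s => has_den s e).
Proof.
elim: e => [c|i|e1 IH1 e2 IH2|e1 IH1 e2 IH2] /=.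
- exact: has_num_large.
- exact: large_true.
- exact: large_and.
- exact: large_and.
Qed.

Lemma speval_peval n (D : comPzRingType) (aO : {rmorphism O -> D})
    (aR : {rmorphism R -> D}) (s : O) (d : D) (v : 'I_n -> D) (e : pexpr R n) :
  (forall r a, tR r * tO s = tO a -> aR r * aO s = aO a) ->
  d * aO s = 1 -> has_den s e ->
  speval (D := KAlg aO) s v d e = peval (B := KAlg aR) v e.
Proof.
move=> compat ds; elim: e => [c|i|e1 IH1 e2 IH2|e1 IH1 e2 IH2] //=.
- by move=> /numP/compat <-; rewrite -mulrA [aO s * d]mulrC ds mulr1.
- by move=> [/IH1 -> /IH2 ->].
- by move=> [/IH1 -> /IH2 ->].
Qed.

(* the variable ord0 stands for 1 / s *)
Fixpoint clear_den n (s : O) (e : pexpr R n) : pexpr O n.+1 :=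
  match e with
  | Const r => Mul (@Const O n.+1 (num s r)) (@Var O n.+1 ord0)
  | Var i => @Var O n.+1 (lift ord0 i)
  | Add e1 e2 => Add (clear_den s e1) (clear_den s e2)
  | Mul e1 e2 => Mul (clear_den s e1) (clear_den s e2)
  end.

Lemma peval_clear_den n (D : kalg O) s (w : 'I_n.+1 -> D) (e : pexpr R n) :
  peval w (clear_den s e) = speval s (fun i => w (lift ord0 i)) (w ord0) e.
Proof. by elim: e => //= e1 -> e2 ->. Qed.

Variables (n m : nat) (f : 'I_m -> pexpr R n).

(** Equations over O of the scheme f = 0 over O[1/s]: the first one makes the extra variable an
    inverse of s. *)
Definition spread_eqs (s : O) (j : 'I_m.+1) : pexpr O n.+1 :=
  if unlift ord0 j is Some i then clear_den s (f i)
  else Add (Mul (@Var O n.+1 ord0) (@Const O n.+1 s)) (@Const O n.+1 (-1)).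

Lemma spread_eqsP (D : kalg O) s (w : 'I_n.+1 -> D) :
  (forall j, peval w (spread_eqs s j) = 0) <->
  w ord0 * str D s = 1 /\
  forall j, speval s (fun i => w (lift ord0 i)) (w ord0) (f j) = 0.
Proof.
rewrite /spread_eqs; split=> [w0|[ws wf] j].
  split.
    have := w0 ord0; rewrite unlift_none /= rmorphN rmorph1 => /eqP.
    by rewrite subr_eq0 => /eqP.
  by move=> j; have := w0 (lift ord0 j); rewrite liftK peval_clear_den.
case: unliftP => [i _|_]; first by rewrite peval_clear_den.
by rewrite /= ws rmorphN rmorph1 subrr.
Qed.

Definition spread_point (D : kalg O) (v : 'I_n -> D) (d : D) : 'I_n.+1 -> D :=
  fun i => if unlift ord0 i is Some j then v j else d.

Lemma spread_pointP (D : kalg O) s (v : 'I_n -> D) (d : D) :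
  d * str D s = 1 -> (forall j, speval s v d (f j) = 0) ->
  forall j, peval (spread_point v d) (spread_eqs s j) = 0.
Proof.
move=> ds vf; apply/spread_eqsP; rewrite /spread_point unlift_none;
  split=> // j.
by rewrite -[RHS](vf j); apply: eq_speval => i; rewrite liftK.
Qed.

(* To lift a solution modulo a square-zero ideal, lift it arbitrarily and then
   apply e, which sends solutions of all f_i f_j = 0 to solutions of all f_j =
     0. *)
Lemma spread_smooth (e : 'I_n -> pexpr R n) :
  (forall i, pequiv (range f) (e i) (@Var R n i)) ->
  (forall j, pequiv (pairs f) (psubst e (f j)) (@Const R n 0)) ->
  large (fun s => formally_smooth (solutions (spread_eqs s))).
Proof.
move=> e1 e2; have num0 s : num s 0 = 0 by apply: numE; rewrite !rmorph0 mul0r.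
apply: large_imp (large_and (large_all (fun i => pequiv_spread (e1 i)))
  (large_all (fun j => pequiv_spread (e2 j)))) =>
    s [E1 E2] C C0 g gsurj gsq [w0 w0f].
have [d0s w0f'] := (spread_eqsP s w0).1 w0f.
have /choice[c cE] i : exists y, g y = w0 (lift ord0 i) by exact: gsurj.
have [d' d'E] := gsurj (w0 ord0).
pose r := d' * str C s - 1.
have gr : g r = 0 by rewrite rmorphB rmorphM rmorph1 hom_str d'E d0s subrr.
(* One Newton step: d' inverts s up to the error r, whose square is 0, so d inverts s exactly. *)
pose d := d' * (1 - r).
have ds : d * str C s = 1.
  have -> : d * str C s = 1 - r * r by rewrite /d /r; ring.
  by rewrite (gsq r r) ?subr0.
have gd : g d = w0 ord0 by rewrite rmorphM rmorphB rmorph1 gr subr0 mulr1 d'E.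
have gf j : g (speval s c d (f j)) = 0.
  by rewrite speval_hom gd -[RHS](w0f' j); apply: eq_speval.
pose v i := speval s c d (e i).
have vf j : speval s v d (f j) = 0.
  rewrite -speval_psubst (E2 j C c d ds) /= ?num0 ?rmorph0 ?mul0r //.
  by move=> _ [i [i' ->]] /=; apply: gsq.
exists (exist _ (spread_point v d) (spread_pointP ds vf)).
apply: solution_eq => i /=; rewrite /spread_point.
case: unliftP => [j ->|->] //; rewrite /v speval_hom.
rewrite (E1 j C0 (g \o c) (g d)) /= ?cE // ?gd //.
by move=> _ [l _ <-]; rewrite -[RHS](w0f' l); apply: eq_speval.
Qed.

End Spread.

(** * Integral points *)

Section Neron.
Variables (K : fieldExtType rat) (A : group_functor K).
Hypothesis HA : abelian_scheme A.
Hypothesis AK0 : forall x : points A (self K), x = 0.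
Variables (p : finite_prime K) (M : good_model A p).
Variables (kp : fieldType) (rp : {rmorphism local_ring p -> kp}).
Hypothesis rpP : is_residue_field p (rp \o to_local p).
Variables (L : fieldExtType K) (P : finite_prime L).
Hypothesis pP : @extended_ideal K L p = ideal_pow P (\dim {:L}).
Variable n : nat.
Hypothesis Hn : ([set: points (model M) (KAlg rp)] #= `I_n)%card.
Hypothesis Hcoprime : coprime n (\dim {:L}).
Notation Rp := (local_ring p).
Notation RL := (local_ext pP).

Lemma to_local_inj : injective (to_local P).
Proof. by move=> x y /(congr1 (incl (local_ring P))) e; apply: incl_inj. Qed.

Lemma local_ext_frac (r : Rp) : exists s a : 'O_L,
  ~ P s /\ (str RL r : local_ring P) * to_local P s = to_local P a.
Proof.
have [a [s [Oa Os Ps e]]] := (localP _ _).1 (inclP (str RL r : local_ring P)).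
have [a' a'E] := integersE Oa; have [s' s'E] := integersE Os.
exists s', a'; split; first by move=> /in_primeP; rewrite s'E.
apply: incl_inj; rewrite rmorphM e -[incl _ (to_local P s')]/(incl _ s') s'E.
by rewrite divfK ?(notin_prime_unit Ps) // -a'E.
Qed.

(** [RL] is local: if the zero section meets U at the closed point, some function in the ideal
    defining its preimage is nonzero there, hence a unit. *)
Lemma zero_in_open (U : subfunctor (model M)) (rho : hom RL (KAlg rp)) :
  is_open U -> (forall x, rho x = 0 <-> in_max P (incl _ (x : local_ring P))) ->
  U (KAlg rp) 0 -> U RL 0.
Proof.
move=> oU rho_ker U0; have [I UI] := oU RL (0 : points (model M) RL).
apply/(opens_at_self UI).
have I1 : span (rho @` I)%classic 1.
  apply/UI; have -> : fmap rho (0 : model M RL) = (0 : points (model M) (KAlg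
    rp)) by exact: raddf0.
  exact: U0.
have [a Ia ra] : exists2 a, I a & rho a <> 0.
  apply: contrapT => none; have /eqP := oner_neq0 kp; apply.
  have id0 : @ideal kp (fun c => c = 0).
    by split=> // [x y -> ->|x y ->]; rewrite ?addr0 ?mulr0.
  apply: (span_min id0 _ I1) => _ [a Ia <-].
  by apply: contrapT => ra; apply: none; exists a.
have ma : ~ in_max P (incl _ (a : local_ring P)) by move=> /rho_ker.
have [b bE] := local_elt (local_inv (inclP _) ma).
have -> : 1 = (b : RL) * a.
  apply: incl_inj; rewrite rmorphM rmorph1 bE mulVf //.
  by apply/eqP => a0; apply: ma; rewrite a0; apply: in_max0.
by apply: idealM; [exact: span_ideal|exact: span_in].
Qed.

(* Q and 0 lie in a common affine open of the model,
  which is the localization of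
   a smooth affine scheme Y over the ring of integers.  By the mapping
     property Y
   maps to the Neron model, so that the two points, equal modulo P on Y,
     are also
   equal modulo P on the Neron model. *)
Lemma no_integral_points (N : neron_model (extend_scalars L A)) (S : set
  (place L)) :
  ~ S (FinitePlace P) -> punctured_integral_points N S = set0.
Proof.
move=> SP; apply/seteqP; split=> // Q [_ /(_ P SP)[Q' [O' [Q'Q O'0 neq]]]] /=.
have [rho [rho_surj rho_ker]] := residue_hom rpP pP.
have red0 := reduction_zero HA AK0 rpP rho_ker Hn Hcoprime.
have [U B u f0 oU Uu fpB f0Q] := lift_point M rho_ker Q.
have [n' [m [f [b [bf blift]]]]] := fpB.
pose rO : {rmorphism 'O_L -> kp} := rho \o to_local P.
have rOP : is_residue_field P rO.
  split=> [y|x]; last by rewrite /rO /= rho_ker;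
    split=> [/(in_max_int (inclP x))/in_primeP|Px] //;
    apply/in_max_prime/in_primeP.
  have [c <-] := rpP.1 y; have [c' c'E] := in_alg_integers L c.
  exists c'; rewrite -[RHS](hom_str rho (to_local p c)) /=; congr (rho _).
  exact: incl_inj.
(* Integrality is stated for every residue field at P; it is contradicted for [kp], where the
   reductions of Q and 0 will agree. *)
apply: (neq kp rO rOP).
have U0k : U (KAlg rp) 0.
  rewrite -(red0 (gmap (model M) f0 u)).
  by apply: (open_fmap rho oU); apply: (open_fmap f0 oU); case: Uu.
have [g0 [g0u _]] := affine_lift Uu (zero_in_open oU rho_ker U0k).
(* As maps from B to [RL], Q and 0 agree modulo P: both reduce to the point 0 of U, which is
   classified by a unique map. *)
have f0g0 : rho \o f0 =1 rho \o g0.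
  have [g [_ gu]] := affine_lift Uu U0k => x.
  transitivity (g x).
    apply: (gu (comp_hom rho f0)); rewrite -fmapM; exact: red0.
  apply/esym/(gu (comp_hom rho g0)); rewrite -fmapM g0u; exact: raddf0.
have [_ [_ Xsmooth] _ _] := model_abelian M.
have [e [e1 e2]] := smooth_section oU Uu Xsmooth bf blift.
pose tO : {rmorphism 'O_L -> local_ring P} := to_local P.
pose tR : {rmorphism Rp -> local_ring P} := str RL.
pose Sig (s : 'O_L) := ~ P s.
have Sig1 : Sig 1 by exact: prime_proper (prime_setP P).
have SigM s t : Sig s -> Sig t -> Sig (s * t) by exact: notin_primeM.
(* A denominator outside P that serves both the equations f and the identities witnessing
   smoothness. *)
have [s0 [Ps0 /(_ 1)]] := large_and SigM
  (spread_smooth to_local_inj Sig1 SigM local_ext_frac e1 e2)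
  (large_all Sig1 SigM (fun j => has_den_large Sig1 SigM local_ext_frac (f j))).
rewrite mul1r => -[Ysmooth fden].
pose Y := solutions (spread_eqs tO tR f s0).
pose DR (D : kalg L) : kalg Rp := restr (incl Rp) (restr (in_alg L) D).
pose YL := base_change (incl 'O_L) Y.
(* Over an L-algebra a solution of the spread equations is a solution of f, that is a map from B;
   composing with u gives the morphism from the generic fibre of Y to A. *)
have fY (D : kalg L) (y : YL D) j :
    peval (B := DR D) (fun i => sval y (lift ord0 i)) (f j) = 0.
  have [ds yf] := (spread_eqsP tO tR f s0 (sval y)).1 (svalP y).
  rewrite -[RHS](yf j); apply/esym.
  apply: (@speval_peval _ _ _ tO tR _ D (str D \o incl 'O_L)
    ((str D \o in_alg L) \o incl Rp)) => // r c rc.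
  have : incl (local_ring P) (tR r * tO s0) = incl _ (tO c) by rewrite rc.
  by rewrite rmorphM => /(congr1 (str D)); rewrite rmorphM.
have hY D (y : YL D) := cid (blift (DR D) (fun i =>
  sval y (lift ord0 i)) (fY D y)).
pose uD (D : kalg L) (y : YL D) : points (extend_scalars L A) D :=
  generic_fibre M (restr (in_alg L) D) (gmap (model M) (projT1 (hY D y)) u).
have uD_nat (D D' : kalg L) (g : hom D D') (y : YL D) :
    uD D' (fmap g y) = gmap (extend_scalars L A) g (uD D y).
  rewrite /uD -[RHS]/(gmap A (restr_hom (in_alg L) g) (generic_fibre M
    (restr (in_alg L) D) (gmap (model M) (projT1 (hY D y)) u))).
  rewrite -generic_fibre_nat; congr (generic_fibre M _ _).
  pose gR : hom (DR D) (DR D') := restr_hom (incl Rp) (restr_hom (in_alg L) g).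
  change (gmap (model M) (projT1 (hY D' (fmap g y))) u =
    gmap (model M) gR (gmap (model M) (projT1 (hY D y)) u)).
  rewrite gmapM; apply: gmap_ext => x.
  have [h1b _] := projT2 (hY D y); have [_ h2u] := projT2 (hY D' (fmap g y)).
  apply/esym; move: x; apply: (h2u (comp_hom gR (projT1 (hY D y)))).
  by move=> i; rewrite /= h1b.
pose um : morphism YL (extend_scalars L A) :=
  @Morphism L YL (extend_scalars L A) uD uD_nat.
have Yscheme : is_scheme Y by exact: solutions_scheme.
have Ysm : is_smooth Y by split=> //; exact: solutions_cover.
have [w [wE _]] := neron_mapping N Yscheme Ysm um.
have [d ds] : exists d : local_ring P, d * to_local P s0 = 1.
  have [|d dE] := @local_elt _ P (incl _ s0)^-1.
    apply: local_inv; first exact/local_int/inclP.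
    by move=> /(in_max_int (inclP s0))/in_primeP.
  exists d; apply: incl_inj; rewrite rmorphM dE rmorph1 mulVf //.
  exact: (@notin_prime_neq0 _ P).
pose kL : kalg 'O_L := KAlg (to_local P).
pose kk : kalg 'O_L := KAlg rO.
pose rk : hom kL kk := @Hom 'O_L kL kk rho (fun=> erefl).
pose iL : hom kL (restr (incl 'O_L) (self L)) :=
  @Hom 'O_L kL (restr (incl 'O_L) (self L)) (incl (local_ring P)) (fun=> erefl).
have yP (h : hom B RL) j : speval tO tR s0 (D := kL) (h \o b) d (f j) = 0.
  rewrite (@speval_peval _ _ _ tO tR _ (local_ring P) tO tR) //.
  by rewrite -[LHS](peval_hom h) bf rmorph0.
pose y (h : hom B RL) : Y kL :=
  exist _ (spread_point (h \o b) d) (@spread_pointP _ _ _ tO tR _ _ f kL s0 (h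
  \o b) d ds (yP h)).
have y_red : fmap rk (y f0) = fmap rk (y g0).
  apply: solution_eq => i; rewrite /= /spread_point.
  by case: unliftP => [j _|_] //=; apply: f0g0.
(* The image under w of the point of Y defined by h is the section N': both extend Qh to the local
   ring, and the Neron model is separated. *)
have wy (h : hom B RL) (Qh : points A (restr (in_alg L) (self L))) (N' : neron
  N (self 'O_L)) :
    generic_fibre M (restr (in_alg L) (self L))
      (gmap (model M) (gen_hom pP) (gmap (model M) h u)) = Qh ->
    @extends L (extend_scalars L A) N N' Qh ->
      w kL (y h) = fmap (str_hom kL) N'.
  move=> hQ N'Q.
  have iL_inj : injective (@fmap _ (neron N) _ _ iL).
    apply: separated_inj; first exact: neron_separated.
    by move=> z z0; apply: incl_inj; rewrite rmorph0.
  apply: iL_inj; apply: (bij_inj (neron_generic_iso N (self L))).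
  rewrite -mor_nat fmapM.
  transitivity Qh; last first.
    have E : fmap (str_hom (restr (incl 'O_L) (self L))) N' =
        fmap (comp_hom iL (str_hom kL)) N' by apply: fmap_ext.
    rewrite -N'Q; exact: (congr1 (fun z => neron_generic N (self L) z) E).
  have -> := wE (self L) (fmap iL (y h)).
  rewrite /= /uD -hQ; congr (generic_fibre M _ _).
  have [_ hu] := projT2 (hY (self L) (fmap iL (y h))).
  change (gmap (model M) (projT1 (hY (self L) (fmap iL (y h)))) u =
    gmap (model M) (gen_hom pP) (gmap (model M) h u)).
  rewrite gmapM; apply: gmap_ext => z; apply/esym; move: z.
  apply: (hu (comp_hom (gen_hom pP) h)) => i.
  by rewrite /= /spread_point liftK.
have kkE (z : neron N (self 'O_L)) :
    fmap (str_hom kk) z = fmap rk (fmap (str_hom kL) z).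
  by rewrite fmapM; apply: fmap_ext.
rewrite -[LHS]/(fmap (str_hom kk) Q') -[RHS]/(fmap (str_hom kk) O') !kkE.
rewrite -(wy f0 Q Q' f0Q Q'Q) -(wy g0 0 O' _ O'0);
  first by rewrite -!mor_nat y_red.
rewrite -[gmap _ g0 u]/(fmap g0 u) g0u.
by rewrite (raddf0 (gmap (model M) (gen_hom pP))) raddf0.
Qed.

End Neron.

Theorem theorem1 (K : fieldExtType rat) (A : group_functor K)
    (HA : abelian_scheme A)
    (HAK : forall x : points A (self K), x = 0)
    (p : finite_prime K) (M : good_model A p)
    (kp : fieldType) (rp : {rmorphism local_ring p -> kp})
    (Hrp : is_residue_field p (rp \o to_local p))
    (L : fieldExtType K) (m : nat) (Hm : \dim {:L} = m)
    (Hram : totally_ramified L p)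
    (n : nat) (Hn : ([set: points (model M) (KAlg rp)] #= `I_n)%card)
    (Hcoprime : coprime n m) :
  exists (P : finite_prime L) (Pp : lies_over p P),
    [/\ forall P' : finite_prime L, lies_over p P' -> P' = P,
        forall (C : completion P) (kP : fieldType)
            (rP : {rmorphism valuation_ring C -> kP}),
          is_residue_field P (rP \o to_valuation_ring C) ->
          forall Q : points (extend_scalars L A) (self L),
            kernel_of_reduction M Pp rP
              (gmap (extend_scalars L A) (str_hom (KAlg (cemb C))) Q)
      & forall (N : neron_model (extend_scalars L A))
            (S : set (place L)), ~ S (FinitePlace P) ->
          punctured_integral_points N S = set0].
Proof.
subst m; have [P pP] := Hram.
have Pp := ramified_lies_over pP (rat_ext_number_field K).
exists P, Pp; split.
- exact: ramified_unique pP (tower_number_field L).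
- by move=> C kP rP; apply: (points_in_kernel HA HAK Hrp pP Hn Hcoprime Pp).
- by move=> N S; apply: (no_integral_points HA HAK Hrp pP Hn Hcoprime).
Qed.
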